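(* Let $D>0$ and $c_0>0$ with $c_0\neq 1$. Consider the system $$\dot{\vartheta}(t)=\int_0^D u(y,t)\,dy,\qquad \partial_{tt}u(x,t)=\partial_{xx}u(x,t),\qquad \partial_x u(0,t)=0,\qquad u(D,t)=U(t),$$ with $\vartheta(t)\in\mathbb{R}$, $x\in[0,D]$, $t\ge 0$, in closed loop with the controller $$U(t)=\overline{K}Z(t)-c_0\int_0^D\partial_t u(y,t)\,dy,$$ where $$Z(t)=\vartheta(t)-g'(D)c_0\int_0^D u(y,t)\,dy+\int_0^D g(y)\,\partial_t u(y,t)\,dy,\qquad g(y)=\frac{D^2-y^2}{2}.$$ Suppose $\overline{K}$ is a negative scalar such that $\lambda:=g'(D)\overline{K}>0$ satisfies $$\lambda\neq\frac{1}{2D}\ln\left(-\frac{1+c_0}{1-c_0}\right).$$ Then, for any initial condition $u(\cdot,0)\in H^1(0,D)$ and $\partial_t u(\cdot,0)\in L^2(0,D)$, the closed-loop system has a unique solution $(\vartheta(t),u(\cdot,t),\partial_t u(\cdot,t))\in C\big([0,\infty),\mathbb{R}\times H^1(0,D)\times L^2(0,D)\big)$, which is exponentially stable in the sense that there exist positive constants $\kappa$ and $\rho$ such that $$\Omega(t)\le\kappa\,\Omega(0)\,e^{-\rho t}\quad\text{for all } t\ge 0,\qquad \Omega(t)=|\vartheta(t)|^2+\|\partial_x u(t)\|^2+\|\partial_t u(t)\|^2.$$ Moreover, if the initial condition $(u(\cdot,0),\partial_t u(\cdot,0))$ is compatible with the controller and belongs to $H^2(0,D)\times H^1(0,D)$,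 then $(\vartheta(t),u(\cdot,t),\partial_t u(\cdot,t))\in C\big([0,\infty),\mathbb{R}\times H^1(0,D)\times L^2(0,D)\big)$ is the classical solution of the closed-loop system.
   Context: $\|\cdot\|$ denotes the $L_2([0,D])$ norm in the spatial variable: $\|u(t)\|^2=\int_0^D u^2(x,t)\,dx$. Here $g'(D)=-D$. The condition on $\lambda$ is regarded as void when the argument of the logarithm is negative (i.e. when $0<c_0<1$). Compatibility of the initial condition with the controller means that it is consistent with the boundary conditions of the closed-loop system, in particular with $u(D,t)=U(t)$, $U$ being the feedback law in the claim.
   Formalization: The initial condition is also required to satisfy u(D,0)=U(0), without which no solution continuous in R×H^1×L^2 exists (e.g. ϑ(0)=0, u=1, u_t=0); for H^2×H^1 data, compatible with the controller means u_x(0,0)=0, u(D,0)=U(0) and u_t(D,0)=U'(0). *)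

(* Defs.v *)
From HB Require Import structures.
From mathcomp Require Export all_boot all_order all_algebra.
From mathcomp Require Export all_classical all_reals all_analysis.
Set Implicit Arguments.
Unset Strict Implicit.
Unset Printing Implicit Defensive.
Import Order.TTheory GRing.Theory Num.Theory.
Export numFieldNormedType.Exports.
Local Open Scope classical_set_scope.
Local Open Scope ring_scope.

Section Sobolev.
Context {R : realType}.
Implicit Types (D : R) (f df ddf : R -> R).

Definition intD D f : R := \int[lebesgue_measure]_(x in `[0, D]) f x.

(* Elements of L^2(0,D) are represented by functions on R; the values outside
   [0,D] are irrelevant. *)
Definition isL2 D f : Prop := f \_ `[0, D] \in Lfun lebesgue_measure 2%:E.

Definition normL2 D f : R := Num.sqrt (intD D (fun x => f x ^+ 2)).

(* C^1_c(]0,D[) *)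
Definition test_fun D (phi : R -> R) : Prop :=
  [/\ forall x, derivable phi x 1,
      continuous (derive1 phi) &
      exists a b : R, [/\ 0 < a, b < D & forall x, phi x != 0 -> a <= x <= b]].

Definition is_weak_derivative D f df : Prop :=
  forall phi, test_fun D phi ->
    intD D (fun x => f x * derive1 phi x) = - intD D (fun x => df x * phi x).

(* f is in H^1(0,D) with weak derivative df (determined a.e.).  The class is
   represented by its continuous representative on [0,D], so that the traces
   f 0 and f D are plain evaluations. *)
Definition isH1 D f df : Prop :=
  [/\ {within `[0, D], continuous f}, isL2 D f, isL2 D df &
      is_weak_derivative D f df].

Definition isH2 D f df ddf : Prop := isH1 D f df /\ isH1 D df ddf.

Definition normH1 D f df : R :=
  Num.sqrt (normL2 D f ^+ 2 + normL2 D df ^+ 2).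

End Sobolev.

Section Time.
Context {R : realType}.

(* s -> t with s != t in the half-line [0,+oo[; one-sided when t = 0 *)
Definition in_time (t : R) : set_system R := within [set s | 0 <= s] t^'.

Definition derives (f : R -> R) (t l : R) : Prop :=
  (s - t)^-1 * (f s - f t) @[s --> in_time t] --> l.

(* Continuity and derivatives in time of f : R -> (R -> R), t |-> f t, in the
   L^2 and H^1 norms; df t is the spatial weak derivative of f t. *)
Definition contL2 (D : R) (f : R -> R -> R) (t : R) : Prop :=
  normL2 D (fun x => f s x - f t x) @[s --> in_time t] --> 0.

Definition contH1 (D : R) (f df : R -> R -> R) (t : R) : Prop :=
  normH1 D (fun x => f s x - f t x) (fun x => df s x - df t x)
    @[s --> in_time t] --> 0.

Definition derivesL2 (D : R) (f : R -> R -> R) (t : R) (l : R -> R) : Prop :=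
  normL2 D (fun x => (s - t)^-1 * (f s x - f t x) - l x)
    @[s --> in_time t] --> 0.

Definition derivesH1 (D : R) (f df : R -> R -> R) (t : R) (l dl : R -> R) :
    Prop :=
  normH1 D (fun x => (s - t)^-1 * (f s x - f t x) - l x)
           (fun x => (s - t)^-1 * (df s x - df t x) - dl x)
    @[s --> in_time t] --> 0.

End Time.

Section ClosedLoop.
Context {R : realType}.
Variables (D c0 K : R).

Definition g (y : R) : R := (D ^+ 2 - y ^+ 2) / 2.

(* In a state (th, u, v), v stands for the time derivative of u. *)
Definition Zstate (th : R) (u v : R -> R) : R :=
  th - derive1 g D * c0 * intD D u + intD D (fun y => g y * v y).

Definition feedback (th : R) (u v : R -> R) : R :=
  K * Zstate th u v - c0 * intD D v.

Definition Omega (th : R) (ux v : R -> R) : R :=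
  th ^+ 2 + normL2 D ux ^+ 2 + normL2 D v ^+ 2.

(* (th, u, v) in C([0,oo), R x H^1 x L^2), ux t being a weak derivative of u t *)
Definition C_state (th : R -> R) (u ux v : R -> R -> R) : Prop :=
  forall t, 0 <= t ->
    [/\ isH1 D (u t) (ux t), isL2 D (v t),
        th s @[s --> in_time t] --> th t, contH1 D u ux t & contL2 D v t].

(* Finite-energy solution.  The wave equation and the Neumann condition at 0
   hold in variational form: the test functions psi range over the elements of
   H^1(0,D) vanishing at the Dirichlet end D only. *)
Definition solution (th : R -> R) (u ux v : R -> R -> R) : Prop :=
  C_state th u ux v /\
  forall t, 0 <= t ->
    [/\ derives th t (intD D (u t)),
        derivesL2 D u t (v t),
        forall psi dpsi, isH1 D psi dpsi -> psi D = 0 ->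
          derives (fun s => intD D (fun x => v s x * psi x)) t
                  (- intD D (fun x => ux t x * dpsi x)) &
        u t D = feedback (th t) (u t) (v t)].

(* Classical solution in the sense of the abstract Cauchy problem in
   R x H^1 x L^2: C^1 in time with values in the state space, with values in the
   domain R x H^2 x H^1 (and boundary conditions), all equations holding at
   every time. *)
Definition classical_solution (th : R -> R) (u ux v : R -> R -> R) : Prop :=
  exists uxx vx : R -> R -> R, forall t, 0 <= t ->
    [/\ [/\ isH2 D (u t) (ux t) (uxx t) & isH1 D (v t) (vx t)],
        [/\ derives th t (intD D (u t)),
            derivesH1 D u ux t (v t) (vx t) &
            derivesL2 D v t (uxx t)],
        contH1 D v vx t /\ contL2 D uxx t &
        ux t 0 = 0 /\ u t D = feedback (th t) (u t) (v t)].

(* H^2 x H^1 data consistent with the boundary conditions.  Both sides of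
   u(D,t) = U(t) must agree at t = 0 together with their time derivatives: since
   v is in H^1 the trace v(D) is defined, and along the equations the time
   derivative of the state (th, u, v) is (int u, v, u_xx), while feedback is
   linear. *)
Definition compatible (th0 : R) (u0 v0 : R -> R) : Prop :=
  exists u0x u0xx v0x : R -> R,
    [/\ isH2 D u0 u0x u0xx, isH1 D v0 v0x, u0x 0 = 0,
        u0 D = feedback th0 u0 v0 &
        v0 D = feedback (intD D u0) v0 u0xx].

Definition starts_at (th : R -> R) (u v : R -> R -> R)
    (th0 : R) (u0 v0 : R -> R) : Prop :=
  [/\ th 0 = th0, {in `[0, D], u 0 =1 u0} &
      {ae lebesgue_measure, forall x : R, x \in `[0, D] -> v 0 x = v0 x}].

End ClosedLoop.

(* Main.v *)
Require Import Defs.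
From mathcomp Require Import measurable_realfun ring lra.
Import Order.TTheory GRing.Theory Num.Theory.
Local Open Scope classical_set_scope.
Local Open Scope ring_scope.
Set Implicit Arguments.
Unset Strict Implicit.
Unset Printing Implicit Defensive.

(** Put a = D K, which is negative. The weight g vanishes at D and has
    derivative - y; integration by parts therefore gives Z' = a Z for every
    solution ([derives_Z]), so that Z(t) = Z(0) exp(a t) and the feedback law
    becomes u(D, t) + c0 int u_t = K Z(0) exp(a t), a damped boundary condition
    with a known forcing.

    Existence. The waves u(x, t) = F(t + x) + F(t - x) satisfy the wave equation
    and the Neumann condition, and the boundary condition at D becomes the
    reflection law
      (1 + c0) F(t + D) + (1 - c0) F(t - D) = K Z(0) exp(a t),
    while theta is determined by Z ([wave_th], [wave_solution]). The data
    prescribe F on [- D, D] ([init_profile]), and the reflection law propagates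
    it. The condition on lambda says that exp(a t) is not a resonance
    ([resonance_neq0]); then F is a multiple of exp(a t) plus a quasi-periodic
    function, multiplied by r = - (1 - c0) / (1 + c0) over each length 2 D
    ([osc]). The feedback law for the data is exactly what makes F continuous at
    the joints, hence locally H^1. For compatible H^2 data the derivative of F
    matches as well ([global_dprofile_prim]), and the solution is classical.
    Differentiability in time of the waves, in L^2, comes from the continuity of
    translations ([translation_continuous], [increment_bound]).

    Stability. |u_x|^2 + |u_t|^2 is twice the integral of F'^2 over the moving
    window [t - D, t + D] ([wave_energy]). The exponential part of F' decays as
    a < 0, the quasi-periodic part because 0 < r^2 < 1 ([window_decay]; r is
    not zero since c0 is not 1), and theta and Z control each other up to the
    wave energy ([th_Z_bounds]).

    Uniqueness. The difference of two solutions with the same data has Z = 0,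
    and with P(x, t) = int_0^x u_t the energy |u|^2 + |P|^2 has derivative
    - 2 c0 (int u_t)^2 ([weak_solution_zero]); the variational equation says
    weakly, and then strongly ([weak_to_strong]), that P_t = u_x.

    Elements of H^1 are handled as primitives of square-integrable functions
    ([prim], [isH1P]), for which gluing, translation and integration by parts
    are elementary. *)

(** * Square-integrable functions on an interval *)

Section SquareIntegrable.
Context {R : realType}.
Implicit Types (a b c r s t D : R) (f g h F G H : R -> R).
Local Notation mu := (@lebesgue_measure R).

Definition itg a b f : R := \int[mu]_(x in `[a, b]) f x.

Definition L1 a b f : Prop := mu.-integrable `[a, b] (EFin \o f).

(** Square-integrable functions are given by total functions, so that sums
    and products are written pointwise; measurability is kept apart since a
    square can be measurable when its root is not. *)
Definition L2 a b f : Prop :=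
  measurable_fun `[a, b] f /\ L1 a b (fun x => f x ^+ 2).

Lemma L1_meas a b f : L1 a b f -> measurable_fun `[a, b] f.
Proof. by move=> /measurable_int/measurable_EFinP. Qed.

Lemma eq_L1 a b f g : (forall x, a <= x <= b -> f x = g x) -> L1 a b f -> L1 a b g.
Proof.
move=> fg; apply: eq_integrable => //= x; rewrite inE/= in_itv/= => xab.
by rewrite fg.
Qed.

Lemma eq_itg a b f g : (forall x, a <= x <= b -> f x = g x) ->
  itg a b f = itg a b g.
Proof.
by move=> fg; apply: eq_Rintegral => x; rewrite inE/= in_itv/= => /fg.
Qed.

Lemma eq_L2 a b f g : (forall x, a <= x <= b -> f x = g x) -> L2 a b f -> L2 a b g.
Proof.
move=> fg [mf sf]; split.
  apply: eq_measurable_fun mf => x; rewrite inE/= in_itv/=; exact: fg.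
by apply: eq_L1 sf => x /fg ->.
Qed.

Lemma L1D a b f g : L1 a b f -> L1 a b g -> L1 a b (fun x => f x + g x).
Proof. by move=> lf lg; have := integrableD _ lf lg; apply. Qed.

Lemma L1Z a b f r : L1 a b f -> L1 a b (fun x => r * f x).
Proof. by move=> lf; have := integrableZl _ r lf; apply. Qed.

Lemma L1N a b f : L1 a b f -> L1 a b (fun x => - f x).
Proof. by move=> /(L1Z (-1)); apply: eq_L1 => x _; rewrite mulN1r. Qed.

Lemma L1B a b f g : L1 a b f -> L1 a b g -> L1 a b (fun x => f x - g x).
Proof. by move=> lf /L1N lg; exact: L1D. Qed.

Lemma L1_le a b f g : measurable_fun `[a, b] f -> L1 a b g ->
  (forall x, a <= x <= b -> `|f x| <= g x) -> L1 a b f.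
Proof.
move=> mf lg fg; apply: (le_integrable _ _ _ lg) => //.
  exact/measurable_EFinP.
move=> x /=; rewrite in_itv/= => /fg h; rewrite lee_fin.
by rewrite (le_trans h)// ler_norm.
Qed.

Lemma itgD a b f g : L1 a b f -> L1 a b g ->
  itg a b (fun x => f x + g x) = itg a b f + itg a b g.
Proof. exact: RintegralD. Qed.

Lemma itgB a b f g : L1 a b f -> L1 a b g ->
  itg a b (fun x => f x - g x) = itg a b f - itg a b g.
Proof. exact: RintegralB. Qed.

Lemma itgZ a b f r : L1 a b f -> itg a b (fun x => r * f x) = r * itg a b f.
Proof. by move=> ?; exact: RintegralZl. Qed.

Lemma itgN a b f : L1 a b f -> itg a b (fun x => - f x) = - itg a b f.
Proof.
move=> lf; rewrite -mulN1r -itgZ//.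
by apply: eq_itg => x _; rewrite mulN1r.
Qed.

Lemma itg_ge0 a b f : (forall x, a <= x <= b -> 0 <= f x) -> 0 <= itg a b f.
Proof. by move=> f0; apply: Rintegral_ge0 => x /=; rewrite in_itv/=; exact: f0. Qed.

Lemma le_itg a b f g : L1 a b f -> L1 a b g ->
  (forall x, a <= x <= b -> f x <= g x) -> itg a b f <= itg a b g.
Proof.
by move=> lf lg fg; apply: le_Rintegral => // x /=; rewrite in_itv/=; exact: fg.
Qed.

Lemma L1_norm a b f : L1 a b f -> L1 a b (fun x => `|f x|).
Proof. by move=> lf; exact: integrable_norm. Qed.

Lemma itg_cst a b r : a <= b -> itg a b (fun=> r) = r * (b - a).
Proof.
move=> ab; rewrite /itg Rintegral_cst//= lebesgue_measure_itv/= lte_fin.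
by move: ab; rewrite le_eqVlt => /predU1P[->|->//]; rewrite ltxx subrr.
Qed.

Lemma itg_cst0 a b : itg a b (fun=> 0) = 0.
Proof. by rewrite /itg Rintegral_cst// mul0r. Qed.

Lemma itg_point a f : itg a a f = 0.
Proof. by rewrite /itg set_itv1 Rintegral_set1. Qed.

Lemma L1_cst a b r : L1 a b (fun=> r).
Proof.
apply: (@measurable_bounded_integrable _ _ _ mu (fun=> r)) => //.
  by rewrite /= lebesgue_measure_itv/=; case: ifP => _; rewrite ?ltry.
by exists `|r|; split; rewrite ?num_real// => M rM x _ /=; exact: ltW.
Qed.

Lemma subitv a b c d : a <= c -> d <= b -> `[c, d] `<=` `[a, b].
Proof.
move=> ac db x /=; rewrite !in_itv/= => /andP[cx xd].
by rewrite (le_trans ac)//= (le_trans xd).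
Qed.

Lemma L1S a b c d f : a <= c -> d <= b -> L1 a b f -> L1 c d f.
Proof. by move=> ac db; apply: integrableS => //; exact: subitv. Qed.

Lemma L2S a b c d f : a <= c -> d <= b -> L2 a b f -> L2 c d f.
Proof.
move=> ac db [mf sf]; split; last exact: L1S sf.
by apply: measurable_funS mf => //; exact: subitv.
Qed.

(** Two closed intervals overlap in a point, which has measure zero. *)
Lemma itg_cat a b c f : a <= b -> b <= c -> L1 a c f ->
  itg a c f = itg a b f + itg b c f.
Proof.
move=> ab bc lf; rewrite {1 3}/itg; apply/eqP.
rewrite addrC -subr_eq; apply/eqP.
rewrite Rintegral_itvB//= ?bnd_simp//.
rewrite Rintegral_itv_obnd_cbnd//.
by apply: integrableS lf => //; apply: subset_itvr; rewrite bnd_simp.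
Qed.

Lemma L1_cat a b c f : a <= b -> b <= c -> L1 a b f -> L1 b c f -> L1 a c f.
Proof.
move=> ab bc lf lg.
rewrite /L1 (@itv_bndbnd_setU _ _ _ (BLeft b)) ?bnd_simp//.
have m1 : measurable_fun (`[a, b[ `|` `[b, c]) f.
  apply/measurable_funU => //; split; last exact: L1_meas.
  by apply: (measurable_funS _ _ (L1_meas lf)) => //; exact: subset_itv_co_cc.
apply/integrableP; split; first exact/measurable_EFinP.
rewrite ge0_integral_setU//=; last 2 first.
- exact/measurableT_comp/measurableT_comp.
- apply/disj_setPS => y [/=]; rewrite 2!in_itv/= => /andP[_ yb] /andP[].
  by rewrite leNgt yb.
move/integrableP : lg => [_ lg].
have /integrableP[_ lf'] : mu.-integrable `[a, b[ (EFin \o f).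
  by apply: integrableS lf => //; exact: subset_itv_co_cc.
exact: lte_add_pinfty.
Qed.

Lemma L2_meas a b f : L2 a b f -> measurable_fun `[a, b] f.
Proof. by case. Qed.

Lemma L2_sqr a b f : L2 a b f -> L1 a b (fun x => f x ^+ 2).
Proof. by case. Qed.

Lemma L2_cat a b c f : a <= b -> b <= c -> L2 a b f -> L2 b c f -> L2 a c f.
Proof.
move=> ab bc [mf sf] [mg sg]; split; last exact: L1_cat sf sg.
have -> : `[a, c]%classic = `[a, b[ `|` `[b, c].
  by rewrite (@itv_bndbnd_setU _ _ _ (BLeft b)) ?bnd_simp.
apply/measurable_funU => //; split => //.
by apply: (measurable_funS _ _ mf) => //; exact: subset_itv_co_cc.
Qed.

Lemma L2M a b f g : L2 a b f -> L2 a b g -> L1 a b (fun x => f x * g x).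
Proof.
move=> [mf sf] [mg sg].
apply: (@L1_le _ _ _ (fun x => f x ^+ 2 + g x ^+ 2)); last 2 first.
- exact: L1D.
- move=> x _; rewrite ler_norml; apply/andP; split.
    by have := sqr_ge0 (f x + g x); have := sqr_ge0 (f x);
       have := sqr_ge0 (g x); rewrite sqrrD -mulr_natl; lra.
  by have := sqr_ge0 (f x - g x); have := sqr_ge0 (f x);
     have := sqr_ge0 (g x); rewrite sqrrB -mulr_natl; lra.
exact: measurable_funM.
Qed.

Lemma L2_bounded a b f M : measurable_fun `[a, b] f ->
  (forall x, a <= x <= b -> `|f x| <= M) -> L2 a b f.
Proof.
move=> mf fM; split => //.
apply: (@L1_le _ _ _ (fun=> M ^+ 2)); last 2 first.
- exact: L1_cst.
- move=> x /fM h; rewrite ger0_norm ?sqr_ge0// -(ger0_norm (sqr_ge0 _)) normrX.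
  by rewrite ler_sqr// nnegrE (le_trans _ h).
exact: measurable_funX.
Qed.

Lemma L2_cst a b r : L2 a b (fun=> r).
Proof. by apply: (@L2_bounded _ _ _ `|r|) => //; exact: measurable_cst. Qed.

Lemma L2_L1 a b f : L2 a b f -> L1 a b f.
Proof.
by move=> /L2M /(_ (L2_cst a b 1)); apply: eq_L1 => x _; rewrite mulr1.
Qed.

Lemma L2D a b f g : L2 a b f -> L2 a b g -> L2 a b (fun x => f x + g x).
Proof.
move=> lf lg; have := L2M lf lg; case: lf lg => [mf sf] [mg sg] sfg.
split; first exact: measurable_funD.
have := L1D (L1D sf sg) (L1Z 2 sfg); apply: eq_L1 => x _; ring.
Qed.

Lemma L2Z a b f r : L2 a b f -> L2 a b (fun x => r * f x).
Proof.
move=> [mf sf]; split; first exact: measurable_funM.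
by have := L1Z (r ^+ 2) sf; apply: eq_L1 => x _; rewrite exprMn.
Qed.

Lemma L2N a b f : L2 a b f -> L2 a b (fun x => - f x).
Proof. by move=> /(L2Z (-1)); apply: eq_L2 => x _; rewrite mulN1r. Qed.

Lemma L2B a b f g : L2 a b f -> L2 a b g -> L2 a b (fun x => f x - g x).
Proof. by move=> lf /L2N lg; exact: L2D. Qed.

Lemma L2_continuous a b f : {within `[a, b], continuous f} -> L2 a b f.
Proof.
move=> cf.
have mf : measurable_fun `[a, b] f by exact: subspace_continuous_measurable_fun.
have [M [_ mrt]] := compact_bounded (continuous_compact cf (@segment_compact _ a b)).
apply: (@L2_bounded _ _ _ (M + 1)) => // x xab.
by apply: (mrt (M + 1)); [rewrite ltrDl|exists x].
Qed.

(** The discriminant of the nonnegative quadratic polynomial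
    t |-> |f + t g|^2 is nonpositive. *)
Lemma cauchy_schwarz a b f g : L2 a b f -> L2 a b g ->
  itg a b (fun x => f x * g x) ^+ 2 <=
  itg a b (fun x => f x ^+ 2) * itg a b (fun x => g x ^+ 2).
Proof.
move=> lf lg.
set A := itg a b (fun x => f x ^+ 2).
set C := itg a b (fun x => g x ^+ 2).
set B := itg a b (fun x => f x * g x).
have C0 : 0 <= C by apply: itg_ge0 => x _; exact: sqr_ge0.
have pos t : 0 <= A + 2 * t * B + t ^+ 2 * C.
  have -> : A + 2 * t * B + t ^+ 2 * C = itg a b (fun x => (f x + t * g x) ^+ 2).
    have sf := L2_sqr lf; have sg := L2_sqr lg; have sfg := L2M lf lg.
    rewrite -itgZ// -itgZ// -itgD//; last exact: L1Z.
    rewrite -itgD//; [|by apply: L1D => //; exact: L1Z|exact: L1Z].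
    by apply: eq_itg => x _; ring.
  by apply: itg_ge0 => x _; exact: sqr_ge0.
have [C00|Cn0] := eqVneq C 0.
  rewrite C00 mulr0.
  have [->|Bn0] := eqVneq B 0; first by rewrite expr0n.
  have := pos (- (A + 1) / (2 * B)); rewrite C00 mulr0 addr0.
  have -> : 2 * (- (A + 1) / (2 * B)) * B = - (A + 1) by field.
  lra.
have := pos (- B / C).
have -> : A + 2 * (- B / C) * B + (- B / C) ^+ 2 * C = (A * C - B ^+ 2) / C.
  by field.
have Cp : 0 < C by rewrite lt_neqAle eq_sym Cn0.
by rewrite pmulr_lge0 ?invr_gt0// subr_ge0.
Qed.

Lemma lebesgue_measure_shift c (A : set R) : measurable A ->
  pushforward mu ((fun x => x + c) : _ -> measurableTypeR R) A = mu A.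
Proof.
have mc : measurable_fun [set: measurableTypeR R]
    ((fun x => x + c) : _ -> measurableTypeR R) by exact: measurable_funD.
move=> mA; apply/esym/lebesgue_measure_unique => //= _ [[x y]] _ <-.
rewrite /pushforward /=.
have -> : (fun x => x + c) @^-1` `]x, y]%classic = `]x - c, y - c]%classic.
  by apply/seteqP; split=> z /=; rewrite !in_itv/= ltrBlDr lerBrDr.
rewrite !lebesgue_measure_itv/= !lte_fin ltrD2r.
by case: ifP => // _; rewrite -!EFinB; congr EFin; ring.
Qed.

Lemma itgE a b f : itg a b f = \int[mu]_x (f \_ `[a, b]) x.
Proof. by rewrite /itg Rintegral_mkcond. Qed.

Lemma L1E a b f : L1 a b f <-> mu.-integrable setT (EFin \o (f \_ `[a, b])).
Proof. by rewrite /L1 integrable_mkcond// restrict_EFin. Qed.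

(** A measurable map that preserves the measure transports integrals; it is
    applied to x |-> x + c and to x |-> - x. *)
Lemma itg_transport (phi : R -> R) a b c d f :
  measurable_fun setT (phi : measurableTypeR R -> measurableTypeR R) ->
  (forall A, measurable A ->
    pushforward mu (phi : measurableTypeR R -> measurableTypeR R) A = mu A) ->
  (forall x, (a <= x <= b) = (c <= phi x <= d)) ->
  L1 c d f ->
  L1 a b (f \o phi) /\ itg a b (f \o phi) = itg c d f.
Proof.
move=> mphi muphi abcd lf.
have Eab g : (g \o phi) \_ `[a, b] = (g \_ `[c, d]) \o phi.
  apply/funext => x /=; rewrite !patchE.
  congr (if _ then _ else _); apply/idP/idP; rewrite !inE/= !in_itv/=;
  by rewrite abcd.
have mf : measurable_fun setT (EFin \o (f \_ `[c, d])).
  by move/L1E/measurable_int : lf.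
have intf : mu.-integrable setT ((EFin \o (f \_ `[c, d])) \o phi).
  apply/integrableP; split; first exact: measurableT_comp.
  have -> : (\int[mu]_x `|((EFin \o (f \_ `[c, d])) \o phi) x| =
    \int[pushforward mu (phi : measurableTypeR R -> measurableTypeR R)]_x
      `|(EFin \o (f \_ `[c, d])) x|)%E.
    rewrite ge0_integral_pushforward//.
    exact: measurableT_comp.
  rewrite (eq_measure_integral mu); last by move=> A mA _; exact: muphi.
  by move/L1E/integrableP : lf => [].
split; first by apply/L1E; rewrite Eab.
rewrite !itgE /Rintegral Eab; congr fine.
transitivity (\int[pushforward mu (phi : measurableTypeR R -> measurableTypeR R)]_x
      (EFin \o (f \_ `[c, d])) x)%E.
  by rewrite (integral_pushforward mphi).
by apply: eq_measure_integral => A mA _; exact: muphi.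
Qed.

Lemma measurable_shift c : measurable_fun setT
  ((fun x => x + c) : measurableTypeR R -> measurableTypeR R).
Proof. exact: measurable_funD. Qed.

Lemma L1_shift a b c f : L1 (a + c) (b + c) f -> L1 a b (fun x => f (x + c)).
Proof.
move=> lf; apply: (@itg_transport (fun x => x + c) _ _ _ _ _ _ _ _ lf).1 => //.
- exact: measurable_shift.
- exact: lebesgue_measure_shift.
- by move=> x; rewrite !lerD2r.
Qed.

Lemma itg_shift a b c f : L1 (a + c) (b + c) f ->
  itg a b (fun x => f (x + c)) = itg (a + c) (b + c) f.
Proof.
move=> lf; apply: (@itg_transport (fun x => x + c) _ _ _ _ _ _ _ _ lf).2 => //.
- exact: measurable_shift.
- exact: lebesgue_measure_shift.
- by move=> x; rewrite !lerD2r.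
Qed.

Lemma L1_opp a b f : L1 (- b) (- a) f -> L1 a b (fun x => f (- x)).
Proof.
move=> lf; apply: (@itg_transport (fun x => - x) _ _ _ _ _ _ _ _ lf).1 => //.
- exact: measurable_funN.
- exact: lebesgue_measureN.
- by move=> x; rewrite !lerN2 andbC.
Qed.

Lemma itg_opp a b f : L1 (- b) (- a) f ->
  itg a b (fun x => f (- x)) = itg (- b) (- a) f.
Proof.
move=> lf; apply: (@itg_transport (fun x => - x) _ _ _ _ _ _ _ _ lf).2 => //.
- exact: measurable_funN.
- exact: lebesgue_measureN.
- by move=> x; rewrite !lerN2 andbC.
Qed.

Lemma L2_shift a b c f : L2 (a + c) (b + c) f -> L2 a b (fun x => f (x + c)).
Proof.
move=> lf; split; first exact: L1_meas (L1_shift (L2_L1 lf)).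
by apply: (@L1_shift a b c (fun x => f x ^+ 2)); exact: L2_sqr.
Qed.

Lemma L2_opp a b f : L2 (- b) (- a) f -> L2 a b (fun x => f (- x)).
Proof.
move=> lf; split; first exact: L1_meas (L1_opp (L2_L1 lf)).
by apply: (@L1_opp a b (fun x => f x ^+ 2)); exact: L2_sqr.
Qed.

Definition eq_ae_on a b f g : Prop :=
  {ae mu, forall x, x \in `[a, b] -> f x = g x}.

Lemma eq_ae_itg a b f g : eq_ae_on a b f g -> measurable_fun `[a, b] g ->
  L1 a b f -> L1 a b g /\ itg a b f = itg a b g.
Proof.
move=> fg mg lf.
have fgE : ae_eq mu `[a, b]%classic (EFin \o f) (EFin \o g).
  case: fg => N [mN N0 fg]; exists N; split => //; apply: subset_trans fg.
  by apply: subsetC => x fg xab /=; rewrite fg.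
have mgE : measurable_fun `[a, b] (EFin \o g) by exact/measurable_EFinP.
have mfE : measurable_fun `[a, b] (EFin \o f) by move/measurable_int : lf.
split; last by rewrite /itg/Rintegral; congr fine; exact: ae_eq_integral.
apply/integrableP; split => //.
rewrite -(@ae_eq_integral _ _ _ mu _ _ (abse \o (EFin \o f))) //=.
- by move/integrableP : lf => [].
- by apply: (@measurableT_comp _ _ _ _ _ _ abse).
- by apply: (@measurableT_comp _ _ _ _ _ _ abse _ (EFin \o g)).
- case: fg => N [mN N0 fg]; exists N; split => //; apply: subset_trans fg.
  by apply: subsetC => x fg xab /=; rewrite fg.
Qed.

Lemma itg_ae0 a b f : L1 a b f -> eq_ae_on a b f (fun=> 0) -> itg a b f = 0.
Proof.
move=> lf f0; rewrite -(itg_cst0 a b).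
exact: (eq_ae_itg f0 (measurable_cst _) lf).2.
Qed.

Lemma eq_ae_L2 a b f g : eq_ae_on a b f g -> measurable_fun `[a, b] g ->
  L2 a b f -> L2 a b g.
Proof.
move=> fg mg [mf sf]; split=> //.
apply: (@eq_ae_itg _ _ (fun x => f x ^+ 2) _ _ _ sf).1; last exact: measurable_funX.
by case: fg => N [mN N0 fg]; exists N; split => //; apply: subset_trans fg;
  apply: subsetC => x fg /fg ->.
Qed.

(** Functions obtained by gluing agree with their pieces except at the
    joints, that is, except at the end points of an interval. *)
Lemma eq_oo_ae a b f g : (forall x, a < x < b -> f x = g x) -> eq_ae_on a b f g.
Proof.
move=> fg; exists ([set a] `|` [set b]); split.
- exact: measurableU.
- by rewrite measureU0//; exact: lebesgue_measure_set1.
move=> x /= /not_implyP[]; rewrite in_itv/= => /andP[ax xb] nfg.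
apply: contrapT => /not_orP[/eqP xa /eqP xb'].
by apply: nfg; apply: fg; rewrite !lt_neqAle ax xb eq_sym xa xb'.
Qed.

Lemma eq_oo_meas a b f g : (forall x, a < x < b -> f x = g x) ->
  measurable_fun `[a, b] f -> measurable_fun `[a, b] g.
Proof.
move=> fg mf.
have [ab|ba|<-] := ltgtP a b.
- have -> : `[a, b]%classic = ([set a] `|` [set b]) `|` `]a, b[.
    apply/seteqP; split=> x /=; rewrite !in_itv/=; last first.
      by move=> [[->|->]|/andP[/ltW -> /ltW ->]]//; rewrite lexx ltW.
    move=> /andP[ax xb]; have [->|xa] := eqVneq x a; first by left; left.
    have [->|xb'] := eqVneq x b; first by left; right.
    by right; rewrite !lt_neqAle ax xb eq_sym xa xb'.
  apply/measurable_funU => //; first exact: measurableU.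
  split; first by apply/measurable_funU => //; split; exact: measurable_fun_set1.
  apply: (@eq_measurable_fun _ _ _ _ _ f).
    by move=> x; rewrite inE/= in_itv/=; exact: fg.
  by apply: (measurable_funS _ _ mf) => //; exact: subset_itv_oo_cc.
- by rewrite set_itv_ge ?bnd_simp -?ltNge//; exact: measurable_fun_set0.
- by rewrite set_itv1; exact: measurable_fun_set1.
Qed.

Lemma eq_oo_L2 a b f g : (forall x, a < x < b -> f x = g x) -> L2 a b f -> L2 a b g.
Proof.
move=> fg lf; apply: (eq_ae_L2 (eq_oo_ae fg) _ lf).
exact: eq_oo_meas fg (L2_meas lf).
Qed.

Lemma eq_oo_itg a b f g : (forall x, a < x < b -> f x = g x) -> L1 a b f ->
  itg a b f = itg a b g.
Proof.
move=> fg lf; apply: (eq_ae_itg (eq_oo_ae fg) _ lf).2.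
exact: eq_oo_meas fg (L1_meas lf).
Qed.

Lemma itg_sqr_eq0 a b f : L2 a b f -> itg a b (fun x => f x ^+ 2) = 0 ->
  eq_ae_on a b f (fun=> 0).
Proof.
move=> [mf sf] /eqP; rewrite /itg /Rintegral fine_eq0; last exact: integrable_fin_num.
move=> /eqP h.
have m2 : measurable_fun `[a, b] (fun x => (f x ^+ 2)%:E).
  by move/measurable_int : sf.
have [+ _] := ae_eq_integral_abs mu (measurable_itv `[a, b]) m2.
rewrite (_ : integral _ _ _ = 0%E) => [/(_ erefl) h'|]; last first.
  rewrite -[RHS]h; apply: eq_integral => x _.
  by rewrite gee0_abs// lee_fin sqr_ge0.
by apply: filterS h' => x h' /h' []/eqP; rewrite sqrf_eq0 => /eqP.
Qed.

End SquareIntegrable.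

(** * Primitives of square-integrable functions *)

Section Primitives.
Context {R : realType}.
Implicit Types (a b c r s t D : R) (f g h F G H : R -> R).
Local Notation mu := (@lebesgue_measure R).

Lemma L2_L1S a b c d f : a <= c -> d <= b -> L2 a b f -> L1 c d f.
Proof. by move=> ac db /(L2S ac db)/L2_L1. Qed.

(** Both sides integrate f(x) h(y) over the triangle a <= y <= x <= b. This
    gives integration by parts for products of absolutely continuous functions,
    where the fundamental theorem of calculus for C^1 functions does not
    apply. *)
Lemma triangle_fubini a b f h : a <= b -> L1 a b f -> L1 a b h ->
  itg a b (fun x => f x * itg a x h) =
  itg a b (fun y => h y * itg y b f).
Proof.
move=> ab lf lh.
pose f1 := f \_ `[a, b]; pose h1 := h \_ `[a, b].
have if1 : mu.-integrable setT (EFin \o f1) by exact/L1E.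
have ih1 : mu.-integrable setT (EFin \o h1) by exact/L1E.
have mf1 : measurable_fun setT f1 by move/measurable_int : if1 => /measurable_EFinP.
have mh1 : measurable_fun setT h1 by move/measurable_int : ih1 => /measurable_EFinP.
pose k (p : measurableTypeR R * measurableTypeR R) : \bar R :=
  (if p.2 <= p.1 then f1 p.1 * h1 p.2 else 0)%:E.
have mfh : measurable_fun setT
    (fun p : measurableTypeR R * measurableTypeR R => f1 p.1 * h1 p.2).
  by apply: measurable_funM; apply: measurableT_comp.
have mk : measurable_fun setT k.
  apply/measurable_EFinP; apply: measurable_fun_ifT => //.
  exact: measurable_fun_ler.
have ik0 : (mu \x mu)%E.-integrable setT
    (fun p : measurableTypeR R * measurableTypeR R => (f1 p.1 * h1 p.2)%:E).
  apply/integrable12ltyP; first exact/measurable_EFinP.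
  under eq_integral => x _.
    under eq_integral => y _ do rewrite /= normrM EFinM.
    rewrite ge0_integralZl//; last first.
      exact/measurable_EFinP/measurableT_comp.
    over.
  rewrite ge0_integralZr//.
  - move/integrableP : if1 => [_ if1]; move/integrableP : ih1 => [_ ih1].
    by rewrite lte_mul_pinfty ?integral_ge0// ge0_fin_numE// integral_ge0.
  - exact/measurable_EFinP/measurableT_comp.
  - exact: integral_ge0.
have ik : (mu \x mu)%E.-integrable setT k.
  apply: (le_integrable _ _ _ ik0) => // -[x y] _; rewrite /k lee_fin /=.
  by case: ifP => // _; rewrite normr0.
have := Fubini ik.
have -> : (\int[mu]_x \int[mu]_y k (x, y))%E =
    (\int[mu]_x ((fun x => f x * itg a x h) \_ `[a, b] x)%:E)%E.
  apply: eq_integral => x _.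
  rewrite [in RHS]patchE; case: ifPn => xab; last first.
    rewrite [in LHS](_ : (fun y => k (x, y)) = cst 0%E) ?integral0//.
    apply/funext => y; rewrite /k /= /f1 patchE (negbTE xab) mul0r.
    by case: ifP.
  move: xab; rewrite inE/= in_itv/= => /andP[ax xb].
  have -> : (fun y => k (x, y)) =
      (fun y => (f x)%:E * ((h \_ `[a, x]) y)%:E)%E.
    apply/funext => y; rewrite /k /= /f1 /h1 -EFinM; congr EFin.
    have xin : x \in `[a, b]%classic by rewrite inE/= in_itv/= ax xb.
    rewrite !patchE xin.
    have [yx|xy] := leP y x.
      suff -> : (y \in `[a, b]%classic) = (y \in `[a, x]%classic) by [].
      by apply/idP/idP; rewrite !inE/= !in_itv/= => /andP[-> yx'] //=;
        exact: le_trans xb.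
    have -> : (y \in `[a, x]%classic) = false.
      by apply/negbTE/negP; rewrite inE/= in_itv/= (leNgt y x) xy andbF.
    by rewrite mulr0.
  have lhx : L1 a x h by exact: L1S lh.
  rewrite integralZl//; last by exact/L1E.
  rewrite EFinM itgE /Rintegral fineK//.
  by apply: integrable_fin_num => //; exact/L1E.
have -> : (\int[mu]_y \int[mu]_x k (x, y))%E =
    (\int[mu]_y ((fun y => h y * itg y b f) \_ `[a, b] y)%:E)%E.
  apply: eq_integral => y _.
  rewrite [in RHS]patchE; case: ifPn => yab; last first.
    rewrite [in LHS](_ : (fun x => k (x, y)) = cst 0%E) ?integral0//.
    apply/funext => x; rewrite /k /= /h1 patchE (negbTE yab) mulr0.
    by case: ifP.
  move: yab; rewrite inE/= in_itv/= => /andP[ay yb].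
  have -> : (fun x => k (x, y)) =
      (fun x => (h y)%:E * ((f \_ `[y, b]) x)%:E)%E.
    apply/funext => x; rewrite /k /= /f1 /h1 -EFinM; congr EFin.
    have yin : y \in `[a, b]%classic by rewrite inE/= in_itv/= ay yb.
    rewrite !patchE yin.
    rewrite mulrC; have [yx|xy] := leP y x.
      suff -> : (x \in `[a, b]%classic) = (x \in `[y, b]%classic) by [].
      by apply/idP/idP; rewrite !inE/= !in_itv/= => /andP[yx' ->] //=;
        rewrite ?yx// (le_trans ay).
    have -> : (x \in `[y, b]%classic) = false.
      by apply/negbTE/negP; rewrite inE/= in_itv/= (leNgt y x) xy.
    by rewrite mulr0.
  have lfy : L1 y b f by exact: L1S lf.
  rewrite integralZl//; last by exact/L1E.
  rewrite EFinM itgE /Rintegral fineK//.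
  by apply: integrable_fin_num => //; exact/L1E.
by move=> eqk; rewrite itgE [RHS]itgE /Rintegral eqk.
Qed.

(** On a bounded interval this is the H^1 relation between a function and its
    weak derivative, in a form that is stable under gluing, translation and
    reflection. For F it is a pointwise statement, so that traces are
    meaningful; f matters only almost everywhere. *)
Definition prim a b F f : Prop :=
  L2 a b f /\ forall x y, a <= x -> x <= y -> y <= b -> F y - F x = itg x y f.

Lemma prim_L2 a b F f : prim a b F f -> L2 a b f. Proof. by case. Qed.

Lemma primE a b F f x : prim a b F f -> a <= x <= b -> F x = F a + itg a x f.
Proof. by case=> _ h /andP[ax xb]; rewrite -h// addrC subrK. Qed.

Lemma primP a b F f : L2 a b f ->
  (forall x, a <= x <= b -> F x = F a + itg a x f) -> prim a b F f.
Proof.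
move=> lf Ff; split => // x y ax xy yb.
rewrite (Ff x) ?ax ?(le_trans xy)// (Ff y) ?(le_trans ax)//.
rewrite (@itg_cat _ a x y)//; first ring.
exact: L1S (L2_L1 lf).
Qed.

Lemma primS a b c d F f : a <= c -> d <= b -> prim a b F f -> prim c d F f.
Proof.
move=> ac db [lf Ff]; split; first exact: L2S lf.
by move=> x y cx xy yd; apply: Ff => //; [exact: le_trans cx|exact: le_trans db].
Qed.

Lemma prim_continuous a b F f : a <= b -> prim a b F f ->
  {within `[a, b], continuous F}.
Proof.
move=> ab pF.
have cI := parameterized_integral_continuous ab (L2_L1 (prim_L2 pF)).
have cI' : {within `[a, b], continuous (fun x => F a + itg a x f)}.
  by move=> x; apply: cvgD; [exact: cvg_cst|exact: cI].
apply: subspace_eq_continuous cI' => x; rewrite inE/= in_itv/= => xab.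
by rewrite [RHS](primE pF).
Qed.

Lemma prim_L2F a b F f : prim a b F f -> L2 a b F.
Proof.
have [ab|ba] := leP a b; first by move=> pF; exact: L2_continuous (prim_continuous ab pF).
by move=> pF; apply: (@eq_L2 _ _ _ (fun=> 0)) (L2_cst _ _ 0) => x /andP[ax xb];
  have := lt_le_trans ba (le_trans ax xb); rewrite ltxx.
Qed.

(** The derivative may change at the two end points; this is what allows
    derivatives to be prescribed piecewise, with any value at the joints. *)
Lemma eq_prim a b F f G g : (forall x, a <= x <= b -> F x = G x) ->
  (forall x, a < x < b -> f x = g x) -> prim a b F f -> prim a b G g.
Proof.
move=> FG fg [lf Ff]; split; first exact: eq_oo_L2 lf.
move=> x y ax xy yb.
rewrite -!FG ?ax ?yb ?(le_trans ax xy) ?(le_trans xy yb)// Ff//.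
apply: eq_oo_itg.
  move=> z /andP[xz zy]; apply: fg.
  by rewrite (le_lt_trans ax)//= (lt_le_trans zy).
exact: L1S (L2_L1 lf).
Qed.

Lemma prim_cat a b c F f : a <= b -> b <= c -> prim a b F f -> prim b c F f ->
  prim a c F f.
Proof.
move=> ab bc pF pG; have lf := L2_cat ab bc (prim_L2 pF) (prim_L2 pG).
apply: primP => // x /andP[ax xc].
have [xb|/ltW bx] := leP x b; first by rewrite (primE pF) ?ax.
rewrite (primE pG) ?bx// (@primE _ _ _ _ b pF) ?ab ?lexx//.
rewrite (@itg_cat _ a b x) ?addrA//.
by apply: L1S (L2_L1 lf).
Qed.

Lemma primD a b F f G g : prim a b F f -> prim a b G g ->
  prim a b (fun x => F x + G x) (fun x => f x + g x).
Proof.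
move=> [lf Ff] [lg Gg]; split; first exact: L2D.
move=> x y ax xy yb; rewrite itgD; [|exact: L2_L1S lf|exact: L2_L1S lg].
by rewrite -Ff// -Gg//; ring.
Qed.

Lemma primZ a b F f r : prim a b F f ->
  prim a b (fun x => r * F x) (fun x => r * f x).
Proof.
move=> [lf Ff]; split; first exact: L2Z.
move=> x y ax xy yb; rewrite itgZ; last exact: L1S (L2_L1 lf).
by rewrite -Ff//; ring.
Qed.

Lemma primN a b F f : prim a b F f -> prim a b (fun x => - F x) (fun x => - f x).
Proof.
by move=> /(primZ (-1)); apply: eq_prim => x _; rewrite mulN1r.
Qed.

Lemma primB a b F f G g : prim a b F f -> prim a b G g ->
  prim a b (fun x => F x - G x) (fun x => f x - g x).
Proof. by move=> pF /primN; exact: primD. Qed.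

Lemma prim_shift a b c F f : prim (a + c) (b + c) F f ->
  prim a b (fun x => F (x + c)) (fun x => f (x + c)).
Proof.
move=> [lf Ff]; split; first exact: L2_shift.
move=> x y ax xy yb.
rewrite itg_shift; first by apply: Ff; rewrite lerD2r.
by apply: L1S (L2_L1 lf); rewrite lerD2r.
Qed.

Lemma prim_opp a b F f : prim (- b) (- a) F f ->
  prim a b (fun x => F (- x)) (fun x => - f (- x)).
Proof.
move=> [lf Ff]; split; first exact/L2N/L2_opp.
move=> x y ax xy yb.
have l1 : L1 (- y) (- x) f by apply: L1S (L2_L1 lf); rewrite lerN2.
rewrite itgN; last exact: L1_opp.
by rewrite itg_opp// -Ff ?lerN2// opprB.
Qed.

Lemma prim_itg a b f : L2 a b f -> prim a b (fun x => itg a x f) f.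
Proof. by move=> lf; apply: primP => // x _; rewrite itg_point add0r. Qed.

(** Each of F, H is its value at one end plus an integral of its derivative;
    the two double integrals that result are equal by Fubini on a
    triangle. *)
Lemma itg_by_parts a b F f H h : a <= b -> prim a b F f -> prim a b H h ->
  itg a b (fun x => F x * h x) + itg a b (fun x => f x * H x) =
  F b * H b - F a * H a.
Proof.
move=> ab pF pH.
have [lf lh] := (prim_L2 pF, prim_L2 pH).
have lF := prim_L2F pF; have lH := prim_L2F pH.
have -> : itg a b (fun x => F x * h x) =
    itg a b (fun x => F b * h x - h x * itg x b f).
  apply: eq_itg => x /andP[ax xb].
  by case: pF => _ /(_ x b ax xb (lexx _)) <-; ring.
have lIf : L2 a b (fun x => itg x b f).
  apply: (@eq_L2 _ _ _ (fun x => F b - F x)); last exact: L2B (L2_cst _ _ _) lF.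
  by move=> x /andP[ax xb]; case: pF => _ /(_ x b ax xb (lexx _)).
have lIh : L2 a b (fun x => itg a x h).
  apply: (@eq_L2 _ _ _ (fun x => H x - H a)); last exact: L2B lH (L2_cst _ _ _).
  by move=> x /andP[ax xb]; case: pH => _ /(_ a x (lexx _) ax xb).
have -> : itg a b (fun x => f x * H x) =
    itg a b (fun x => H a * f x + f x * itg a x h).
  apply: eq_itg => x /andP[ax xb].
  by case: pH => _ /(_ a x (lexx _) ax xb) <-; ring.
rewrite itgB; [|exact/L2_L1/L2Z|exact: L2M].
rewrite itgD; [|exact/L2_L1/L2Z|exact: L2M].
rewrite !itgZ; [|exact: L2_L1|exact: L2_L1].
rewrite triangle_fubini//; [|exact: L2_L1|exact: L2_L1].
case: pF => _ <-//; case: pH => _ <-//; ring.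
Qed.

Lemma prim_C1 a b F f : (forall x, is_derive x (1 : R) F (f x)) -> continuous f ->
  prim a b F f.
Proof.
move=> dF cf.
have lf c d : L2 c d f.
  by apply: L2_continuous; apply: continuous_subspaceT => x; exact: cf.
split => // x y _ + _; rewrite le_eqVlt => /predU1P[<-|xy].
  by rewrite subrr itg_point.
have cF : continuous F.
  by move=> z; apply: differentiable_continuous; apply/derivable1_diffP; case: (dF z).
have := @continuous_FTC2 _ f F x y xy.
rewrite /itg /Rintegral => ->//.
- by apply: continuous_subspaceT => z; exact: cf.
- split=> [z _|//|//]; first by case: (dF z).
  + by apply: cvg_at_right_filter; exact: cF.
  + by apply: cvg_at_left_filter; exact: cF.
- by move=> z _; rewrite derive1E; case: (dF z).
Qed.

End Primitives.

(** * H^1 as a space of primitives *)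

Section Sobolev1D.
Context {R : realType}.
Implicit Types (a b c r s t D p q : R) (f g h F G H k : R -> R).
Local Notation mu := (@lebesgue_measure R).

(** Membership in Lfun speaks of the restriction by zero to the whole line
    and of a norm defined by a real power; on functions this is square
    integrability. *)
Lemma isL2P D f : isL2 D f <-> L2 0 D f.
Proof.
have sqE : (EFin \o (fun x => f x ^+ 2)) \_ `[0, D] =
    EFin \o (fun x => (f \_ `[0, D]) x ^+ 2).
  apply/funext => x /=; rewrite !patchE; case: ifP => // _.
  by rewrite /point/= expr0n.
split=> [lf|[mf sf]].
  have := Lfun2_integrable_sqr lf; rewrite -sqE => sf.
  split; last by apply/integrable_mkcond.
  apply/measurable_restrictT => //.
  by move: lf; rewrite /isL2 inE => /andP[]; rewrite inE.
rewrite /isL2 inE; apply/andP; split; rewrite inE/=.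
  by have [+ _] := measurable_restrictT f (measurable_itv `[0, D]); apply.
rewrite /finite_norm unlock; apply: poweR_lty.
have /integrable_mkcond : mu.-integrable `[0, D] (EFin \o (fun x => f x ^+ 2)) by [].
move=> /(_ (measurable_itv _)); rewrite sqE => /integrableP[_].
apply: le_lt_trans; rewrite le_eqVlt; apply/orP; left; apply/eqP.
apply: eq_integral => x _ /=.
by rewrite powR_mulrn// normrX.
Qed.

Lemma intDE D f : intD D f = itg 0 D f. Proof. by []. Qed.

Lemma sqr_normL2 D f : normL2 D f ^+ 2 = itg 0 D (fun x => f x ^+ 2).
Proof. by rewrite sqr_sqrtr//; apply: itg_ge0 => x _; exact: sqr_ge0. Qed.

(** With [a, b] as window, composition with clamp extends a function that is
    continuous on [a, b] to a continuous function on the line; with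
    [- M, M] it truncates values. *)
Definition clamp a b (x : R) : R := Num.max a (Num.min b x).

Lemma clamp_itv a b x : a <= b -> a <= clamp a b x <= b.
Proof.
move=> ab; rewrite /clamp le_max lexx/= ge_max ab/=.
by rewrite ge_min lexx.
Qed.

Lemma clamp_id a b x : a <= x <= b -> clamp a b x = x.
Proof. by move=> /andP[ax xb]; rewrite /clamp min_r// max_r. Qed.

Lemma continuous_clamp a b h : a <= b -> {within `[a, b], continuous h} ->
  continuous (fun x => h (clamp a b x)).
Proof.
move=> ab /subspace_continuousP ch x.
have cc : continuous (clamp a b).
  move=> z; apply: (@continuous_max _ _ (fun=> a) (fun z => Num.min b z)).
    exact: cvg_cst.
  by apply: (@continuous_min _ _ (fun=> b) (fun z => z)); [exact: cvg_cst|exact: cvg_id].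
have := ch (clamp a b x); rewrite /= in_itv/= clamp_itv// => /(_ isT) hc.
apply: (cvg_comp _ _ _ hc) => P /= wP.
have H : nbhs x (fun z => `[a, b]%classic (clamp a b z) -> P (clamp a b z)).
  exact: cc x _ wP.
apply: (@filterS _ (nbhs x) _ _ _ _ H) => z; apply.
by rewrite /= in_itv/=; exact: clamp_itv.
Qed.

(** If g were positive at x it would exceed g(x) / 2 on a nondegenerate
    subinterval; clamping makes the argument uniform in x, end points
    included. *)
Lemma continuous_itg_eq0 a b g : a < b -> {within `[a, b], continuous g} ->
  (forall x, a <= x <= b -> 0 <= g x) -> itg a b g = 0 ->
  forall x, a <= x <= b -> g x = 0.
Proof.
move=> ab cg g0 ig0 x xab; apply/eqP; rewrite eq_le g0// andbT leNgt.
apply/negP => gx.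
have lg := L2_L1 (L2_continuous cg).
have cgx := continuous_clamp (ltW ab) cg.
have /cvgrPdist_lt/(_ (g x / 2)) := cgx x.
rewrite divr_gt0// => /(_ isT) [d/= d0 Hd].
rewrite clamp_id// in Hd.
have [ax xb] := andP xab.
pose y1 := Num.max a (x - d / 2); pose y2 := Num.min b (x + d / 2).
have y12 : y1 < y2.
  rewrite /y1 /y2 gt_max !lt_min ab/=; apply/and3P; split; lra.
have ay1 : a <= y1 by rewrite le_max lexx.
have y2b : y2 <= b by rewrite ge_min lexx.
have := ig0; rewrite (@itg_cat _ a y1 b)// ?(le_trans (ltW y12))//.
rewrite (@itg_cat _ y1 y2 b)// ?(ltW y12)//; last exact: L1S lg.
have p1 : 0 <= itg a y1 g.
  apply: itg_ge0 => z /andP[az zy]; apply: g0.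
  by rewrite az (le_trans zy)// (le_trans (ltW y12)).
have p3 : 0 <= itg y2 b g.
  apply: itg_ge0 => z /andP[az zy]; apply: g0.
  by rewrite zy (le_trans _ az)// (le_trans ay1)// ltW.
have : itg y1 y2 (fun=> g x / 2) <= itg y1 y2 g.
  apply: le_itg; [exact: L1_cst|exact: L1S lg|move=> z /andP[z1 z2]].
  have zab : a <= z <= b by rewrite (le_trans ay1)//= (le_trans z2).
  have := Hd z; rewrite /= clamp_id// => Hz.
  have : `|g x - g z| < g x / 2.
    apply: Hz; move: z1 z2; rewrite /y1 /y2 ge_max le_min => /andP[_ z1] /andP[_ z2].
    by rewrite ltr_distlC; apply/andP; split; lra.
  by rewrite ltr_norml => /andP[_]; lra.
rewrite itg_cst; last exact: ltW.
have : 0 < g x / 2 * (y2 - y1) by rewrite mulr_gt0 ?divr_gt0// subr_gt0.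
lra.
Qed.

Lemma test_fun_prim D phi : 0 < D -> test_fun D phi ->
  [/\ prim 0 D phi (derive1 phi), phi 0 = 0 & phi D = 0].
Proof.
move=> D0 [dphi cphi [a [b [a0 bD sphi]]]]; split.
- apply: prim_C1 => // x; rewrite derive1E; exact: derivableP.
- apply: contrapT => /eqP/sphi/andP[].
  by rewrite leNgt a0.
- apply: contrapT => /eqP/sphi/andP[_].
  by rewrite leNgt bD.
Qed.

Lemma prim_isH1 D f df : 0 < D -> prim 0 D f df -> isH1 D f df.
Proof.
move=> D0 pf; split.
- exact: prim_continuous (ltW D0) pf.
- exact/isL2P/(prim_L2F pf).
- exact/isL2P/(prim_L2 pf).
- move=> phi /(test_fun_prim D0)[pphi phi0 phiD].
  have := itg_by_parts (ltW D0) pf pphi; rewrite phi0 phiD !mulr0 subr0 !intDE => /eqP.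
  by rewrite addr_eq0 => /eqP.
Qed.

(** The primitive is taken from minus infinity, so that the fundamental
    theorem of calculus applies at every point; it is supported in [p, q]
    because k is, and has integral zero. This is how test functions with a
    prescribed derivative are produced. *)
Lemma continuous_primitive p q k : p < q -> continuous k ->
  (forall x, ~~ (p < x < q) -> k x = 0) -> itg p q k = 0 ->
  exists F, [/\ forall x, derivable F x 1, derive1 F = k &
    forall x, F x != 0 -> p <= x <= q].
Proof.
move=> pq ck k0 ik0.
have lk : L1 p q k.
  by apply/L2_L1/L2_continuous; apply: continuous_subspaceT => x; exact: ck.
have kE : k = k \_ `[p, q].
  apply/funext => x; rewrite patchE; case: ifPn => //.
  rewrite notin_setE/= in_itv/= => xpq; apply: k0; apply/negP => /andP[px xq].
  by apply: xpq; rewrite !ltW.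
have ik u : mu.-integrable `]-oo, u] (EFin \o k).
  by apply: (@integrableS _ _ _ mu setT) => //; rewrite kE; exact/L1E.
pose F x := \int[mu]_(t in [set` `]-oo, x]]) k t.
have dF x : derivable F x 1 /\ derive1 F x = k x.
  apply: (@continuous_FTC1 _ k -oo%O x (x + 1)).
  - by rewrite ltrDl.
  - exact: ik.
  - by rewrite ltNyr.
  - exact: ck.
exists F; split=> [x||x Fx].
- by case: (dF x).
- by apply/funext => x; case: (dF x).
have FE : F x = \int[mu]_t (k \_ `]-oo, x]) t by rewrite /F Rintegral_mkcond.
rewrite !leNgt; apply/andP; split; apply/negP => xx; move/eqP: Fx; apply.
  rewrite FE (_ : k \_ _ = fun=> 0); first by rewrite /Rintegral integral0.
  apply/funext => t; rewrite patchE; case: ifPn => //.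
  rewrite inE/= in_itv/= => tx; apply: k0; rewrite negb_and -leNgt.
  by rewrite (le_trans tx) ?ltW.
rewrite FE -ik0 itgE; congr Rintegral; apply/funext => t; rewrite -kE patchE.
case: ifPn => //; rewrite notin_setE/= in_itv/= => /negP; rewrite -ltNge => xt.
by apply/esym/k0; rewrite negb_and -!leNgt (ltW (lt_trans xx xt)) orbT.
Qed.

(** Testing against the primitive of w (h - c), where w is a bump on ]p, q[
    and c the w-mean of h, shows that w (h - c)^2 has integral zero. *)
Lemma dubois_reymond D h p q : 0 < p -> p < q -> q < D ->
  {within `[0, D], continuous h} ->
  (forall phi, test_fun D phi -> itg 0 D (fun x => h x * derive1 phi x) = 0) ->
  exists c, forall x, p < x < q -> h x = c.
Proof.
move=> p0 pq qD ch hphi.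
have D0 : 0 < D by rewrite (lt_trans p0)// (lt_trans pq).
pose w x : R := Num.max 0 ((x - p) * (q - x)).
pose h' x := h (clamp 0 D x).
have ch' : continuous h' by exact: continuous_clamp (ltW D0) ch.
have cw : continuous w.
  move=> z; apply: (@continuous_max _ _ (fun=> 0) (fun z => (z - p) * (q - z))).
    exact: cvg_cst.
  apply: cvgM; first by apply: cvgB; [exact: cvg_id|exact: cvg_cst].
  by apply: cvgB; [exact: cvg_cst|exact: cvg_id].
have w0 x : 0 <= w x by rewrite le_max lexx.
have wE x : ~~ (p < x < q) -> w x = 0.
  rewrite negb_and -!leNgt => xpq; apply: max_l.
  case/orP: xpq => xpq; [apply: mulr_le0_ge0|apply: mulr_ge0_le0];
    rewrite ?subr_le0 ?subr_ge0//.
    exact: le_trans xpq (ltW pq).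
  exact: le_trans (ltW pq) xpq.
have wpos x : p < x < q -> 0 < w x.
  by move=> /andP[px xq]; rewrite lt_max mulr_gt0 ?orbT// subr_gt0.
have lC f a b : continuous f -> L1 a b f.
  by move=> cf; apply/L2_L1/L2_continuous; apply: continuous_subspaceT => x; exact: cf.
have iw : 0 < itg p q w.
  rewrite lt_neqAle itg_ge0//= andbT; apply/negP => /eqP iw0.
  have := @continuous_itg_eq0 p q w pq (continuous_subspaceT cw) (fun x _ => w0 x) (esym iw0).
  have mpq : p < (p + q) / 2 < q by apply/andP; split; lra.
  move=> /(_ ((p + q) / 2)); case/andP: (mpq) => /ltW-> /ltW-> /(_ isT).
  by have := wpos _ mpq; lra.
have cwh : continuous (fun x => w x * h' x).
  by move=> x; apply: cvgM; [exact: cw|exact: ch'].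
pose c := itg p q (fun x => w x * h' x) / itg p q w.
pose k x := w x * h' x - c * w x.
have ck : continuous k.
  move=> x; apply: cvgB; first exact: cwh.
  by apply: cvgM; [exact: cvg_cst|exact: cw].
have ik : itg p q k = 0.
  rewrite /k itgB; [|exact: lC|exact/L1Z/lC].
  rewrite itgZ; last exact: lC.
  by rewrite /c divfK ?subrr// gt_eqF.
have kE x : ~~ (p < x < q) -> k x = 0.
  by move=> /wE wx; rewrite /k wx mulr0 mul0r subr0.
have [F [dF F'k sF]] := continuous_primitive pq ck kE ik.
have tF : test_fun D F.
  by split; [exact: dF|rewrite F'k; exact: ck|exists p, q; split].
have := hphi F tF; rewrite F'k => ihk.
have pD := ltW (lt_trans pq qD).
have clD x : p <= x <= q -> clamp 0 D x = x.
  move=> /andP[px xq]; rewrite clamp_id// (le_trans (ltW p0))//=.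
  by rewrite (le_trans xq)// ltW.
have cg : continuous (fun x => w x * (h' x - c) ^+ 2).
  move=> x; apply: cvgM; first exact: cw.
  have -> : (fun x => (h' x - c) ^+ 2) = (fun x => (h' x - c) * (h' x - c)).
    by apply/funext => z; rewrite expr2.
  by apply: cvgM; (apply: cvgB; [exact: ch'|exact: cvg_cst]).
have ig : itg p q (fun x => w x * (h' x - c) ^+ 2) = 0.
  have -> : itg p q (fun x => w x * (h' x - c) ^+ 2) =
      itg p q (fun x => h' x * k x - c * k x).
    by apply: eq_itg => x _; rewrite /k; ring.
  have ch'k : continuous (fun x => h' x * k x).
    by move=> x; apply: cvgM; [exact: ch'|exact: ck].
  rewrite itgB; [|exact: lC|exact/L1Z/lC].
  rewrite itgZ; last exact: lC.
  rewrite ik mulr0 subr0.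
  have <- : itg 0 D (fun x => h x * k x) = itg p q (fun x => h' x * k x).
    have -> : itg 0 D (fun x => h x * k x) = itg 0 D (fun x => h' x * k x).
      by apply: eq_itg => x x0D; rewrite /h' clamp_id.
    rewrite (@itg_cat _ 0 p D) ?(ltW p0)//; last exact: lC.
    rewrite (@itg_cat _ p q D) ?(ltW pq) ?(ltW qD)//; last exact: lC.
    rewrite (@eq_itg _ 0 p _ (fun=> 0)) ?itg_cst0 ?add0r; last first.
      by move=> x /andP[_ xp]; rewrite kE ?mulr0// negb_and -leNgt xp.
    rewrite (@eq_itg _ q D _ (fun=> 0)) ?itg_cst0 ?addr0//.
    by move=> x /andP[xq _]; rewrite kE ?mulr0// negb_and -!leNgt xq orbT.
  exact: ihk.
exists c => x xpq.
have xpq' : p <= x <= q by case/andP: xpq => /ltW-> /ltW->.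
have := @continuous_itg_eq0 p q _ pq (continuous_subspaceT cg) _ ig x xpq'.
move=> /(_ (fun z _ => mulr_ge0 (w0 z) (sqr_ge0 _)))/eqP.
by rewrite mulf_eq0 gt_eqF ?wpos//= sqrf_eq0 subr_eq0 /h' clD// => /eqP.
Qed.

(** The difference between f and the integral of df has weak derivative zero,
    hence is constant by du Bois-Reymond. *)
Lemma isH1_prim D f df : 0 < D -> isH1 D f df -> prim 0 D f df.
Proof.
move=> D0 [cf /isL2P lf /isL2P ldf wd].
pose G x := itg 0 x df.
have pG : prim 0 D G df by exact: prim_itg.
have cG := prim_continuous (ltW D0) pG.
pose h x := f x - G x.
have ch : {within `[0, D], continuous h}.
  by move=> x; apply: cvgB; [exact: cf|exact: cG].
have ch' := continuous_clamp (ltW D0) ch.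
have hphi phi : test_fun D phi -> itg 0 D (fun x => h x * derive1 phi x) = 0.
  move=> tphi; have [pphi phi0 phiD] := test_fun_prim D0 tphi.
  have := itg_by_parts (ltW D0) pG pphi; rewrite phi0 phiD !mulr0 subr0 => Gphi.
  have := wd _ tphi; rewrite !intDE => fphi.
  have -> : itg 0 D (fun x => h x * derive1 phi x) =
     itg 0 D (fun x => f x * derive1 phi x - G x * derive1 phi x).
    by apply: eq_itg => x _; rewrite /h mulrBl.
  rewrite itgB; last 2 first.
  - exact: L2M lf (prim_L2 pphi).
  - exact: L2M (prim_L2F pG) (prim_L2 pphi).
  by rewrite fphi; move/eqP: Gphi; rewrite addr_eq0 => /eqP ->; rewrite subrr.
pose m := D / 2.
have m0D : 0 < m < D by rewrite /m; apply/andP; split; lra.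
have hm x : 0 < x < D -> h x = h m.
  move=> /andP[x0 xD]; have /andP[m0 mD] := m0D.
  pose p := Num.min x m / 2; pose q := (Num.max x m + D) / 2.
  have mx1 : Num.min x m <= x by rewrite ge_min lexx.
  have mx2 : Num.min x m <= m by rewrite ge_min lexx orbT.
  have mx3 : 0 < Num.min x m by rewrite lt_min x0.
  have Mx1 : x <= Num.max x m by rewrite le_max lexx.
  have Mx2 : m <= Num.max x m by rewrite le_max lexx orbT.
  have Mx3 : Num.max x m < D by rewrite gt_max xD.
  have [||| c hc] := @dubois_reymond D h p q _ _ _ ch hphi.
  - by rewrite /p; lra.
  - by rewrite /p /q; lra.
  - by rewrite /q; lra.
  by rewrite !hc// /p /q; apply/andP; split; lra.
(* the value at the end points is reached by continuity *)
have hm' x : 0 <= x <= D -> h x = h m.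
  move=> xD.
  pose y n : R := x + (m - x) * harmonic n.
  have yx : y n @[n --> \oo] --> x.
    rewrite -[X in _ --> X](addr0 x) -[X in x + X](mulr0 (m - x)).
    apply: cvgD; first exact: cvg_cst.
    by apply: cvgM; [exact: cvg_cst|exact: cvg_harmonic].
  have hy : h (clamp 0 D (y n)) @[n --> \oo] --> h (clamp 0 D x).
    exact: (cvg_comp _ _ yx (ch' x)).
  have hyE n : h (clamp 0 D (y n)) = h m.
    have yn : 0 < y n < D.
      have h01 : 0 < (harmonic n : R) <= 1.
        rewrite /harmonic invr_gt0 ltr0n/= invf_le1 ?ler1n// ltr0n.
      have := mulr_gt0 D0 (andP h01).1.
      rewrite /y /m; case/andP: xD => x0 xD; case/andP: h01 => h0 h1.
      have e : x + (D / 2 - x) * harmonic n = x * (1 - harmonic n) + D * harmonic n / 2 by field.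
      rewrite e; have := mulr_ge0 x0 (_ : 0 <= 1 - harmonic n); rewrite subr_ge0 => /(_ h1).
      have := ler_wpM2r (_ : 0 <= 1 - harmonic n) xD; rewrite subr_ge0 => /(_ h1).
      by move=> *; apply/andP; split; lra.
    rewrite clamp_id ?hm//.
    by case/andP: yn => /ltW-> /ltW->.
  rewrite -[LHS](_ : h (clamp 0 D x) = _) ?clamp_id//.
  rewrite (_ : (fun n => h (clamp 0 D (y n))) = fun=> h m) in hy; last exact/funext.
  rewrite clamp_id// in hy; rewrite -(cvg_lim (@Rhausdorff R) hy).
  exact: lim_cst.
have fE x : 0 <= x <= D -> f x = h m + G x.
  by move=> /hm' <-; rewrite /h subrK.
apply: primP => // x xD.
rewrite fE// (fE 0) ?lexx ?(ltW D0)// /G itg_point addr0.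
by [].
Qed.

(** All of the proof works with primitives; this equivalence is the only
    contact with weak derivatives. *)
Lemma isH1P D f df : 0 < D -> isH1 D f df <-> prim 0 D f df.
Proof. by move=> D0; split; [exact: isH1_prim|exact: prim_isH1]. Qed.

End Sobolev1D.

(** * Translations in L^2 *)

Section Translations.
Context {R : realType}.
Implicit Types (a b c r s t p q e : R) (f g h F G H k : R -> R).
Local Notation mu := (@lebesgue_measure R).

(** A travelling wave evaluates its profile at x + t for every t >= 0, so
    profiles live on the whole line. *)
Definition locL2 f : Prop := forall a b, L2 a b f.

Definition primR F f : Prop := forall a b, prim a b F f.

Lemma primR_locL2 F f : primR F f -> locL2 f.
Proof. by move=> pF a b; exact: prim_L2 (pF a b). Qed.

Lemma primR_locL2F F f : primR F f -> locL2 F.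
Proof. by move=> pF a b; exact: prim_L2F (pF a b). Qed.

Lemma locL2_meas f : locL2 f -> measurable_fun setT f.
Proof.
move=> lf.
have -> : [set: R] = \bigcup_n `[- n%:R, n%:R]%classic.
  apply/seteqP; split => // x _; exists (Num.trunc `|x|).+1 => //=.
  rewrite in_itv/= -ler_norml; apply/ltW.
  exact: truncnS_gt.
by apply/measurable_fun_bigcup => // n; exact: L2_meas (lf _ _).
Qed.

Lemma measurable_clamp a b : measurable_fun setT (clamp a b : R -> R).
Proof.
apply: continuous_measurable_fun => z.
apply: (@continuous_max _ _ (fun=> a) (fun z => Num.min b z)); first exact: cvg_cst.
by apply: (@continuous_min _ _ (fun=> b) (fun z => z)); [exact: cvg_cst|exact: cvg_id].
Qed.

Lemma clamp_norm (M y : R) : 0 <= M -> `|clamp (- M) M y| <= M.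
Proof. by move=> M0; rewrite ler_norml clamp_itv//; lra. Qed.

Lemma clamp_dist (M y : R) : 0 <= M -> (y - clamp (- M) M y) ^+ 2 <= y ^+ 2.
Proof.
move=> M0; rewrite /clamp; have [yM|My] := leP y M.
  have [My|yM'] := leP (- M) y; first by rewrite subrr expr0n sqr_ge0.
  by rewrite opprK -sqrrN -(sqrrN y) ler_sqr ?nnegrE; lra.
by rewrite max_r; [rewrite ler_sqr ?nnegrE; lra|lra].
Qed.

(** Dominated convergence, with f^2 as the dominating function. *)
Lemma trunc_approx a b f e : L2 a b f -> 0 < e -> exists2 M : R, 0 <= M &
  itg a b (fun x => (f x - clamp (- M) M (f x)) ^+ 2) < e.
Proof.
move=> [mf sf] e0.
pose k n x := (f x - clamp (- n%:R) n%:R (f x)) ^+ 2.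
have mk n : measurable_fun `[a, b] (k n).
  apply: measurable_funX; apply: measurable_funB => //.
  exact: measurableT_comp (measurable_clamp _ _) mf.
have lk n : L1 a b (k n).
  apply: L1_le (mk n) sf _ => x _.
  by rewrite ger0_norm ?sqr_ge0// clamp_dist.
have [] := @dominated_convergence _ _ _ mu `[a, b]%classic (measurable_itv _)
  (fun n x => (k n x)%:E) (cst 0%E) (fun x => (f x ^+ 2)%:E).
- by move=> n; exact: (measurable_int mu (lk n)).
- exact: measurable_cst.
- apply: aeW => x _; apply: cvg_near_cst.
  exists (Num.trunc `|f x|).+1 => // n /= fn; rewrite /k clamp_id ?subrr ?expr0n//.
  rewrite -ler_norml; apply/ltW/(lt_le_trans (truncnS_gt _)).
  by rewrite ler_nat.
- exact: sf.
- apply: aeW => x n _.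
  by rewrite /= lee_fin ger0_norm ?sqr_ge0// clamp_dist.
move=> _ _; rewrite integral0 => /fine_cvgP[_ /cvgrPdist_lt/(_ e e0)[n _ /(_ n (leqnn n))]].
rewrite /= sub0r normrN => kn; exists n%:R => //.
by rewrite (le_lt_trans _ kn)// ler_norm.
Qed.

Lemma L1_approx a b f e : L1 a b f -> 0 < e ->
  exists2 g, continuous g & itg a b (fun x => `|f x - g x|) < e.
Proof.
move=> lf e0.
have abfin : (mu `[a, b] < +oo)%E.
  by rewrite /= lebesgue_measure_itv/=; case: ifP => _; rewrite ?ltry.
have [g [cg _]] := approximation_continuous_integrable (measurable_itv _) abfin lf.
move=> /fine_cvgP[_ /cvgrPdist_lt/(_ e e0)[n _ /(_ n (leqnn n))]].
rewrite /= sub0r normrN => kn; exists (g n) => //.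
by rewrite (le_lt_trans _ kn)// ler_norm.
Qed.

(** Uniform continuity on a segment, obtained from compactness in the form
    of near coverings because x + eta may leave the segment. *)
Lemma near_translate a b g e : continuous g -> 0 < e ->
  exists2 d, 0 < d & forall eta, `|eta| < d -> forall x, a <= x <= b ->
    `|g (x + eta) - g x| < e.
Proof.
move=> cg e0.
have : near_covering (`[a, b] : set R).
  by apply/compact_near_coveringP; exact: segment_compact.
move=> /(_ R (nbhs (0 : R)) (fun eta x => `|g (x + eta) - g x| < e) _) [].
  move=> x _.
  have /cvgrPdist_lt/(_ (e / 2)) := cg x; rewrite divr_gt0// => /(_ isT) [d/= d0 Hd].
  exists (ball x (d / 2), ball (0 : R) (d / 2)).
    by split; [apply: nbhsx_ballx; rewrite divr_gt0|apply: nbhsx_ballx; rewrite divr_gt0].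
  move=> [y eta] /= [xy eta0].
  rewrite /ball/= in xy eta0; rewrite sub0r normrN in eta0.
  have h1 : `|g x - g (y + eta)| < e / 2.
    apply: Hd => /=; rewrite opprD addrA.
    by rewrite (le_lt_trans (ler_normB _ _))//; lra.
  have h2 : `|g x - g y| < e / 2.
    by apply: Hd => /=; rewrite (lt_trans xy)//; lra.
  have -> : g (y + eta) - g y = (g x - g y) - (g x - g (y + eta)) by ring.
  by rewrite (le_lt_trans (ler_normB _ _))//; lra.
move=> d/= d0 Hd; exists d => // eta etad x xab.
by apply: (Hd eta) => /=; rewrite ?sub0r ?normrN// in_itv.
Qed.

(** Truncation reduces the claim to a bounded function, for which the squared
    L^2 distance is at most a constant times the L^1 distance; in L^1
    continuous functions are dense, and they are uniformly continuous on
    segments. The constant 9 is 3 * 3, from three summands of which each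
    contributes a third. *)
Lemma translation_continuous0 f a b e : locL2 f -> a <= b -> 0 < e ->
  exists2 d, 0 < d & forall eta, `|eta| < d ->
    itg a b (fun x => (f (x + eta) - f x) ^+ 2) <= e.
Proof.
move=> lf ab e0.
pose A := a - 1; pose B := b + 1.
have e9 : 0 < e / 9 by rewrite divr_gt0.
have [M M0 fM] := trunc_approx (lf A B) e9.
pose k x := clamp (- M) M (f x).
have kM x : `|k x| <= M by exact: clamp_norm.
have lk : locL2 k.
  move=> c d; apply: (@L2_bounded _ _ _ _ M) => //.
  by apply: measurableT_comp (measurable_clamp _ _) _; exact: L2_meas.
pose e1 := e / (9 * 2 * (M + 1) * (b - a + 2)).
have ba : 0 <= b - a by rewrite subr_ge0.
have pos : 0 < 9 * 2 * (M + 1) * (b - a + 2).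
  by rewrite !mulr_gt0//; lra.
have e1_gt0 : 0 < e1 by rewrite divr_gt0.
have [g cg kg] := L1_approx (L2_L1 (lk A B)) e1_gt0.
have [d d0 gd] := near_translate a b cg e1_gt0.
exists (Num.min d 1); first by rewrite lt_min d0/=.
move=> eta; rewrite lt_min => /andP[etad eta1].
have {eta1} [eta1 eta2] : - 1 < eta /\ eta < 1.
  by move: eta1; rewrite ltr_norml => /andP[].
have Aa : A <= a by rewrite /A; lra.
have bB : b <= B by rewrite /B; lra.
have Ae : A <= a + eta by rewrite /A; lra.
have eB : b + eta <= B by rewrite /B; lra.
have lC c c' : L2 c c' g.
  by apply: L2_continuous; apply: continuous_subspaceT => x; exact: cg.
have sh h : locL2 h -> L2 a b (fun x => h (x + eta)) by move=> lh; exact: L2_shift.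
(* an integral over the shifted window is at most the integral over the larger one *)
have win h : L1 A B h -> (forall x, 0 <= h x) ->
    itg a b (fun x => h (x + eta)) <= itg A B h.
  move=> lh h0.
  have lh1 c c' : A <= c -> c' <= B -> L1 c c' h by move=> *; exact: L1S lh.
  rewrite itg_shift; last exact: lh1.
  rewrite (@itg_cat _ A (a + eta) B)//; last by rewrite /B; lra.
  rewrite (@itg_cat _ (a + eta) (b + eta) B)//; last 2 first.
  - by rewrite lerD2r.
  - exact: lh1.
  by rewrite addrCA lerDl addr_ge0 ?itg_ge0.
have win0 h : L1 A B h -> (forall x, 0 <= h x) -> itg a b h <= itg A B h.
  move=> lh h0.
  have lh1 c c' : A <= c -> c' <= B -> L1 c c' h by move=> *; exact: L1S lh.
  rewrite (@itg_cat _ A a B)//; last by rewrite (le_trans ab).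
  rewrite (@itg_cat _ a b B)//; last exact: lh1.
  by rewrite addrCA lerDl addr_ge0 ?itg_ge0.
have l1 : L1 a b (fun x => `|k (x + eta) - k x|).
  by apply/L1_norm/L2_L1/L2B; [exact: sh|exact: lk].
have kL1 : itg a b (fun x => `|k (x + eta) - k x|) <= e1 * (b - a + 2).
  pose h x := `|k x - g x|.
  have lh : L1 A B h by apply/L1_norm/L2_L1/L2B.
  have hs : L1 a b (fun x => h (x + eta)).
    by apply/L1_norm/L2_L1/L2B; [exact: sh|exact: sh].
  have h0 : L1 a b h by apply: L1S lh.
  have h_ge0 x : 0 <= h x by exact: normr_ge0.
  have -> : e1 * (b - a + 2) = e1 + (e1 * (b - a) + e1) by ring.
  apply: (@le_trans _ _ (itg a b (fun x => h (x + eta) + (e1 + h x)))).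
    apply: le_itg => //.
      by apply: L1D => //; apply: L1D => //; exact: L1_cst.
    move=> x xab; have := gd _ etad x xab; rewrite /h.
    have -> : k (x + eta) - k x = (k (x + eta) - g (x + eta)) +
       ((g (x + eta) - g x) - (k x - g x)) by ring.
    move=> gx; rewrite (le_trans (ler_normD _ _))// lerD2l.
    by rewrite (le_trans (ler_normB _ _))// lerD2r ltW.
  rewrite itgD//; last by apply: L1D => //; exact: L1_cst.
  rewrite itgD//; last exact: L1_cst.
  rewrite itg_cst//; apply: lerD.
    exact: le_trans (win _ lh h_ge0) (ltW kg).
  by rewrite lerD2l; exact: le_trans (win0 _ lh h_ge0) (ltW kg).
have lkk : L2 a b (fun x => k (x + eta) - k x) by apply: L2B; [exact: sh|exact: lk].
have kL2 : itg a b (fun x => (k (x + eta) - k x) ^+ 2) <= e / 9.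
  apply: (@le_trans _ _ (itg a b (fun x => 2 * M * `|k (x + eta) - k x|))).
    apply: le_itg; [exact: L2_sqr|exact: L1Z|move=> x _].
    rewrite -real_normK ?num_real// expr2 ler_wpM2r//.
    by rewrite (le_trans (ler_normB _ _))//; have := kM x; have := kM (x + eta); lra.
  rewrite itgZ//; apply: (@le_trans _ _ (2 * (M + 1) * (e1 * (b - a + 2)))).
    apply: ler_pM => //; [lra|exact: itg_ge0|lra].
  rewrite le_eqVlt; apply/orP; left; apply/eqP; rewrite /e1; field.
  by apply/andP; split; lra.
pose m x := f x - k x.
have lm : locL2 m by move=> c c'; exact: L2B.
have mL2 : itg A B (fun x => m x ^+ 2) < e / 9 by [].
have lm2 : L1 A B (fun x => m x ^+ 2) by exact: L2_sqr.
have lms : L1 a b (fun x => m (x + eta) ^+ 2) by apply/L2_sqr/sh.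
have lm0 : L1 a b (fun x => m x ^+ 2) by exact: L2_sqr.
have lkk2 := L2_sqr lkk.
have lff : L2 a b (fun x => f (x + eta) - f x) by apply: L2B; [exact: sh|exact: lf].
apply: (@le_trans _ _ (itg a b (fun x =>
    3 * (m (x + eta) ^+ 2 + ((k (x + eta) - k x) ^+ 2 + m x ^+ 2))))).
  apply: le_itg; [exact: L2_sqr|by apply/L1Z/L1D => //; exact: L1D|move=> x _].
  have -> : f (x + eta) - f x = m (x + eta) + (k (x + eta) - k x) - m x.
    by rewrite /m; ring.
  set u := m (x + eta); set v := k (x + eta) - k x; set w := m x.
  have := sqr_ge0 (u - v); have := sqr_ge0 (u + w); have := sqr_ge0 (v + w).
  rewrite !expr2; lra.
rewrite itgZ; last by apply: L1D => //; exact: L1D.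
rewrite itgD//; last exact: L1D.
rewrite itgD//.
have := win _ lm2 (fun x => sqr_ge0 _); have := win0 _ lm2 (fun x => sqr_ge0 _).
move=> /=; lra.
Qed.

Lemma locL2_shift f c : locL2 f -> locL2 (fun x => f (x + c)).
Proof. by move=> lf a b; exact: L2_shift. Qed.

Lemma translation_continuous f a b t e : locL2 f -> a <= b -> 0 < e ->
  exists2 d, 0 < d & forall s, `|s - t| < d ->
    itg a b (fun x => (f (x + s) - f (x + t)) ^+ 2) <= e.
Proof.
move=> lf ab e0.
have [d d0 H] := translation_continuous0 (@locL2_shift f t lf) ab e0.
exists d => // s /H; congr (_ <= _); apply: eq_itg => x _.
by congr ((f _ - _) ^+ 2); ring.
Qed.

(** Jensen: F(x + q) - F(x + p) - (q - p) f(x) is the integral of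
    f(x + eta) - f(x) over eta in [p, q]. Integrating its square in x and
    exchanging the integrals bounds it by the modulus of continuity of the
    translations of f. Two shifts p and q are allowed so that forward and
    backward increments are covered with p <= 0 <= q. *)
Lemma increment_bound F f a b p q M : primR F f -> a <= b -> p <= q ->
  (forall eta, p <= eta <= q ->
     itg a b (fun x => (f (x + eta) - f x) ^+ 2) <= M) ->
  itg a b (fun x => (F (x + q) - F (x + p) - (q - p) * f x) ^+ 2) <=
    (q - p) ^+ 2 * M.
Proof.
move=> pF ab pq fM.
have lf := primR_locL2 pF; have lF := primR_locL2F pF.
have mf := locL2_meas lf.
pose k (z : measurableTypeR R * measurableTypeR R) : R :=
  (f (z.1 + z.2) - f z.1) ^+ 2.
have mk : measurable_fun setT k.
  apply: measurable_funX; apply: measurable_funB.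
    by apply: measurableT_comp mf _; exact: measurable_funD.
  exact: measurableT_comp mf _.
have sub x : L2 p q (fun eta => f (x + eta) - f x).
  apply: L2B (L2_cst _ _ _).
  by apply: (@eq_L2 _ _ _ (fun eta => f (eta + x))) (locL2_shift _ lf _ _) => eta _;
    rewrite addrC.
have key x : (F (x + q) - F (x + p) - (q - p) * f x) ^+ 2 <=
    (q - p) * itg p q (fun eta => k (x, eta)).
  have -> : F (x + q) - F (x + p) - (q - p) * f x =
      itg p q (fun eta => (f (x + eta) - f x) * 1).
    rewrite (@eq_itg _ p q _ (fun eta => f (eta + x) - f x)); last first.
      by move=> eta _; rewrite mulr1 (addrC x).
    rewrite itgB; [|exact/L2_L1/locL2_shift|exact: L1_cst].
    rewrite itg_cst// itg_shift; last exact/L2_L1.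
    case: (pF (p + x) (q + x)) => _ <-; rewrite ?lerD2r//.
    by rewrite (addrC q x) (addrC p x); ring.
  apply: le_trans (cauchy_schwarz (sub x) (L2_cst _ _ 1)) _.
  rewrite (@eq_itg _ p q (fun=> 1 ^+ 2) (fun=> 1)); last by move=> *; rewrite expr1n.
  by rewrite itg_cst// mul1r mulrC.
pose K (z : measurableTypeR R * measurableTypeR R) : \bar R :=
  ((k \_ (`[a, b] `*` `[p, q])) z)%:E.
have mK : measurable_fun setT K.
  apply/measurable_EFinP.
  have [+ _] := measurable_restrictT k
    (measurableX (measurable_itv `[a, b]) (measurable_itv `[p, q])).
  by apply; exact: measurable_funS mk.
have K0 z : (0 <= K z)%E.
  by rewrite /K lee_fin patchE; case: ifP => // _; exact: sqr_ge0.
have Kpatch x eta : K (x, eta) =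
    (((fun x => ((fun eta => k (x, eta)) \_ `[p, q]) eta) \_ `[a, b]) x)%:E.
  rewrite /K !patchE in_setX /=.
  by case: (x \in _) => //=; case: (eta \in _).
have lk1 x : L1 p q (fun eta => k (x, eta)) by exact: L2_sqr (sub x).
have lk2 eta : L1 a b (fun x => k (x, eta)).
  by apply: L2_sqr; apply: L2B; [exact: locL2_shift|exact: lf].
have KE x : (\int[mu]_eta K (x, eta) =
    ((fun x => itg p q (fun eta => k (x, eta))) \_ `[a, b] x)%:E)%E.
  under eq_integral => eta _ do rewrite Kpatch.
  rewrite patchE; case: ifPn => xab; last first.
    by under eq_integral => eta _ do rewrite patchE (negbTE xab); rewrite integral0.
  under eq_integral => eta _ do rewrite patchE xab.
  by rewrite itgE /Rintegral fineK//; apply: integrable_fin_num => //; exact/L1E.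
have KE' eta : (\int[mu]_x K (x, eta) =
    ((fun eta => itg a b (fun x => k (x, eta))) \_ `[p, q] eta)%:E)%E.
  have {}Kpatch x : K (x, eta) =
    (((fun eta => ((fun x => k (x, eta)) \_ `[a, b]) x) \_ `[p, q]) eta)%:E.
    by rewrite Kpatch !patchE; case: (x \in _) => //=; case: (eta \in _).
  under eq_integral => x _ do rewrite Kpatch.
  rewrite patchE; case: ifPn => epq; last first.
    by under eq_integral => x _ do rewrite patchE (negbTE epq); rewrite integral0.
  under eq_integral => x _ do rewrite patchE epq.
  by rewrite itgE /Rintegral fineK//; apply: integrable_fin_num => //; exact/L1E.
have M0 : 0 <= M.
  by apply: le_trans (fM p _); [apply: itg_ge0 => x _; exact: sqr_ge0|rewrite lexx].
have lG : L1 a b (fun x => (F (x + q) - F (x + p) - (q - p) * f x) ^+ 2).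
  apply/L2_sqr/L2B; last exact: L2Z.
  by apply: L2B; exact: locL2_shift.
have qp0 : 0 <= q - p by rewrite subr_ge0.
rewrite -lee_fin itgE /Rintegral fineK; last first.
  by apply: integrable_fin_num => //; exact/L1E.
apply: (@le_trans _ _ (\int[mu]_x ((q - p)%:E * \int[mu]_eta K (x, eta)))%E).
  apply: ge0_le_integral => //.
  - by move=> x _; rewrite lee_fin patchE; case: ifP => // _; exact: sqr_ge0.
  - by move/L1E/measurable_int : lG.
  - apply: measurable_funeM.
    exact: (measurable_fun_fubini_tonelli_F K).
  - move=> x _; rewrite KE -EFinM lee_fin !patchE; case: ifP => _; last by rewrite mulr0.
    exact: key.
rewrite ge0_integralZl//; last 2 first.
- exact: (measurable_fun_fubini_tonelli_F K).
- by move=> x _; exact: integral_ge0.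
rewrite (fubini_tonelli K)//.
rewrite expr2 -mulrA EFinM lee_wpmul2l ?lee_fin//.
apply: (@le_trans _ _ (\int[mu]_eta (((fun=> M) \_ `[p, q]) eta)%:E)%E).
  apply: ge0_le_integral => //.
  - by move=> eta _; exact: integral_ge0.
  - exact: (measurable_fun_fubini_tonelli_G K).
  - by have /L1E/measurable_int := L1_cst p q M.
  - move=> eta _; rewrite KE' lee_fin !patchE; case: ifPn => // epq.
    by apply: fM; move: epq; rewrite inE/= in_itv.
rewrite -(@fineK _ (integral _ _ _)); last first.
  by apply: integrable_fin_num => //; exact/L1E/L1_cst.
by rewrite -[fine _]/(Rintegral _ _ _) -itgE itg_cst// mulrC lee_fin.
Qed.


End Translations.

(** * Calculus in time *)

Section TimeCalculus.
Context {R : realType}.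
Implicit Types (a b c r s t p q e D : R) (f g h F G H : R -> R).
Implicit Types (u v : R -> R -> R).
Local Notation mu := (@lebesgue_measure R).

Lemma normL2_ge0 D f : 0 <= normL2 D f. Proof. exact: sqrtr_ge0. Qed.

Lemma eq_normL2 D f g : (forall x, 0 <= x <= D -> f x = g x) ->
  normL2 D f = normL2 D g.
Proof. by move=> fg; congr Num.sqrt; apply: eq_itg => x /fg ->. Qed.

Lemma normL2Z D f r : L2 0 D f -> normL2 D (fun x => r * f x) = `|r| * normL2 D f.
Proof.
move=> lf; rewrite /normL2 intDE.
rewrite (@eq_itg _ _ _ _ (fun x => r ^+ 2 * f x ^+ 2)); last first.
  by move=> x _; rewrite exprMn.
rewrite itgZ; last exact: L2_sqr.
by rewrite sqrtrM ?sqr_ge0// sqrtr_sqr.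
Qed.

Lemma normL2_le D f e : 0 <= e -> itg 0 D (fun x => f x ^+ 2) <= e ^+ 2 ->
  normL2 D f <= e.
Proof. by move=> e0 h; rewrite -(ger0_norm e0) -sqrtr_sqr ler_wsqrtr. Qed.

Lemma itgM_le D f g : L2 0 D f -> L2 0 D g ->
  `|itg 0 D (fun x => f x * g x)| <= normL2 D f * normL2 D g.
Proof.
move=> lf lg; rewrite -(@ler_pXn2r _ 2) ?nnegrE ?mulr_ge0 ?normL2_ge0//.
by rewrite real_normK ?num_real// exprMn !sqr_normL2; exact: cauchy_schwarz.
Qed.

Lemma normL2D D f g : L2 0 D f -> L2 0 D g ->
  normL2 D (fun x => f x + g x) <= normL2 D f + normL2 D g.
Proof.
move=> lf lg; apply: normL2_le; first by rewrite addr_ge0 ?normL2_ge0.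
rewrite (@eq_itg _ _ _ _ (fun x => f x ^+ 2 + (2 * (f x * g x) + g x ^+ 2))); last first.
  by move=> x _; ring.
have lfg := L2M lf lg; have [sf sg] := (L2_sqr lf, L2_sqr lg).
rewrite itgD//; last by apply: L1D => //; exact: L1Z.
rewrite itgD//; last exact: L1Z.
rewrite itgZ// -!sqr_normL2 sqrrD.
have := itgM_le lf lg; rewrite ler_norml => /andP[_]; lra.
Qed.

Lemma normL2B D f g : L2 0 D f -> L2 0 D g ->
  normL2 D (fun x => f x - g x) <= normL2 D f + normL2 D g.
Proof.
move=> lf lg; rewrite (le_trans (normL2D lf (L2N lg)))// lerD2l.
rewrite -[leRHS]mul1r -[X in X * _](normr1 R) -normrN -normL2Z// le_eqVlt.
by apply/orP; left; apply/eqP/eq_normL2 => x _; rewrite mulN1r.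
Qed.

Global Instance in_time_filter t : Filter (in_time t).
Proof. by apply: within_filter; exact: dnbhs_filter. Qed.

Lemma in_timeP t (P : R -> Prop) : (\forall s \near in_time t, P s) <->
  exists2 d, 0 < d & forall s, 0 <= s -> s != t -> `|s - t| < d -> P s.
Proof.
split=> [[d/= d0 H]|[d d0 H]].
  exists d => // s s0 st sd; apply: (H s) => //=.
  by rewrite distrC.
exists d => //= s sd st s0; apply: H => //.
by rewrite distrC.
Qed.

Lemma cvg_in_time_le f t l : f s @[s --> in_time t] --> l <->
  forall e, 0 < e -> exists2 d, 0 < d &
    forall s, 0 <= s -> s != t -> `|s - t| < d -> `|f s - l| <= e.
Proof.
split=> [/cvgrPdist_le H e e0|H].
  by have /in_timeP[d d0 Hd] := H e e0; exists d => // s s0 st /Hd; rewrite distrC; apply.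
apply/cvgrPdist_le => e e0; apply/in_timeP.
by have [d d0 Hd] := H e e0; exists d => // s s0 st /Hd; rewrite distrC; apply.
Qed.

(** The quotient is multiplied out, so that the case s = t is no
    exception. *)
Lemma derivesP F t l : derives F t l <->
  forall e, 0 < e -> exists2 d, 0 < d &
    forall s, 0 <= s -> `|s - t| < d -> `|F s - F t - l * (s - t)| <= e * `|s - t|.
Proof.
split=> [/cvg_in_time_le H e e0|H].
  have [d d0 Hd] := H e e0; exists d => // s s0 sd.
  have [->|st] := eqVneq s t; first by rewrite !subrr mulr0 subr0 normr0 mulr0.
  have := Hd s s0 st sd; rewrite -(ler_pM2r (_ : 0 < `|s - t|)) ?normr_gt0 ?subr_eq0//.
  rewrite -normrM mulrBl mulrAC mulVf ?mul1r// subr_eq0//.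
apply/cvg_in_time_le => e e0; have [d d0 Hd] := H e e0; exists d => // s s0 st sd.
rewrite -(ler_pM2r (_ : 0 < `|s - t|)) ?normr_gt0 ?subr_eq0//.
by rewrite -normrM mulrBl mulrAC mulVf ?mul1r ?subr_eq0//; exact: Hd.
Qed.

Lemma contL2P D u t : contL2 D u t <->
  forall e, 0 < e -> exists2 d, 0 < d &
    forall s, 0 <= s -> `|s - t| < d -> normL2 D (fun x => u s x - u t x) <= e.
Proof.
split=> [/cvg_in_time_le H e e0|H].
  have [d d0 Hd] := H e e0; exists d => // s s0 sd.
  have [->|st] := eqVneq s t.
    rewrite (@eq_normL2 _ _ (fun=> 0)); last by move=> x _; rewrite subrr.
    rewrite normL2_le// ?(ltW e0)// (@eq_itg _ _ _ _ (fun=> 0)) ?itg_cst0 ?sqr_ge0//.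
    by move=> x _; rewrite expr0n.
  by have := Hd s s0 st sd; rewrite subr0 ger0_norm ?normL2_ge0.
apply/cvg_in_time_le => e e0; have [d d0 Hd] := H e e0; exists d => // s s0 st sd.
by rewrite subr0 ger0_norm ?normL2_ge0//; exact: Hd.
Qed.

(** The same reformulation in L^2; all functions must be square integrable
    for the scalar to be pulled out of the norm. *)
Lemma derivesL2P D u t l : (forall s, 0 <= s -> L2 0 D (u s)) -> 0 <= t -> L2 0 D l ->
  derivesL2 D u t l <->
  forall e, 0 < e -> exists2 d, 0 < d &
    forall s, 0 <= s -> `|s - t| < d ->
      normL2 D (fun x => u s x - u t x - (s - t) * l x) <= e * `|s - t|.
Proof.
move=> lu t0 ll.
have scale s : 0 <= s -> s != t ->
    normL2 D (fun x => u s x - u t x - (s - t) * l x) =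
    `|s - t| * normL2 D (fun x => (s - t)^-1 * (u s x - u t x) - l x).
  move=> s0 st; rewrite -normL2Z.
    apply: eq_normL2 => x _; rewrite mulrBr mulrA divff ?mul1r// subr_eq0//.
  by apply: L2B => //; apply: L2Z; apply: L2B; exact: lu.
split=> [/cvg_in_time_le H e e0|H].
  have [d d0 Hd] := H e e0; exists d => // s s0 sd.
  have [->|st] := eqVneq s t.
    rewrite subrr normr0 mulr0 normL2_le//.
    rewrite (@eq_itg _ _ _ _ (fun=> 0)) ?itg_cst0 ?sqr_ge0//.
    by move=> x _; rewrite subrr mul0r subrr expr0n.
  have := Hd s s0 st sd; rewrite subr0 ger0_norm ?normL2_ge0// scale// => h.
  by rewrite mulrC ler_wpM2r.
apply/cvg_in_time_le => e e0; have [d d0 Hd] := H e e0; exists d => // s s0 st sd.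
rewrite subr0 ger0_norm ?normL2_ge0//.
have := Hd s s0 sd; rewrite scale// mulrC ler_pM2r// normr_gt0 subr_eq0//.
Qed.

Lemma derives_cvg F t l : derives F t l -> F s @[s --> in_time t] --> F t.
Proof.
move=> /derivesP H; apply/cvg_in_time_le => e e0.
have [d d0 Hd] := H 1 ltr01.
have p0 : 0 < 1 + `|l| by rewrite ltr_pwDl.
exists (Num.min d (e / (1 + `|l|))); first by rewrite lt_min d0 divr_gt0.
move=> s s0 st; rewrite lt_min => /andP[sd se].
have := Hd s s0 sd; rewrite mul1r => h.
have -> : F s - F t = (F s - F t - l * (s - t)) + l * (s - t) by ring.
rewrite (le_trans (ler_normD _ _))// normrM.
rewrite (@le_trans _ _ ((1 + `|l|) * `|s - t|))//.
  by rewrite mulrDl mul1r lerD2r.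
by rewrite mulrC -ler_pdivlMr// ltW.
Qed.

Lemma derivesD F G t l m : derives F t l -> derives G t m ->
  derives (fun s => F s + G s) t (l + m).
Proof.
move=> dF dG; rewrite /derives.
rewrite (_ : (fun s => _) = fun s => (s - t)^-1 * (F s - F t) + (s - t)^-1 * (G s - G t)).
  exact: cvgD.
by apply/funext => s; ring.
Qed.

Lemma derivesM F G t l m : derives F t l -> derives G t m ->
  derives (fun s => F s * G s) t (l * G t + F t * m).
Proof.
move=> dF dG; rewrite /derives.
rewrite (_ : (fun s => _) = fun s => ((s - t)^-1 * (F s - F t)) * G s +
    F t * ((s - t)^-1 * (G s - G t))).
  apply: cvgD; first by apply: cvgM => //; exact: derives_cvg dG.
  by apply: cvgM => //; exact: cvg_cst.
by apply/funext => s; ring.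
Qed.

Lemma derives_cst r t : derives (fun=> r) t 0.
Proof.
rewrite /derives (_ : (fun s => _) = fun=> 0); first exact: cvg_cst.
by apply/funext => s; rewrite subrr mulr0.
Qed.

Lemma derivesZ F t l r : derives F t l -> derives (fun s => r * F s) t (r * l).
Proof.
by move=> /(derivesM (derives_cst r t)); rewrite mul0r add0r.
Qed.

Arguments derivesZ {F t l} r.

Lemma derivesB F G t l m : derives F t l -> derives G t m ->
  derives (fun s => F s - G s) t (l - m).
Proof.
move=> dF /(derivesZ (-1)) /(derivesD dF); rewrite mulN1r.
by congr derives; apply/funext => s; rewrite mulN1r.
Qed.

Lemma eq_derives F G t l : (forall s, 0 <= s -> F s = G s) -> 0 <= t ->
  derives F t l -> derives G t l.
Proof.
move=> FG t0 /derivesP H; apply/derivesP => e /H[d d0 Hd]; exists d => // s s0 sd.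
by rewrite -!FG//; exact: Hd.
Qed.

Lemma is_derive_derives F t l : is_derive t (1 : R) F l -> derives F t l.
Proof.
move=> [dF Fl]; apply/derivesP => e e0.
have : h^-1 *: (F (h *: 1 + t) - F t) @[h --> 0^'] --> l by rewrite -Fl.
move/cvgrPdist_le => /(_ e e0)[d/= d0 Hd]; exists d => // s s0 sd.
have [->|st] := eqVneq s t; first by rewrite !subrr mulr0 subr0 normr0 mulr0.
have st0 : s - t != 0 by rewrite subr_eq0.
have := Hd (s - t); rewrite /= sub0r normrN => /(_ sd st0).
rewrite /GRing.scale/= mulr1 subrK distrC.
rewrite -(ler_pM2r (_ : 0 < `|s - t|)) ?normr_gt0//.
by rewrite -normrM mulrBl mulrAC mulVf ?mul1r.
Qed.

Lemma derives_is_derive F t l : 0 < t -> derives F t l -> is_derive t (1 : R) F l.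
Proof.
move=> t0 /derivesP H.
suff H' : h^-1 *: (F (h *: 1 + t) - F t) @[h --> (0 : R)^'] --> l.
  split; first by apply/cvg_ex; exists l.
  exact/cvg_lim.
apply/cvgrPdist_le => e e0; have [d d0 Hd] := H e e0.
exists (Num.min d t); first by rewrite /= lt_min d0.
move=> h/=; rewrite sub0r normrN lt_min => /andP[hd ht] h0.
have := Hd (h + t); rewrite addrK => /(_ _ hd).
have -> : 0 <= h + t by move: ht; rewrite ltr_norml => /andP[? _]; lra.
move=> /(_ isT) Hh; rewrite /GRing.scale/= mulr1 distrC.
rewrite -(ler_pM2r (_ : 0 < `|h|)) ?normr_gt0//.
by rewrite -normrM mulrBl mulrAC mulVf ?mul1r.
Qed.

(** The derivative at time zero is one-sided, but the mean value theorem
    needs no derivative at the end points. *)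
Lemma derives_MVT F (l : R -> R) t1 t2 : 0 <= t1 -> t1 < t2 ->
  (forall t, 0 <= t -> derives F t (l t)) ->
  exists2 c, t1 < c < t2 & F t2 - F t1 = l c * (t2 - t1).
Proof.
move=> t10 t12 dF.
have [||c] := @MVT _ F l t1 t2 t12.
- move=> x; rewrite in_itv/= => /andP[t1x _].
  by apply: derives_is_derive; [exact: le_lt_trans t1x|exact/dF/ltW/(le_lt_trans t10)].
- apply/subspace_continuousP => x /=; rewrite in_itv/= => /andP[t1x xt2].
  have x0 := le_trans t10 t1x.
  have /cvg_in_time_le H := derives_cvg (dF x x0).
  apply/cvgrPdist_le => e e0; have [d d0 Hd] := H e e0.
  exists d => // s/= sd; rewrite in_itv/= => /andP[t1s _].
  have [->|sx] := eqVneq s x; first by rewrite subrr normr0 ltW.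
  by rewrite distrC; apply: Hd => //; [exact: le_trans t1s|rewrite distrC].
- by rewrite in_itv/= => c12 E; exists c.
Qed.

Lemma derives_nincr F (l : R -> R) t : 0 <= t ->
  (forall t, 0 <= t -> derives F t (l t)) -> (forall t, 0 <= t -> l t <= 0) ->
  F t <= F 0.
Proof.
rewrite le_eqVlt => /predU1P[<-//|t0] dF l0.
have [c /andP[c0 ct]] := derives_MVT (lexx 0) t0 dF.
move=> E; rewrite -subr_le0 E mulr_le0_ge0 ?l0 ?(ltW c0)//.
by rewrite subr0 ltW.
Qed.

Lemma derives_eq0 F t : 0 <= t -> (forall t, 0 <= t -> derives F t 0) -> F t = F 0.
Proof.
rewrite le_eqVlt => /predU1P[<-//|t0] dF.
have [c _] := derives_MVT (lexx 0) t0 dF.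
by rewrite mul0r => /eqP; rewrite subr_eq0 => /eqP.
Qed.

Lemma derives_exp r t : derives (fun s => expR (r * s)) t (r * expR (r * t)).
Proof.
apply: is_derive_derives; rewrite mulrC.
have h : is_derive t (1 : R) (fun s => r * s) r.
  by apply: is_derive_eq; rewrite /GRing.scale/= mulr1.
exact: (@is_derive1_comp _ expR (fun s => r * s)).
Qed.

Arguments derives_exp : clear implicits.

(** F(t) exp(- r t) has derivative zero. *)
Lemma derives_linear_ode F r t : 0 <= t ->
  (forall t, 0 <= t -> derives F t (r * F t)) -> F t = F 0 * expR (r * t).
Proof.
move=> t0 dF.
pose G s := F s * expR (- r * s).
have dG s : 0 <= s -> derives G s 0.
  move=> s0; have := derivesM (dF s s0) (derives_exp (- r) s).
  by congr derives; ring.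
have := derives_eq0 t0 dG; rewrite /G mulr0 expR0 mulr1 => <-.
by rewrite -mulrA -expRD mulNr addNr expR0 mulr1.
Qed.

Lemma derives_itgM D u t l h : (forall s, 0 <= s -> L2 0 D (u s)) -> 0 <= t ->
  L2 0 D l -> L2 0 D h -> derivesL2 D u t l ->
  derives (fun s => itg 0 D (fun x => u s x * h x)) t (itg 0 D (fun x => l x * h x)).
Proof.
move=> lu t0 ll lh /(derivesL2P lu t0 ll) H; apply/derivesP => e e0.
have p0 : 0 < 1 + normL2 D h by rewrite ltr_pwDl ?normL2_ge0.
have [d d0 Hd] := H _ (divr_gt0 e0 p0); exists d => // s s0 sd.
have -> : itg 0 D (fun x => u s x * h x) - itg 0 D (fun x => u t x * h x) -
    itg 0 D (fun x => l x * h x) * (s - t) =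
    itg 0 D (fun x => (u s x - u t x - (s - t) * l x) * h x).
  have [l1 l2 l3] := And3 (L2M (lu s s0) lh) (L2M (lu t t0) lh) (L2M ll lh).
  rewrite [X in _ - X]mulrC -itgZ// -itgB// -itgB//; [|exact: L1B|exact: L1Z].
  by apply: eq_itg => x _; ring.
have lust : L2 0 D (fun x => u s x - u t x - (s - t) * l x).
  by apply: L2B; [apply: L2B; exact: lu|exact: L2Z].
rewrite (le_trans (itgM_le lust lh))//.
rewrite (le_trans (ler_wpM2r (normL2_ge0 _ _) (Hd s s0 sd)))//.
rewrite mulrAC ler_wpM2r// mulrAC ler_pdivrMr// ler_wpM2l ?(ltW e0)//.
by rewrite lerDr.
Qed.

Lemma derives_itg D u t l : (forall s, 0 <= s -> L2 0 D (u s)) -> 0 <= t ->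
  L2 0 D l -> derivesL2 D u t l ->
  derives (fun s => itg 0 D (u s)) t (itg 0 D l).
Proof.
move=> lu t0 ll /(derives_itgM lu t0 ll (L2_cst 0 D 1)).
rewrite (@eq_itg _ _ _ _ l); last by move=> x _; rewrite mulr1.
by apply: eq_derives => // s _; apply: eq_itg => x _; rewrite mulr1.
Qed.

(** |u(s)|^2 - |u(t)|^2 = 2 <u(s) - u(t), u(t)> + |u(s) - u(t)|^2, where the
    last term is of second order in s - t. *)
Lemma derives_sqr D u t l : (forall s, 0 <= s -> L2 0 D (u s)) -> 0 <= t ->
  L2 0 D l -> derivesL2 D u t l ->
  derives (fun s => itg 0 D (fun x => u s x ^+ 2)) t (2 * itg 0 D (fun x => u t x * l x)).
Proof.
move=> lu t0 ll dul.
have d1 := derives_itgM lu t0 ll (lu t t0) dul.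
have d2 : derives (fun s => itg 0 D (fun x => (u s x - u t x) ^+ 2)) t 0.
  apply/derivesP => e e0.
  pose M := normL2 D l + 1.
  have M0 : 0 < M by rewrite ltr_wpDl ?normL2_ge0.
  have /derivesL2P := dul => /(_ lu t0 ll 1 ltr01)[d d0 Hd].
  exists (Num.min d (e / M ^+ 2)); first by rewrite lt_min d0 divr_gt0 ?exprn_gt0.
  move=> s s0; rewrite lt_min => /andP[sd se].
  rewrite (@eq_itg _ 0 D (fun x => (u t x - u t x) ^+ 2) (fun=> 0)) ?itg_cst0; last first.
    by move=> x _; rewrite subrr expr0n.
  rewrite subr0 mul0r subr0 -sqr_normL2 ger0_norm ?sqr_ge0//.
  have ns : normL2 D (fun x => u s x - u t x) <= M * `|s - t|.
    rewrite (@eq_normL2 _ _ (fun x => (u s x - u t x - (s - t) * l x) + (s - t) * l x)); last first.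
      by move=> x _; ring.
    rewrite (le_trans (normL2D _ _))//; [|exact: L2Z|].
      by apply: L2B; [apply: L2B; exact: lu|exact: L2Z].
    rewrite normL2Z//; have := Hd s s0 sd; rewrite /M; lra.
  rewrite (@le_trans _ _ ((M * `|s - t|) ^+ 2))//.
    by rewrite ler_sqr ?nnegrE ?normL2_ge0// mulr_ge0// ltW.
  rewrite exprMn expr2 [X in _ * X]expr2 mulrA ler_wpM2r//.
  by rewrite -expr2 mulrC -ler_pdivlMr ?exprn_gt0// ltW.
have := derivesD (derivesZ 2 d1) d2; rewrite addr0 mulrC.
rewrite [X in derives _ _ X]mulrC (@eq_itg _ _ _ (fun x => l x * _) (fun x => u t x * l x)); last first.
  by move=> x _; rewrite mulrC.
pose C := itg 0 D (fun x => u t x ^+ 2).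
move=> /derivesD/(_ (derives_cst (- C) t)); rewrite addr0.
apply: eq_derives => // s s0.
have [ls lt] := (lu s s0, lu t t0).
have [l1 l2 l3] := And3 (L2M ls lt) (L2_sqr lt) (L2_sqr ls).
rewrite (@eq_itg _ _ _ (fun x => (u s x - u t x) ^+ 2)
  (fun x => u s x ^+ 2 - (2 * (u s x * u t x) - u t x ^+ 2))); last by move=> x _; ring.
rewrite itgB//; last by apply: L1B => //; exact: L1Z.
rewrite itgB//; last exact: L1Z.
by rewrite itgZ// /C; ring.
Qed.

(** A weakly differentiable curve with strongly continuous derivative is
    strongly differentiable. The mean value theorem applied to the pairing
    with h bounds the pairing of h with the defect of differentiability; h is
    then taken to be that defect. *)
Lemma weak_to_strong D (P p : R -> R -> R) t :
  (forall s, 0 <= s -> L2 0 D (P s)) -> (forall s, 0 <= s -> L2 0 D (p s)) ->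
  (forall s, 0 <= s -> contL2 D p s) ->
  (forall h s, L2 0 D h -> 0 <= s ->
    derives (fun r => itg 0 D (fun x => P r x * h x)) s (itg 0 D (fun x => p s x * h x))) ->
  0 <= t -> derivesL2 D P t (p t).
Proof.
move=> lP lp cp dP t0; apply/derivesL2P => //; first exact: lp.
move=> e e0; have /contL2P/(_ e e0)[d d0 Hd] := cp t t0; exists d => // s s0 sd.
pose h x := P s x - P t x - (s - t) * p t x.
have lh : L2 0 D h by apply: L2B; [apply: L2B; exact: lP|apply: L2Z; exact: lp].
rewrite -/h.
pose F r := itg 0 D (fun x => P r x * h x) - itg 0 D (fun x => p t x * h x) * r.
pose l r := itg 0 D (fun x => p r x * h x) - itg 0 D (fun x => p t x * h x).
have dF r : 0 <= r -> derives F r (l r).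
  move=> r0; apply: derivesB; first exact: dP.
  have := derivesZ (itg 0 D (fun x => p t x * h x)) (is_derive_derives (is_derive_id r (1 : R))).
  by rewrite mulr1.
have hh : normL2 D h ^+ 2 = F s - F t.
  rewrite sqr_normL2 /F.
  have [l1 l2 l3] := And3 (L2M (lP s s0) lh) (L2M (lP t t0) lh) (L2M (lp t t0) lh).
  rewrite (@eq_itg _ _ _ _ (fun x => P s x * h x - P t x * h x - (s - t) * (p t x * h x))).
    rewrite itgB; [|exact: L1B|exact: L1Z].
    by rewrite itgB// itgZ//; ring.
  by move=> x _; rewrite expr2 {1}/h; ring.
have [c cst E] : exists2 c, 0 <= c /\ `|c - t| < d & F s - F t = l c * (s - t).
  have [st|ts|->] := ltgtP s t.
  - have [c /andP[sc ct] E] := derives_MVT s0 st dF.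
    exists c; last by rewrite -opprB E; ring.
    split; first by rewrite (le_trans s0)// ltW.
    by move: sd; rewrite !ltr0_norm ?subr_lt0//; lra.
  - have [c /andP[tc cs] E] := derives_MVT t0 ts dF.
    exists c => //; split; first by rewrite (le_trans t0)// ltW.
    by move: sd; rewrite !gtr0_norm ?subr_gt0//; lra.
  - by exists t; [rewrite subrr normr0|rewrite !subrr mulr0].
have [c0 cd] := cst.
have lc : `|l c| <= e * normL2 D h.
  rewrite /l -itgB; [|exact: L2M (lp _ _) _|exact: L2M (lp _ _) _].
  rewrite (@eq_itg _ _ _ _ (fun x => (p c x - p t x) * h x)); last first.
    by move=> x _; ring.
  rewrite (le_trans (itgM_le _ lh))//; first by apply: L2B; exact: lp.
  by rewrite ler_wpM2r ?normL2_ge0// Hd.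
have := normL2_ge0 D h; rewrite le_eqVlt => /predU1P[<-|h0].
  by rewrite mulr_ge0// ltW.
rewrite -(ler_pM2r h0) -expr2 hh E (le_trans (ler_norm _))// normrM mulrAC.
by rewrite ler_wpM2r.
Qed.

End TimeCalculus.
Arguments derivesZ {R F t l} r.
Arguments derives_exp {R} r t.

(** * Uniqueness *)

Section Uniqueness.
Context {R : realType}.
Variables (D c0 K : R).
Hypotheses (D_gt0 : 0 < D) (c0_gt0 : 0 < c0).
Implicit Types (th : R -> R) (u ux v : R -> R -> R) (t s : R).

(** What uniqueness needs of a solution, with primitives in place of weak
    derivatives. Only the spatial derivative is required to be continuous in
    time. *)
Definition weak_solution th u ux v : Prop := forall t, 0 <= t ->
  [/\ [/\ prim 0 D (u t) (ux t), L2 0 D (v t) & contL2 D ux t],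
      derives th t (itg 0 D (u t)) /\ derivesL2 D u t (v t),
      forall psi dpsi, prim 0 D psi dpsi -> psi D = 0 ->
        derives (fun s => itg 0 D (fun x => v s x * psi x)) t
          (- itg 0 D (fun x => ux t x * dpsi x)) &
      u t D = feedback D c0 K (th t) (u t) (v t)].

Lemma normH1_ge (f df : R -> R) : normL2 D df <= normH1 D f df.
Proof.
rewrite -[leLHS]ger0_norm ?normL2_ge0// -sqrtr_sqr ler_wsqrtr// lerDr.
exact: sqr_ge0.
Qed.

Lemma solution_weak th u ux v : solution D c0 K th u ux v -> weak_solution th u ux v.
Proof.
move=> [cs sol] t t0; have [hu /isL2P lv _ cu _] := cs t t0.
have [dth du dv bc] := sol t t0.
split => //.
- split => //; first exact/isH1P.
  apply/contL2P => e e0; have [d d0 Hd] := (cvg_in_time_le _ _ _).1 cu e e0.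
  exists d => // s s0 sd.
  have [->|st] := eqVneq s t.
    apply: normL2_le; first exact: ltW.
    rewrite (@eq_itg _ _ _ _ (fun=> 0)) ?itg_cst0 ?sqr_ge0// => x _.
    by rewrite subrr expr0n.
  have := Hd s s0 st sd; rewrite subr0; apply: le_trans.
  exact: le_trans (normH1_ge (fun x => u s x - u t x) _) (ler_norm _).
- by move=> psi dpsi ppsi psi0; apply: dv => //; exact/isH1P.
Qed.

Lemma derive1_g y : derive1 (g D) y = - y.
Proof.
have dg : is_derive y (1 : R) (g D) (- y).
  by apply: is_derive_eq; rewrite /GRing.scale/=; field.
by rewrite derive1E; case: dg.
Qed.

Lemma prim_g : prim 0 D (g D) (fun y => - y).
Proof.
apply: prim_C1 => [x|x]; last by apply: cvgN; exact: cvg_id.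
by apply: is_derive_eq; rewrite /GRing.scale/=; field.
Qed.

Lemma prim_id a b : prim a b (fun y : R => y) (fun=> 1).
Proof. by apply: prim_C1 => x; exact: cvg_cst. Qed.

Lemma g_end : g D D = 0. Proof. by rewrite /g subrr mul0r. Qed.

(** Integration by parts against x: this is how the trace at D and the
    integral of f are traded for a term controlled by the derivative. *)
Lemma itg_deriv_id (f df : R -> R) : prim 0 D f df ->
  itg 0 D (fun x => df x * x) = D * f D - itg 0 D f.
Proof.
move=> pf; have := itg_by_parts (ltW D_gt0) pf (prim_id 0 D).
rewrite mulr0 subr0 (@eq_itg _ _ _ _ f); last by move=> x _; rewrite mulr1.
by move=> h; rewrite (mulrC D) -h addrAC subrr add0r.
Qed.

(** The weight g vanishes at D and has derivative - y, so that the derivative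
    of the last term of Z is D u(D) - int u: this compensates the derivative of
    theta, and what remains is D (u(D) + c0 int v), which is D K Z by the
    feedback law. The variational equation applies because g is an admissible
    test function. *)
Lemma derives_Z th u ux v t : weak_solution th u ux v -> 0 <= t ->
  derives (fun s => Zstate D c0 (th s) (u s) (v s)) t
    (D * K * Zstate D c0 (th t) (u t) (v t)).
Proof.
move=> sol t0; have [[pu lv _] [dth du] dv bc] := sol t t0.
have lu s : 0 <= s -> L2 0 D (u s).
  by move=> s0; have [[/prim_L2F]] := sol s s0.
have d1 := dv _ _ prim_g g_end.
have d2 := derives_itg lu t0 lv du.
have := derivesD (derivesB dth (derivesZ (- D * c0) d2)) d1.
rewrite (_ : itg 0 D (u t) - _ + _ = D * K * Zstate D c0 (th t) (u t) (v t)).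
  apply: eq_derives => // s _; rewrite /Zstate derive1_g; congr (_ + _).
  by apply: eq_itg => x _; rewrite mulrC.
rewrite (@eq_itg _ _ _ (fun x => ux t x * - x) (fun x => - (ux t x * x))); last first.
  by move=> x _; rewrite mulrN.
rewrite itgN; last exact: L2M (prim_L2 pu) (prim_L2F (prim_id _ _)).
rewrite (itg_deriv_id pu) bc /feedback /Zstate derive1_g !intDE; ring.
Qed.

Lemma Z_exp th u ux v t : weak_solution th u ux v -> 0 <= t ->
  Zstate D c0 (th t) (u t) (v t) =
  Zstate D c0 (th 0) (u 0) (v 0) * expR (D * K * t).
Proof.
move=> sol t0; apply: (@derives_linear_ode _ (fun s => Zstate D c0 (th s) (u s) (v s))) => //.
by move=> s s0; exact: derives_Z sol s0.
Qed.

Lemma weak_solution_sub th u ux v th' u' ux' v' :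
  weak_solution th u ux v -> weak_solution th' u' ux' v' ->
  weak_solution (fun t => th t - th' t) (fun t x => u t x - u' t x)
    (fun t x => ux t x - ux' t x) (fun t x => v t x - v' t x).
Proof.
move=> sol sol' t t0.
have [[pu lv cux] [dth du] dv bc] := sol t t0.
have [[pu' lv' cux'] [dth' du'] dv' bc'] := sol' t t0.
have lu s : 0 <= s -> L2 0 D (u s) by move=> s0; have [[/prim_L2F]] := sol s s0.
have lu' s : 0 <= s -> L2 0 D (u' s) by move=> s0; have [[/prim_L2F]] := sol' s s0.
have lux s : 0 <= s -> L2 0 D (ux s) by move=> s0; have [[/prim_L2]] := sol s s0.
have lux' s : 0 <= s -> L2 0 D (ux' s) by move=> s0; have [[/prim_L2]] := sol' s s0.
have lvs s : 0 <= s -> L2 0 D (v s) by move=> s0; have [[_ l _] _ _ _] := sol s s0.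
have lvs' s : 0 <= s -> L2 0 D (v' s) by move=> s0; have [[_ l _] _ _ _] := sol' s s0.
split.
- split; [exact: primB|exact: L2B|].
  apply/contL2P => e e0.
  have e2 : 0 < e / 2 by rewrite divr_gt0.
  have /contL2P/(_ _ e2)[d1 d10 H1] := cux.
  have /contL2P/(_ _ e2)[d2 d20 H2] := cux'.
  exists (Num.min d1 d2); first by rewrite lt_min d10.
  move=> s s0; rewrite lt_min => /andP[sd1 sd2].
  rewrite (@eq_normL2 _ _ _ (fun x => (ux s x - ux t x) - (ux' s x - ux' t x))); last first.
    by move=> x _; ring.
  rewrite (le_trans (normL2B _ _))//; try by apply: L2B; auto.
  by have := H1 s s0 sd1; have := H2 s s0 sd2; lra.
- split; first by rewrite itgB; [exact: derivesB|exact: L2_L1 (lu _ _)|exact: L2_L1 (lu' _ _)].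
  have luB s : 0 <= s -> L2 0 D (fun x => u s x - u' s x) by move=> s0; apply: L2B; auto.
  apply/(derivesL2P luB t0 (L2B lv lv')) => e e0.
  have e2 : 0 < e / 2 by rewrite divr_gt0.
  have /(derivesL2P lu t0 lv)/(_ _ e2)[d1 d10 H1] := du.
  have /(derivesL2P lu' t0 lv')/(_ _ e2)[d2 d20 H2] := du'.
  exists (Num.min d1 d2); first by rewrite lt_min d10.
  move=> s s0; rewrite lt_min => /andP[sd1 sd2].
  rewrite (@eq_normL2 _ _ _ (fun x => (u s x - u t x - (s - t) * v t x) -
     (u' s x - u' t x - (s - t) * v' t x))); last by move=> x _; ring.
  rewrite (le_trans (normL2B _ _))//; try by apply: L2B; [apply: L2B; auto|exact: L2Z].
  by have := H1 s s0 sd1; have := H2 s s0 sd2; lra.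
- move=> psi dpsi ppsi psi0.
  have lpsi := prim_L2F ppsi; have ldpsi := prim_L2 ppsi.
  have := derivesB (dv _ _ ppsi psi0) (dv' _ _ ppsi psi0).
  rewrite (@eq_itg _ _ _ (fun x => (ux t x - ux' t x) * dpsi x)
    (fun x => ux t x * dpsi x - ux' t x * dpsi x)); last by move=> x _; ring.
  rewrite itgB; [|apply: L2M; auto|apply: L2M; auto].
  rewrite opprB addrC opprK; apply: eq_derives => // s s0.
  rewrite -itgB; [|apply: L2M; auto|apply: L2M; auto].
  by apply: eq_itg => x _; ring.
- rewrite bc bc' /feedback /Zstate !intDE.
  have lg := prim_L2F prim_g.
  rewrite !itgB; try by apply: L2_L1; auto.
  rewrite (@eq_itg _ _ _ (fun x => g D x * (v t x - v' t x))
    (fun x => g D x * v t x - g D x * v' t x)); last by move=> x _; ring.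
  rewrite itgB; [|apply: L2M; auto|apply: L2M; auto].
  ring.
Qed.

(** With P = int_0^x v the pair (u, P) satisfies u_t = P_x and P_t = u_x, and
    |u|^2 + |P|^2 has derivative 2 P(D) u(D) = - 2 c0 (int v)^2 as Z = 0. This
    energy, unlike |u_x|^2 + |v|^2, is differentiable for finite-energy
    solutions: P_t = u_x holds weakly by the variational equation with
    int_x^D h as test function, hence strongly. *)
Lemma weak_solution_zero th u ux v : weak_solution th u ux v ->
  th 0 = 0 -> (forall x, 0 <= x <= D -> u 0 x = 0) -> eq_ae_on 0 D (v 0) (fun=> 0) ->
  forall t, 0 <= t ->
    [/\ th t = 0, forall x, 0 <= x <= D -> u t x = 0 & eq_ae_on 0 D (v t) (fun=> 0)].
Proof.
move=> sol th0 u0 v0.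
have pu s : 0 <= s -> prim 0 D (u s) (ux s) by move=> s0; have [[]] := sol s s0.
have lu s : 0 <= s -> L2 0 D (u s) by move=> s0; exact: prim_L2F (pu s s0).
have lux s : 0 <= s -> L2 0 D (ux s) by move=> s0; exact: prim_L2 (pu s s0).
have lv s : 0 <= s -> L2 0 D (v s) by move=> s0; have [[_ l _] _ _ _] := sol s s0.
have lg := prim_L2F prim_g.
have v00 h : L2 0 D h -> itg 0 D (fun x => v 0 x * h x) = 0.
  move=> lh; apply: itg_ae0; first exact: L2M (lv _ _) lh.
  case: v0 => N [mN N0 v0]; exists N; split => //; apply: subset_trans v0.
  by apply: subsetC => x vx xD; rewrite vx// mul0r.
have iv0 : itg 0 D (v 0) = 0.
  by apply: itg_ae0 => //; exact: L2_L1 (lv 0 _).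
have Z0 t : 0 <= t -> Zstate D c0 (th t) (u t) (v t) = 0.
  move=> t0; rewrite (Z_exp sol t0) /Zstate th0 !intDE.
  rewrite (@eq_itg _ _ _ (u 0) (fun=> 0))// itg_cst0 mulr0 subr0 add0r.
  rewrite (@eq_itg _ _ _ _ (fun x => v 0 x * g D x)); last by move=> x _; rewrite mulrC.
  by rewrite v00// mul0r.
pose P s x := itg 0 x (v s).
have pP s : 0 <= s -> prim 0 D (P s) (v s) by move=> s0; exact: prim_itg (lv s s0).
have lP s : 0 <= s -> L2 0 D (P s) by move=> s0; exact: prim_L2F (pP s s0).
have P00 s : P s 0 = 0 by rewrite /P itg_point.
have dP t : 0 <= t -> derivesL2 D P t (ux t).
  move=> t0; apply: weak_to_strong => //.
    by move=> s s0; have [[]] := sol s s0.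
  move=> h s lh s0; have [_ _ + _] := sol s s0.
  pose psi x := itg 0 D h - itg 0 x h.
  have ppsi : prim 0 D psi (fun x => - h x).
    have := primB (primZ (itg 0 D h) (prim_C1 0 D (fun x => is_derive_cst (1 : R) x 1) _))
      (prim_itg lh).
    move=> /(_ (fun x => cvg_cst _)); apply: eq_prim => x _; first by rewrite mulr1.
    by rewrite mulr0 sub0r.
  have psiD : psi D = 0 by rewrite /psi subrr.
  move=> /(_ _ _ ppsi psiD).
  rewrite (@eq_itg _ _ _ (fun x => ux s x * - h x) (fun x => - (ux s x * h x))); last first.
    by move=> x _; rewrite mulrN.
  rewrite itgN ?opprK; last by apply: L2M; auto.
  apply: eq_derives => // r r0.
  have := itg_by_parts (ltW D_gt0) (pP r r0) ppsi; rewrite psiD P00 mulr0 mul0r subrr.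
  rewrite (@eq_itg _ _ _ (fun x => P r x * - h x) (fun x => - (P r x * h x))); last first.
    by move=> x _; rewrite mulrN.
  rewrite itgN; last by apply: L2M; auto.
  by move/eqP; rewrite addr_eq0 => /eqP/oppr_inj ->.
pose E s := itg 0 D (fun x => P s x ^+ 2) + itg 0 D (fun x => u s x ^+ 2).
have dE t : 0 <= t -> derives E t (- 2 * c0 * itg 0 D (v t) ^+ 2).
  move=> t0; have [[_ _ _] [_ du] _ bc] := sol t t0.
  have := derivesD (derives_sqr lP t0 (lux t t0) (dP t t0)) (derives_sqr lu t0 (lv t t0) du).
  congr derives.
  have := itg_by_parts (ltW D_gt0) (pP t t0) (pu t t0).
  rewrite P00 mul0r subr0 bc /feedback Z0// mulr0 sub0r intDE.
  rewrite (@eq_itg _ _ _ (fun x => v t x * u t x) (fun x => u t x * v t x)); last first.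
    by move=> x _; rewrite mulrC.
  by rewrite -mulrDr => ->; rewrite /P; ring.
have E0 : E 0 = 0.
  rewrite /E (@eq_itg _ _ _ (fun x => P 0 x ^+ 2) (fun=> 0)) ?itg_cst0; last first.
    move=> x /andP[x0 xD]; rewrite /P.
    rewrite itg_ae0 ?expr0n//; first exact: L2_L1S (lv 0 _).
    case: v0 => N [mN N0 v0]; exists N; split => //; apply: subset_trans v0.
    apply: subsetC => y /= vy; rewrite in_itv/= => /andP[y0 yx]; apply: vy.
    by rewrite in_itv/= y0 (le_trans yx).
  rewrite (@eq_itg _ _ _ (fun x => u 0 x ^+ 2) (fun=> 0)) ?itg_cst0 ?addr0//.
  by move=> x x0D; rewrite u0// expr0n.
have u_eq0 t : 0 <= t -> forall x, 0 <= x <= D -> u t x = 0.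
  move=> t0.
  have Et : E t <= 0.
    rewrite -E0; apply: (derives_nincr t0 dE) => s s0.
    by rewrite mulr_le0_ge0 ?sqr_ge0//; have := c0_gt0; lra.
  have uu : itg 0 D (fun x => u t x ^+ 2) = 0.
    apply/eqP; rewrite eq_le itg_ge0 ?andbT; last by move=> x _; exact: sqr_ge0.
    apply: le_trans Et; rewrite /E lerDr itg_ge0// => x _; exact: sqr_ge0.
  have cu : {within `[0, D], continuous (fun x => u t x ^+ 2)}.
    have cu := prim_continuous (ltW D_gt0) (pu t t0).
    have -> : (fun x => u t x ^+ 2) = (fun x => u t x * u t x).
      by apply/funext => x; rewrite expr2.
    by move=> x; apply: cvgM; exact: cu.
  move=> x x0D; have := continuous_itg_eq0 D_gt0 cu (fun x _ => sqr_ge0 _) uu x0D.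
  by move/eqP; rewrite sqrf_eq0 => /eqP.
move=> t t0; split => //; first last.
- have [_ [_ du] _ _] := sol t t0.
  apply: itg_sqr_eq0; first exact: lv.
  rewrite -sqr_normL2; apply/eqP; rewrite sqrf_eq0; apply/eqP.
  have vc s : 0 <= s -> normL2 D (fun x => (s - t)^-1 * (u s x - u t x) - v t x) =
      normL2 D (v t).
    move=> s0; rewrite /normL2; congr Num.sqrt; apply: eq_itg => x x0D.
    by rewrite !u_eq0// subrr mulr0 sub0r sqrrN.
  apply/eqP; rewrite eq_le normL2_ge0 andbT; apply/ler_addgt0Pr => e e0.
  have [d d0 Hd] := (cvg_in_time_le _ _ _).1 du e e0.
  have := Hd (t + d / 2); rewrite vc; last by rewrite addr_ge0// divr_ge0 ?ltW.
  rewrite add0r => h; rewrite -[leLHS]ger0_norm ?normL2_ge0// -[normL2 _ _]subr0.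
  apply: h.
  + by rewrite addr_ge0// divr_ge0 ?ltW.
  + by rewrite -subr_eq0 addrAC subrr add0r gt_eqF// divr_gt0.
  + by rewrite addrAC subrr add0r gtr0_norm; lra.
- exact: u_eq0.
- rewrite -th0; apply: (derives_eq0 t0) => s s0.
  have [_ [dth _] _ _] := sol s s0.
  by move: dth; rewrite (@eq_itg _ _ _ _ (fun=> 0)) ?itg_cst0//; exact: u_eq0.
Qed.

End Uniqueness.

(** * Quasi-periodic extension *)

Section QuasiPeriodic.
Context {R : realType}.
Variables (D r : R).
Hypotheses (D_gt0 : 0 < D) (r_neq0 : r != 0).
Implicit Types (s t x : R) (f g h F G H P M p m : R -> R) (n : int).

(** A function on [- D, D] from one on [0, D] for each direction of
    travel: M is read backwards on the left half. *)
Definition glue P M x : R := if x < 0 then M (- x) else P x.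

Lemma glue_prim P p M m : prim 0 D P p -> prim 0 D M m -> P 0 = M 0 ->
  prim (- D) D (glue P M) (glue p (fun x => - m x)).
Proof.
move=> pP pM PM0; apply: (@prim_cat _ _ 0).
- by rewrite oppr_le0 ltW.
- exact: ltW.
- have pM' : prim (- 0) (- - D) M m by rewrite oppr0 opprK.
  apply: eq_prim (prim_opp pM') => x /andP[Dx x0]; rewrite /glue; last by rewrite x0.
  by move: x0; rewrite le_eqVlt => /predU1P[->|->//]; rewrite ltxx oppr0.
- apply: eq_prim pP => x /andP[x0 xD]; rewrite /glue; first by rewrite ltNge x0.
  by rewrite ltNge ltW.
Qed.

Definition tile s : int := Num.floor ((s + D) / (2 * D)).

(** The extension of h from [- D, D[ to the line with
    k(s + 2 D) = r k(s). A real factor r of either sign is allowed, which is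
    why it is built tile by tile and not as an exponential times a periodic
    function. *)
Definition qper h s : R := r ^ tile s * h (s - 2 * D * (tile s)%:~R).

Definition node n : R := 2 * D * n%:~R - D.

Let D2 : 0 < 2 * D. Proof. by rewrite mulr_gt0. Qed.

Lemma nodeS n : node (n + 1) = node n + 2 * D.
Proof. by rewrite /node intrD; ring. Qed.

Lemma tile_itv s : node (tile s) <= s < node (tile s + 1).
Proof.
have /andP[h1 h2] := floor_itv ((s + D) / (2 * D)).
rewrite ler_pdivlMr// in h1; rewrite ltr_pdivrMr// in h2.
rewrite nodeS /node; apply/andP; split; first by rewrite /tile; lra.
by move: h2; rewrite intrD /tile; lra.
Qed.

Lemma tileE s n : node n <= s < node (n + 1) -> tile s = n.
Proof.
move=> /andP[h1 h2]; apply: floor_def.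
rewrite ler_pdivlMr// ltr_pdivrMr// intrD.
move: h1 h2; rewrite nodeS /node => h1 h2; apply/andP; split; lra.
Qed.

Lemma qper_tile h s n : node n <= s < node (n + 1) ->
  qper h s = r ^ n * h (s - 2 * D * n%:~R).
Proof. by move=> /tileE sn; rewrite /qper sn. Qed.

(** The matching condition at the ends makes the formula of a tile valid on
    its closure, where the next tile takes over. *)
Lemma qper_tile_closed h s n : h D = r * h (- D) -> node n <= s <= node (n + 1) ->
  qper h s = r ^ n * h (s - 2 * D * n%:~R).
Proof.
move=> hD /andP[ns]; rewrite le_eqVlt => /predU1P[sn|sn]; last first.
  by apply: qper_tile; rewrite ns.
rewrite (@qper_tile _ _ (n + 1)); last by rewrite sn lexx/= !nodeS ltrDl.
rewrite sn nodeS /node expfzDr// expr1z -(mulrA (r ^ n)).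
have -> : 2 * D * n%:~R - D + 2 * D - 2 * D * n%:~R = D by ring.
have -> : 2 * D * n%:~R - D + 2 * D - 2 * D * (n + 1)%:~R = - D.
  by rewrite intrD; ring.
by rewrite hD.
Qed.

Lemma qper0 h x : - D < x < D -> qper h x = h x.
Proof.
move=> /andP[Dx xD]; rewrite (@qper_tile _ _ 0).
  by rewrite expr0z mul1r mulr0 subr0.
by rewrite nodeS /node mulr0; apply/andP; split; lra.
Qed.

Lemma qper0_closed h x : h D = r * h (- D) -> - D <= x <= D -> qper h x = h x.
Proof.
move=> hD /andP[Dx xD]; rewrite (@qper_tile_closed _ _ 0)//.
  by rewrite expr0z mul1r mulr0 subr0.
by rewrite nodeS /node mulr0; apply/andP; split; lra.
Qed.

Lemma qper_shift h s : qper h (s + 2 * D) = r * qper h s.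
Proof.
have /andP[s1 s2] := tile_itv s.
rewrite (@qper_tile _ _ (tile s + 1)); last first.
  by move: s1 s2; rewrite !nodeS => s1 s2; apply/andP; split; lra.
rewrite /qper expfzDr// expr1z mulrCA mulrA; congr (_ * h _).
by rewrite intrD; ring.
Qed.

(** Only the function itself has to match at the joints: its derivative may
    jump there. *)
Lemma prim_qper H h : prim (- D) D H h -> H D = r * H (- D) ->
  primR (qper H) (qper h).
Proof.
move=> pH HD.
have ptile n : prim (node n) (node (n + 1)) (qper H) (qper h).
  have pH' : prim (node n + - (2 * D * n%:~R)) (node (n + 1) + - (2 * D * n%:~R)) H h.
    rewrite nodeS (_ : node n + - _ = - D); last by rewrite /node; ring.
    by rewrite (_ : node n + _ + - _ = D)//; rewrite /node; ring.
  apply: eq_prim (primZ (r ^ n) (prim_shift pH')) => x xn.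
    by rewrite (qper_tile_closed HD xn).
  by rewrite (@qper_tile h x n)//; case/andP: xn => /ltW -> ->.
have node_le n (k : nat) : node n <= node (n + k%:Z).
  rewrite /node intrD lerD2r ler_wpM2l//; first exact: ltW.
  by rewrite lerDl ler0z.
have pcat n (k : nat) : prim (node n) (node (n + k.+1%:Z)) (qper H) (qper h).
  elim: k => [|k IH]; first exact: ptile.
  have e : n + k.+2%:Z = n + k.+1%:Z + 1 by rewrite -addrA -PoszD addn1.
  rewrite e; apply: prim_cat (node_le _ _) _ IH (ptile _).
  by rewrite nodeS lerDl ltW.
move=> a b.
have /andP[an _] := tile_itv a.
pose k := (Num.trunc `|(b - node (tile a)) / (2 * D)|).+1.
apply: primS an _ (pcat (tile a) k).
have kb : (b - node (tile a)) / (2 * D) < k%:R.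
  exact: le_lt_trans (ler_norm _) (truncnS_gt _).
rewrite ltr_pdivrMr// in kb.
have : node (tile a) + k%:R * (2 * D) <= node (tile a + k.+1%:Z).
  rewrite /node intrD -[k.+1%:~R]/(k.+1%:R) -natr1.
  by have := D_gt0; lra.
lra.
Qed.

End QuasiPeriodic.

(** * Travelling waves *)

Section Waves.
Context {R : realType}.
Variables (D : R).
Hypotheses (D_gt0 : 0 < D).
Implicit Types (e s t x : R) (f h F : R -> R).

(** The sign e is 1 for the solution u, which extends evenly across the
    Neumann end, and for u_t; it is - 1 for u_x. *)
Definition wave e F t x : R := F (x + t) + e * F (- x + t).

Lemma locL2_opp f : locL2 f -> locL2 (fun x => f (- x)).
Proof. by move=> lf a b; exact: L2_opp. Qed.

Lemma wave_locL2 e f t : locL2 f -> locL2 (wave e f t).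
Proof.
move=> lf a b; apply: L2D; first exact: locL2_shift.
by apply/L2Z/(@locL2_opp (fun x => f (x + t)))/locL2_shift.
Qed.

Lemma wave_prim e F f t : primR F f -> primR (wave e F t) (wave (- e) f t).
Proof.
move=> pF a b; have pFt : primR (fun x => F (x + t)) (fun x => f (x + t)).
  by move=> c d; exact: prim_shift.
have := primD (pFt a b) (primZ e (prim_opp (pFt (- b) (- a)))).
by apply: eq_prim => x _; rewrite /wave// mulrN mulNr.
Qed.

Lemma itg_fold f : L1 (- D) D f ->
  itg 0 D f + itg 0 D (fun x => f (- x)) = itg (- D) D f.
Proof.
have D0 : - D <= 0 by rewrite oppr_le0 ltW.
move=> lf; rewrite (@itg_cat _ (- D) 0 D)//; last exact: ltW.
rewrite itg_opp oppr0 1?addrC//.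
by apply: L1S lf => //; exact: ltW.
Qed.

(** On [0, D] a wave sees its profile over the whole window [- D, D]; the
    factor 2 is that of (p + e q)^2 <= 2 (p^2 + q^2). *)
Lemma normL2_fold e f : locL2 f -> `|e| <= 1 ->
  normL2 D (fun x => f x + e * f (- x)) ^+ 2 <= 2 * itg (- D) D (fun x => f x ^+ 2).
Proof.
move=> lf e1; have lfo := locL2_opp lf.
rewrite sqr_normL2 -itg_fold; last exact/L2_sqr/lf.
rewrite mulrDr -!itgZ; [|exact/L2_sqr/lfo|exact/L2_sqr/lf].
have l1 := L1Z 2 (L2_sqr (lf 0 D)); have l2 := L1Z 2 (L2_sqr (lfo 0 D)).
rewrite -itgD//; apply: le_itg; [|exact: L1D|move=> x _].
  by apply/L2_sqr/L2D; [exact: lf|exact/L2Z/lfo].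
have ee : e ^+ 2 <= 1 by rewrite -[e ^+ 2]ger0_norm ?sqr_ge0// normrX expr_le1.
have := sqr_ge0 (f x - e * f (- x)).
have := ler_wpM2r (sqr_ge0 (f (- x))) ee.
rewrite -exprMn; set y := e * f (- x); rewrite !expr2; lra.
Qed.

(** Parallelogram identity: the energy of a wave is carried by the window of
    its profile. *)
Lemma wave_energy f t : locL2 f ->
  normL2 D (wave (- 1) f t) ^+ 2 + normL2 D (wave 1 f t) ^+ 2 =
  2 * itg (- D) D (fun x => f (x + t) ^+ 2).
Proof.
move=> lf; have lft := locL2_shift t lf; have lfo := locL2_opp lft.
rewrite !sqr_normL2 -itgD; [|exact/L2_sqr/wave_locL2|exact/L2_sqr/wave_locL2].
rewrite -(itg_fold (L2_sqr (lft _ _))) mulrDr.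
rewrite -!itgZ; [|exact/L2_sqr/lfo|exact/L2_sqr/lft].
rewrite -itgD; [|exact/L1Z/L2_sqr/lft|exact/L1Z/L2_sqr/lfo].
by apply: eq_itg => x _; rewrite /wave; ring.
Qed.

Lemma wave_contL2 e f t : locL2 f -> `|e| <= 1 -> contL2 D (wave e f) t.
Proof.
move=> lf e1; apply/contL2P => eps eps0.
have DD : - D <= D by have := D_gt0; lra.
have e2 : 0 < eps ^+ 2 / 2 by rewrite divr_gt0 ?exprn_gt0.
have [d d0 Hd] := translation_continuous t lf DD e2.
exists d => // s _ /Hd h.
rewrite -(@ler_pXn2r _ 2) ?nnegrE ?normL2_ge0 ?(ltW eps0)//.
pose k x := f (x + s) - f (x + t).
have lk : locL2 k by move=> a b; apply: L2B; exact: locL2_shift.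
rewrite (@eq_normL2 _ _ _ (fun x => k x + e * k (- x))); last first.
  by move=> x _; rewrite /wave /k; ring.
by apply: le_trans (normL2_fold lk e1) _; move: h; rewrite -/k; lra.
Qed.

(** The difference quotient of the profile converges in L^2 by continuity of
    translations; this uses no more than square integrability of f. *)
Lemma wave_derives e F f t : primR F f -> `|e| <= 1 -> 0 <= t ->
  derivesL2 D (wave e F) t (wave e f t).
Proof.
move=> pF e1 t0; have lf := primR_locL2 pF; have lF := primR_locL2F pF.
apply/derivesL2P => //; [by move=> s _; exact: wave_locL2|exact: wave_locL2|].
move=> eps eps0.
have DD : - D <= D by have := D_gt0; lra.
have e2 : 0 < eps ^+ 2 / 2 by rewrite divr_gt0 ?exprn_gt0.
have [d d0 Hd] := translation_continuous t lf DD e2.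
exists d => // s _ sd.
rewrite -(@ler_pXn2r _ 2) ?nnegrE ?mulr_ge0 ?normL2_ge0 ?(ltW eps0)//.
pose k x := F (x + s) - F (x + t) - (s - t) * f (x + t).
have lk : locL2 k.
  by move=> a b; apply: L2B; [apply: L2B|apply: L2Z]; exact: locL2_shift.
rewrite (@eq_normL2 _ _ _ (fun x => k x + e * k (- x))); last first.
  by move=> x _; rewrite /wave /k; ring.
apply: le_trans (normL2_fold lk e1) _.
have pFt : primR (fun x => F (x + t)) (fun x => f (x + t)).
  by move=> c c'; exact: prim_shift.
have bnd p q : p <= 0 -> 0 <= q -> q - p = `|s - t| ->
    itg (- D) D (fun x => (F (x + q + t) - F (x + p + t) - (q - p) * f (x + t)) ^+ 2) <=
    (q - p) ^+ 2 * (eps ^+ 2 / 2).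
  move=> p0 q0 qp.
  apply: (@increment_bound _ (fun x => F (x + t)) (fun x => f (x + t))) => //.
    exact: le_trans q0.
  move=> eta /andP[pe eq]; have := Hd (eta + t).
  rewrite addrK (_ : `|eta| < d); last first.
    by apply: le_lt_trans sd; rewrite -qp ler_norml; apply/andP; split; lra.
  by move=> /(_ isT); apply: le_trans; rewrite le_eqVlt; apply/orP; left;
    apply/eqP/eq_itg => x _; rewrite addrA.
have {bnd} : itg (- D) D (fun x => k x ^+ 2) <= `|s - t| ^+ 2 * (eps ^+ 2 / 2).
  have [ts|/ltW st] := leP t s.
    have := bnd 0 (s - t); rewrite lexx subr_ge0 subr0 ger0_norm ?subr_ge0//.
    move=> /(_ isT ts erefl); apply: le_trans.
    rewrite le_eqVlt; apply/orP; left; apply/eqP/eq_itg => x _.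
    by rewrite /k addr0 (_ : x + (s - t) + t = x + s)//; ring.
  have := bnd (s - t) 0; rewrite lexx subr_le0 sub0r ler0_norm ?subr_le0//.
  move=> /(_ st isT erefl); apply: le_trans.
  rewrite le_eqVlt; apply/orP; left; apply/eqP/eq_itg => x _.
  by rewrite /k addr0 (_ : x + (s - t) + t = x + s); ring.
by rewrite exprMn; lra.
Qed.

Lemma wave_itg F f t : primR F f -> itg 0 D (wave 1 f t) = F (D + t) - F (- D + t).
Proof.
move=> pF; have [_] := wave_prim (- 1) t pF 0 D.
rewrite opprK => /(_ 0 D (lexx _) (ltW D_gt0) (lexx _)) <-.
by rewrite /wave oppr0; ring.
Qed.

(** Integration by parts moves the derivative from psi onto the wave: the
    pairing of wave 1 f with psi equals minus that of wave (- 1) F with the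
    derivative of psi, and the latter is differentiable by the L^2 calculus.
    The boundary terms vanish because psi(D) = 0 and wave (- 1) F vanishes at
    x = 0. *)
Lemma wave_weak F f t psi dpsi : primR F f -> 0 <= t -> prim 0 D psi dpsi ->
  psi D = 0 ->
  derives (fun s => itg 0 D (fun x => wave 1 f s x * psi x)) t
    (- itg 0 D (fun x => wave (- 1) f t x * dpsi x)).
Proof.
move=> pF t0 ppsi psiD; have lf := primR_locL2 pF; have lF := primR_locL2F pF.
have n1 : `|- 1 : R| <= 1 by rewrite normrN normr1.
have := derives_itgM (fun s _ => wave_locL2 (- 1) s lF 0 D) t0
  (wave_locL2 (- 1) t lf 0 D) (prim_L2 ppsi) (wave_derives pF n1 t0).
move=> /(derivesZ (- 1)); rewrite mulN1r.
apply: eq_derives => // s _.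
have := itg_by_parts (ltW D_gt0) (wave_prim (- 1) s pF 0 D) ppsi.
rewrite psiD mulr0 {3}/wave oppr0 mulN1r subrr mul0r subr0 opprK => /eqP.
by rewrite addr_eq0 mulN1r => /eqP ->; rewrite opprK.
Qed.

End Waves.

(** * The closed loop in terms of waves *)

Section ClosedLoopWaves.
Context {R : realType}.
Variables (D c0 K : R).
Hypotheses (D_gt0 : 0 < D).
Implicit Types (t s x : R) (F f : R -> R).

(** The value that makes Z equal to Z0 exp(D K t) for the given wave. Defining
    theta by solving for it leaves one thing to check, namely that its
    derivative is int u. *)
Definition wave_th (Z0 : R) F f t : R :=
  Z0 * expR (D * K * t) - D * c0 * itg 0 D (wave 1 F t) -
  itg 0 D (fun x => g D x * wave 1 f t x).

Lemma Zstate_wave Z0 F f t :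
  Zstate D c0 (wave_th Z0 F f t) (wave 1 F t) (wave 1 f t) =
  Z0 * expR (D * K * t).
Proof. by rewrite /Zstate /wave_th derive1_g !intDE; ring. Qed.

Section Solution.
Variables (Z0 : R) (F f : R -> R).
Hypothesis pF : primR F f.
Hypothesis reflection : forall t, 0 <= t ->
  (1 + c0) * F (D + t) + (1 - c0) * F (- D + t) = K * (Z0 * expR (D * K * t)).

Let n1 : `|- 1 : R| <= 1. Proof. by rewrite normrN normr1. Qed.
Let p1 : `|1 : R| <= 1. Proof. by rewrite normr1. Qed.
Let lf : locL2 f. Proof. exact: primR_locL2 pF. Qed.
Let lF : locL2 F. Proof. exact: primR_locL2F pF. Qed.

Lemma wave_feedback t : 0 <= t ->
  wave 1 F t D = feedback D c0 K (wave_th Z0 F f t) (wave 1 F t) (wave 1 f t).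
Proof.
move=> t0; rewrite /feedback Zstate_wave intDE (wave_itg D_gt0 t pF).
by have := reflection t0; rewrite /wave; lra.
Qed.

(** The computation of the derivative of Z in reverse: by the reflection
    condition D K Z equals D (u(D) + c0 int v), and the integral of x u_x
    turns D u(D) into int u. *)
Lemma wave_th_derives t : 0 <= t ->
  derives (wave_th Z0 F f) t (itg 0 D (wave 1 F t)).
Proof.
move=> t0.
have d1 := derivesZ Z0 (derives_exp (D * K) t).
have d2 := derivesZ (D * c0) (derives_itg (fun s _ => wave_locL2 1 s lF 0 D) t0
  (wave_locL2 1 t lf 0 D) (wave_derives D_gt0 pF p1 t0)).
have d3 := wave_weak D_gt0 pF t0 (prim_g D) (g_end D).
have := derivesB (derivesB d1 d2) d3.
have pu := wave_prim 1 t pF 0 D.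
rewrite (@eq_itg _ _ _ (fun x => wave (- 1) f t x * - x)
  (fun x => - (wave (- 1) f t x * x))); last by move=> x _; rewrite mulrN.
rewrite itgN; last by apply: L2M (prim_L2 pu) (prim_L2F (prim_id _ _)).
rewrite (itg_deriv_id D_gt0 pu) (wave_itg D_gt0 t pF).
have -> : Z0 * (D * K * expR (D * K * t)) - D * c0 * (F (D + t) - F (- D + t)) -
    - - (D * wave 1 F t D - itg 0 D (wave 1 F t)) = itg 0 D (wave 1 F t).
  have -> : Z0 * (D * K * expR (D * K * t)) = D * (K * (Z0 * expR (D * K * t))) by ring.
  by rewrite -reflection// /wave; ring.
apply: eq_derives => // s _; rewrite /wave_th; congr (_ - _).
by apply: eq_itg => x _; rewrite mulrC.
Qed.

Lemma wave_contH1 t : contH1 D (wave 1 F) (wave (- 1) f) t.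
Proof.
apply/cvg_in_time_le => e e0.
have e2 : 0 < e / 2 by rewrite divr_gt0.
have /contL2P/(_ _ e2)[d1 d10 H1] := wave_contL2 D_gt0 t lF p1.
have /contL2P/(_ _ e2)[d2 d20 H2] := wave_contL2 D_gt0 t lf n1.
exists (Num.min d1 d2); first by rewrite lt_min d10.
move=> s s0 _; rewrite lt_min => /andP[sd1 sd2].
rewrite subr0 ger0_norm ?sqrtr_ge0//.
rewrite -(ger0_norm (ltW e0)) -sqrtr_sqr ler_wsqrtr//.
have h1 := H1 s s0 sd1; have h2 := H2 s s0 sd2.
have sq n : 0 <= n -> n <= e / 2 -> n ^+ 2 <= e ^+ 2 / 4.
  move=> n0 ne; apply: (@le_trans _ _ ((e / 2) ^+ 2)).
    by rewrite ler_sqr ?nnegrE// ltW.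
  by rewrite expr_div_n le_eqVlt -natrX eqxx.
have := sq _ (normL2_ge0 _ _) h1; have := sq _ (normL2_ge0 _ _) h2.
have := sqr_ge0 e; lra.
Qed.

(** The boundary condition u(D) + c0 int u_t = K Z is the reflection
    condition on F, since int u_t = F(t + D) - F(t - D). *)
Lemma wave_solution :
  solution D c0 K (wave_th Z0 F f) (wave 1 F) (wave (- 1) f) (wave 1 f).
Proof.
split=> t t0.
  split.
  - exact/isH1P/wave_prim.
  - exact/isL2P/wave_locL2.
  - exact: derives_cvg (wave_th_derives t0).
  - exact: wave_contH1.
  - exact: wave_contL2.
split.
- exact: wave_th_derives.
- exact: wave_derives.
- by move=> psi dpsi /isH1P ppsi psiD; apply: wave_weak => //; exact: ppsi.
- exact: wave_feedback.
Qed.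

End Solution.

Lemma normH1_cvg (fs dfs : R -> R -> R) t :
  normL2 D (fs s) @[s --> in_time t] --> 0 ->
  normL2 D (dfs s) @[s --> in_time t] --> 0 ->
  normH1 D (fs s) (dfs s) @[s --> in_time t] --> 0.
Proof.
move=> h1 h2.
have h : normL2 D (fs s) * normL2 D (fs s) + normL2 D (dfs s) * normL2 D (dfs s)
    @[s --> in_time t] --> (0 * 0 + 0 * 0 : R).
  by apply: cvgD; apply: cvgM.
rewrite mulr0 addr0 in h.
have := cvg_comp _ _ h (@sqrt_continuous R 0); rewrite sqrtr0.
by apply: cvg_trans; apply: near_eq_cvg; apply: nearW => s; rewrite /normH1/= !expr2.
Qed.

(** One more derivative of the profile gives one more derivative in space and
    in time: u_t and u_x are themselves waves with profile f. *)
Lemma wave_classical Z0 F f (f' : R -> R) : primR F f -> primR f f' ->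
  (forall t, 0 <= t ->
    (1 + c0) * F (D + t) + (1 - c0) * F (- D + t) = K * (Z0 * expR (D * K * t))) ->
  classical_solution D c0 K (wave_th Z0 F f) (wave 1 F) (wave (- 1) f) (wave 1 f).
Proof.
move=> pF pf refl.
have n1 : `|- 1 : R| <= 1 by rewrite normrN normr1.
have p1 : `|1 : R| <= 1 by rewrite normr1.
exists (wave 1 f'), (wave (- 1) f') => t t0; split.
- split; last by apply/isH1P => //; exact: wave_prim.
  split; first by apply/isH1P => //; exact: wave_prim.
  apply/isH1P => //; have := wave_prim (- 1) t pf 0 D.
  by rewrite opprK.
- split; first exact: wave_th_derives.
    by apply: normH1_cvg; exact: wave_derives.
  exact: wave_derives.
- split; last by apply: wave_contL2 => //; exact: primR_locL2 pf.
  by apply: normH1_cvg; apply: wave_contL2 => //;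
    [exact: primR_locL2 pF|exact: primR_locL2 pf].
- by split; [rewrite /wave oppr0 mulN1r subrr|exact: wave_feedback].
Qed.

End ClosedLoopWaves.

(** * The reflection law at the actuated end *)

Section Oscillation.
Context {R : realType}.
Variables (D c0 K : R).
Hypotheses (D_gt0 : 0 < D) (c0_gt0 : 0 < c0) (c0_neq1 : c0 != 1).
Implicit Types (B t s x : R) (F f H h : R -> R).

Let a : R := D * K.

(** The factor by which the homogeneous reflection law
    (1 + c0) F(t + D) + (1 - c0) F(t - D) = 0 multiplies F over one round
    trip of length 2 D. *)
Definition refl_coef : R := - ((1 - c0) / (1 + c0)).

(** The symbol of the reflection law on exp(a s), which vanishes precisely
    when the forcing exp(a t) is resonant. *)
Definition resonance : R := (1 + c0) * expR (a * D) + (1 - c0) * expR (- (a * D)).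

Let r := refl_coef.

Let c1 : 1 + c0 != 0. Proof. by rewrite gt_eqF// addr_gt0. Qed.

Lemma refl_coef_neq0 : r != 0.
Proof. by rewrite oppr_eq0 mulf_neq0 ?invr_eq0// subr_eq0 eq_sym. Qed.

Lemma refl_coef_sqr_lt1 : r ^+ 2 < 1.
Proof.
rewrite sqrrN expr_div_n ltr_pdivrMr ?exprn_gt0 ?addr_gt0// mul1r.
by have := c0_gt0; rewrite !expr2; lra.
Qed.

(** The resonant rate solves exp(- 2 a D) = - (1 + c0) / (1 - c0), which for
    lambda = - a is the excluded value. It is real only if the right-hand
    side is positive, which is when the hypothesis applies. *)
Lemma resonance_neq0 (lambda : R) : lambda = - a ->
  (0 < - ((1 + c0) / (1 - c0)) ->
     lambda != (2 * D)^-1 * ln (- ((1 + c0) / (1 - c0)))) ->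
  resonance != 0.
Proof.
move=> la nres; apply/negP => /eqP den0.
have c1' : 1 - c0 != 0 by rewrite subr_eq0 eq_sym.
have E : - ((1 + c0) / (1 - c0)) = expR (- (2 * D * a)).
  have e0 : expR (a * D) != 0 by rewrite gt_eqF ?expR_gt0.
  have -> : expR (- (2 * D * a)) = expR (- (a * D)) / expR (a * D).
    by rewrite -expRN -expRD; congr expR; ring.
  apply: (mulIf e0); rewrite divfK//; apply: (mulIf c1').
  have -> : - ((1 + c0) / (1 - c0)) * expR (a * D) * (1 - c0) =
    - ((1 + c0) * expR (a * D)) by field.
  rewrite [RHS]mulrC; apply/eqP; rewrite eq_sym -addr_eq0 addrC.
  exact/eqP.
have := nres; rewrite E expR_gt0 expRK la => /(_ isT)/eqP; apply.
by field; rewrite gt_eqF.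
Qed.

(** The general solution of the forced reflection law: a multiple of exp(a s)
    absorbs the forcing, and what remains is quasi-periodic with factor r. It
    agrees with h on ]- D, D[. *)
Definition osc B h s : R :=
  B * expR (a * s) + qper D r (fun x => h x - B * expR (a * x)) s.

Lemma prim_exp B (p q : R) : prim p q (fun x => B * expR (a * x)) (fun x => a * B * expR (a * x)).
Proof.
apply: prim_C1 => x.
  have h : is_derive x (1 : R) (fun s => a * s) a.
    by apply: is_derive_eq; rewrite /GRing.scale/= mulr1.
  have h2 : is_derive x (1 : R) (fun s => expR (a * s)) (expR (a * x) * a).
    exact: (@is_derive1_comp _ expR (fun s => a * s)).
  have h3 : is_derive x (1 : R) (fun s => B * expR (a * s)) (B *: (expR (a * x) * a)).
    exact: is_deriveZ.
  by apply: (is_derive_eq h3); rewrite /GRing.scale/=; ring.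
apply: cvgM; first exact: cvg_cst.
apply: (cvg_comp (fun x => a * x) expR); last exact: continuous_expR.
by apply: cvgM; [exact: cvg_cst|exact: cvg_id].
Qed.

(** The reflection law at time zero is the matching condition, at the ends of
    the window, of what remains after the exponential is removed. *)
Lemma osc_match B h : (1 + c0) * h D + (1 - c0) * h (- D) = B * resonance ->
  h D - B * expR (a * D) = r * (h (- D) - B * expR (a * - D)).
Proof.
move=> hB; rewrite mulrN; apply: (mulfI c1).
rewrite /r /refl_coef /resonance in hB *.
have -> : (1 + c0) * (- ((1 - c0) / (1 + c0)) * (h (- D) - B * expR (- (a * D)))) =
  - (1 - c0) * (h (- D) - B * expR (- (a * D))) by field.
by move: hB; rewrite mulrDr; lra.
Qed.

Lemma osc_prim B H h : prim (- D) D H h ->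
  (1 + c0) * H D + (1 - c0) * H (- D) = B * resonance ->
  primR (osc B H) (osc (a * B) h).
Proof.
move=> pH HB p q; apply: primD; first exact: prim_exp.
apply: (prim_qper D_gt0 refl_coef_neq0); last exact: osc_match.
apply: primB pH _; exact: prim_exp.
Qed.

Lemma osc_reflection B h t :
  (1 + c0) * osc B h (D + t) + (1 - c0) * osc B h (- D + t) = B * resonance * expR (a * t).
Proof.
rewrite /osc; set k := fun x => _.
have -> : D + t = - D + t + 2 * D by ring.
rewrite (qper_shift D_gt0 refl_coef_neq0).
have -> : expR (a * (- D + t + 2 * D)) = expR (a * D) * expR (a * t).
  by rewrite -expRD; congr expR; ring.
have -> : expR (a * (- D + t)) = expR (- (a * D)) * expR (a * t).
  by rewrite -expRD; congr expR; ring.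
by rewrite /resonance /r /refl_coef; field; exact: c1.
Qed.

Lemma osc0 B h x : - D < x < D -> osc B h x = h x.
Proof. by move=> xD; rewrite /osc (qper0 _ D_gt0)// subrKC. Qed.

Lemma osc0_closed B h x : (1 + c0) * h D + (1 - c0) * h (- D) = B * resonance ->
  - D <= x <= D -> osc B h x = h x.
Proof.
move=> hB xD; rewrite /osc (qper0_closed D_gt0 refl_coef_neq0 (osc_match hB) xD).
by rewrite subrKC.
Qed.

End Oscillation.

(** * Exponential stability *)

Section Stability.
Context {R : realType}.
Variables (D c0 K : R).
Hypotheses (D_gt0 : 0 < D) (c0_gt0 : 0 < c0) (c0_neq1 : c0 != 1) (K_lt0 : K < 0).
Implicit Types (t s x : R) (F f H h k : R -> R).

Let a : R := D * K.
Let r := refl_coef c0.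

Let a_lt0 : a < 0. Proof. by rewrite /a pmulr_rlt0. Qed.

Let D2 : 0 < 2 * D. Proof. by rewrite mulr_gt0. Qed.

Let DD : - D <= D. Proof. by have := D_gt0; lra. Qed.

(** theta = th_gain Z + Q, with Q linear in u_x and v. *)
Definition th_gain : R := 1 - D ^+ 2 * c0 * K.

(** A constant with Q^2 <= th_defect (|u_x|^2 + |v|^2), from Cauchy-Schwarz
    applied to the three terms of Q. *)
Definition th_defect : R := 3 * (D ^+ 4 * c0 ^+ 4 * itg 0 D (fun=> 1 ^+ 2 : R) +
  D ^+ 2 * c0 ^+ 2 * itg 0 D (fun x => x ^+ 2) + itg 0 D (fun x => g D x ^+ 2)).

Lemma th_gain_ge1 : 1 <= th_gain.
Proof.
by rewrite /th_gain lerDl oppr_ge0 nmulr_lle0// mulr_ge0 ?exprn_ge0 ?ltW.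
Qed.

Lemma th_defect_ge0 : 0 <= th_defect.
Proof.
have i0 (q : R -> R) : 0 <= itg 0 D (fun x => q x ^+ 2).
  by apply: itg_ge0 => x _; exact: sqr_ge0.
by rewrite mulr_ge0// !addr_ge0 ?mulr_ge0 ?exprn_ge0 ?i0 ?ltW.
Qed.

(** The trace u(D) is eliminated by the feedback law and int u by the trace:
    th - q Z, with q >= 1 since K < 0, is a combination of int v, int x u_x and
    int g v. Thus theta and Z control each other up to the wave energy. *)
Lemma th_Z_bounds (th Z : R) (u ux v : R -> R) : prim 0 D u ux -> L2 0 D v ->
  u D = K * Z - c0 * itg 0 D v ->
  th = Z - D * c0 * itg 0 D u - itg 0 D (fun x => g D x * v x) ->
  (Z ^+ 2 <= 2 * th ^+ 2 + 2 * th_defect * (normL2 D ux ^+ 2 + normL2 D v ^+ 2)) /\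
  (th ^+ 2 <= 2 * th_gain ^+ 2 * Z ^+ 2 +
     2 * th_defect * (normL2 D ux ^+ 2 + normL2 D v ^+ 2)).
Proof.
move=> pu lv uD thE.
set nu := normL2 D ux ^+ 2; set nv := normL2 D v ^+ 2.
pose V := itg 0 D (fun x => 1 * v x).
pose X := itg 0 D (fun x => ux x * x).
pose G := itg 0 D (fun x => g D x * v x).
have VE : itg 0 D v = V by apply: eq_itg => x _; rewrite mul1r.
have lg := prim_L2F (prim_g D).
have Vle : V ^+ 2 <= itg 0 D (fun=> 1 ^+ 2) * nv.
  by rewrite /nv sqr_normL2; exact: cauchy_schwarz (L2_cst 0 D 1) lv.
have Gle : G ^+ 2 <= itg 0 D (fun x => g D x ^+ 2) * nv.
  by rewrite /nv sqr_normL2; exact: cauchy_schwarz lg lv.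
have Xle : X ^+ 2 <= nu * itg 0 D (fun x => x ^+ 2).
  rewrite /nu sqr_normL2; apply: cauchy_schwarz (prim_L2 pu) _.
  exact: prim_L2F (prim_id 0 D).
pose Q := D ^+ 2 * c0 ^+ 2 * V + D * c0 * X - G.
have thQ : th = th_gain * Z + Q.
  rewrite thE /Q /th_gain -/G.
  have : X = D * u D - itg 0 D u by exact: itg_deriv_id.
  by rewrite uD VE => ->; ring.
have nu0 : 0 <= nu by exact: sqr_ge0.
have nv0 : 0 <= nv by exact: sqr_ge0.
have Qle : Q ^+ 2 <= th_defect * (nu + nv).
  have c1 : 0 <= D ^+ 4 * c0 ^+ 4 by rewrite mulr_ge0 ?exprn_ge0 ?ltW.
  have c2 : 0 <= D ^+ 2 * c0 ^+ 2 by rewrite mulr_ge0 ?exprn_ge0 ?ltW.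
  have i0 (q : R -> R) : 0 <= itg 0 D (fun x => q x ^+ 2).
    by apply: itg_ge0 => x _; exact: sqr_ge0.
  apply: (@le_trans _ _ (3 * (D ^+ 4 * c0 ^+ 4 * V ^+ 2 + D ^+ 2 * c0 ^+ 2 * X ^+ 2 + G ^+ 2))).
    pose p1 := D ^+ 2 * c0 ^+ 2 * V; pose p2 := D * c0 * X.
    have -> : D ^+ 4 * c0 ^+ 4 * V ^+ 2 = p1 ^+ 2 by rewrite /p1; ring.
    have -> : D ^+ 2 * c0 ^+ 2 * X ^+ 2 = p2 ^+ 2 by rewrite /p2; ring.
    rewrite /Q -/p1 -/p2.
    have := sqr_ge0 (p1 - p2); have := sqr_ge0 (p1 + G); have := sqr_ge0 (p2 + G).
    rewrite !expr2; lra.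
  rewrite /th_defect -[leRHS]mulrA ler_wpM2l//.
  set I1 := itg 0 D (fun=> 1 ^+ 2) in Vle *.
  set I2 := itg 0 D (fun x => x ^+ 2) in Xle *.
  set I3 := itg 0 D (fun x => g D x ^+ 2) in Gle *.
  have -> : (D ^+ 4 * c0 ^+ 4 * I1 + D ^+ 2 * c0 ^+ 2 * I2 + I3) * (nu + nv) =
    (D ^+ 4 * c0 ^+ 4 * (I1 * nv) + D ^+ 2 * c0 ^+ 2 * (nu * I2) + I3 * nv) +
    (D ^+ 4 * c0 ^+ 4 * (I1 * nu) + D ^+ 2 * c0 ^+ 2 * (I2 * nv) + I3 * nu) by ring.
  have rest : 0 <= D ^+ 4 * c0 ^+ 4 * (I1 * nu) + D ^+ 2 * c0 ^+ 2 * (I2 * nv) + I3 * nu.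
    have h1 := mulr_ge0 c1 (mulr_ge0 (i0 (fun=> 1)) nu0).
    have h2 := mulr_ge0 c2 (mulr_ge0 (i0 (fun x => x)) nv0).
    have h3 := mulr_ge0 (i0 (g D)) nu0.
    exact: addr_ge0 (addr_ge0 h1 h2) h3.
  have := ler_wpM2l c1 Vle; have := ler_wpM2l c2 Xle; lra.
have q1 := th_gain_ge1.
split.
  apply: (@le_trans _ _ ((th_gain * Z) ^+ 2)).
    rewrite exprMn ler_peMl ?sqr_ge0//; exact: exprn_ege1.
  have -> : th_gain * Z = th - Q by rewrite thQ; ring.
  have := sqr_ge0 (th + Q); rewrite !expr2 in Qle *; lra.
rewrite thQ -mulrA -exprMn.
have := sqr_ge0 (th_gain * Z - Q); rewrite !expr2 in Qle *; lra.
Qed.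

(** The rate for which one round trip 2 D costs the factor r^2. *)
Definition decay_rate : R := - ln (r ^+ 2) / (2 * D).

Let r2_gt0 : 0 < r ^+ 2.
Proof. by rewrite lt_neqAle sqr_ge0 eq_sym sqrf_eq0 refl_coef_neq0. Qed.

Lemma decay_rate_gt0 : 0 < decay_rate.
Proof.
rewrite divr_gt0// oppr_gt0 ln_lt0// r2_gt0/=.
exact: refl_coef_sqr_lt1.
Qed.

Lemma expR_decay_rate t : expR (- decay_rate * (t + 2 * D)) = r ^+ 2 * expR (- decay_rate * t).
Proof.
have -> : - decay_rate * (t + 2 * D) = ln (r ^+ 2) + - decay_rate * t.
  by rewrite /decay_rate; field; rewrite gt_eqF.
by rewrite expRD lnK// posrE.
Qed.

Definition window k t : R := itg (- D) D (fun x => k (x + t) ^+ 2).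

Lemma window_ge0 k t : 0 <= window k t.
Proof. by apply: itg_ge0 => x _; exact: sqr_ge0. Qed.

Lemma windowE k t : locL2 k -> window k t = itg (- D + t) (D + t) (fun x => k x ^+ 2).
Proof.
move=> lk; rewrite /window (@itg_shift _ _ _ t (fun x => k x ^+ 2))//.
exact: L2_sqr.
Qed.

(** Over one round trip the window is multiplied by r^2; within a round trip
    it is covered by the initial window and the next one, whence 1 + r^2. The
    division by r^2 pays for the incomplete last round trip. *)
Lemma window_decay k t : locL2 k -> (forall s, k (s + 2 * D) = r * k s) -> 0 <= t ->
  window k t <= (1 + r ^+ 2) / r ^+ 2 * expR (- decay_rate * t) * window k 0.
Proof.
move=> lk kr.
have wS s : window k (s + 2 * D) = r ^+ 2 * window k s.
  rewrite /window -itgZ; last first.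
    by apply: L2_sqr; exact: (locL2_shift s lk).
  by apply: eq_itg => x _; rewrite addrA kr exprMn.
have l1 b c : L1 b c (fun x => k x ^+ 2) by exact: L2_sqr.
have base s : 0 <= s -> s <= 2 * D -> window k s <= (1 + r ^+ 2) * window k 0.
  move=> s0 sD; rewrite mulrDl mul1r -wS add0r !windowE// !addr0.
  rewrite -[leRHS](_ : itg (- D) (D + 2 * D) (fun x => k x ^+ 2) = _); last first.
    rewrite (@itg_cat _ _ D)//; last by have := D_gt0; lra.
    have -> : - D + 2 * D = D by ring.
    by [].
  rewrite (@itg_cat _ (- D) (- D + s) (D + 2 * D))//; [|lra..].
  rewrite (@itg_cat _ (- D + s) (D + s) (D + 2 * D))//; [|by have := D_gt0; lra..].
  have p1 b c : 0 <= itg b c (fun x => k x ^+ 2).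
    by apply: itg_ge0 => x _; exact: sqr_ge0.
  by have := p1 (- D) (- D + s); have := p1 (D + s) (D + 2 * D); lra.
have r2 := r2_gt0.
have w0 := window_ge0 k 0.
have ind n : forall s, 0 <= s -> s <= 2 * D * n.+1%:R ->
    window k s <= (1 + r ^+ 2) / r ^+ 2 * expR (- decay_rate * s) * window k 0.
  elim: n => [|n IH] s s0 sn.
    have {}sn : s <= 2 * D by rewrite mulr1 in sn.
    apply: le_trans (base s s0 sn) _; rewrite ler_wpM2r//.
    rewrite -mulrA ler_peMr//; first by rewrite addr_ge0// ltW.
    rewrite -(ler_pM2l r2) mulr1 mulrA mulfV ?gt_eqF// mul1r.
    have := expR_decay_rate 0; rewrite mulr0 expR0 mulr1 add0r => <-.
    by rewrite ler_expR !mulNr lerN2 ler_wpM2l// ltW// decay_rate_gt0.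
  have [s2|s2] := leP s (2 * D).
    apply: IH => //; apply: le_trans s2 _.
    by rewrite ler_peMr ?(ltW D2)// ler1n.
  have -> : s = (s - 2 * D) + 2 * D by ring.
  rewrite wS expR_decay_rate.
  have sD : 0 <= s - 2 * D by rewrite subr_ge0 ltW.
  have sDn : s - 2 * D <= 2 * D * n.+1%:R.
    by move: sn; rewrite -[n.+2%:R]natr1; lra.
  apply: le_trans (ler_wpM2l (ltW r2) (IH _ sD sDn)) _.
  by rewrite le_eqVlt; apply/orP; left; apply/eqP; ring.
move=> t0; apply: (ind (Num.trunc `|t / (2 * D)|)) => //.
rewrite mulrC -ler_pdivrMr//; apply: ltW.
exact: le_lt_trans (ler_norm _) (truncnS_gt _).
Qed.

(** The exponential is bounded on the window by its value at the left end,
    as a < 0. *)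
Definition forcing_gain : R :=
  (a * (K / resonance D c0 K)) ^+ 2 * expR (- (2 * a * D)) * (2 * D).

Lemma forcing_gain_ge0 : 0 <= forcing_gain.
Proof. exact: mulr_ge0 (mulr_ge0 (sqr_ge0 _) (expR_ge0 _)) (ltW D2). Qed.

Lemma forcing_window Z0 t : window (fun s => a * (K * Z0 / resonance D c0 K) * expR (a * s)) t <=
  forcing_gain * Z0 ^+ 2 * expR (2 * a * t).
Proof.
set B := a * _; pose M := B ^+ 2 * expR (- (2 * a * D)) * expR (2 * a * t).
have -> : forcing_gain * Z0 ^+ 2 * expR (2 * a * t) = M * (D - - D).
  by rewrite /M /B /forcing_gain; ring.
rewrite -(itg_cst M DD); apply: le_itg; last first.
- move=> x /andP[Dx _].
  rewrite exprMn /M -mulrA ler_wpM2l ?sqr_ge0// -expRD expr2 -expRD ler_expR.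
  have := a_lt0; move: Dx; rewrite -subr_ge0 opprK => Dx ha.
  by have := mulr_le0_ge0 (ltW ha) Dx; lra.
- exact: L1_cst.
- apply: L2_sqr.
  exact: (prim_L2F (@prim_shift _ _ _ t _ _ (prim_exp D K B _ _))).
Qed.

(** The constant is assembled along the chain: initial state to Z0 (C3),
    Z0 to the exponential part, and both to the quasi-periodic part and so
    to the wave energy (C4), and finally back to theta. *)
Definition overshoot : R :=
  let C3 := 2 + 2 * th_defect in
  let C := (1 + r ^+ 2) / r ^+ 2 in
  let C4 := 4 * forcing_gain * C3 + 4 * C * (1 + 2 * forcing_gain * C3) in
  2 * th_gain ^+ 2 * C3 + (1 + 2 * th_defect) * C4.

(** The derivative f of the profile is a multiple of exp(a s) plus a
    quasi-periodic part. The first is controlled by Z0, and Z0 by the initial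
    state; the second decays over each round trip. The wave energy is the
    energy of f over the moving window, and theta is recovered from Z and the
    wave energy. *)
Lemma wave_stability Z0 F h t :
  let f := osc D c0 K (a * (K * Z0 / resonance D c0 K)) h in
  primR F f ->
  (forall t, 0 <= t ->
    (1 + c0) * F (D + t) + (1 - c0) * F (- D + t) = K * (Z0 * expR (D * K * t))) ->
  0 <= t ->
  Omega D (wave_th D c0 K Z0 F f t) (wave (- 1) f t) (wave 1 f t) <=
  overshoot * Omega D (wave_th D c0 K Z0 F f 0) (wave (- 1) f 0) (wave 1 f 0) *
    expR (- Num.min decay_rate (- (2 * a)) * t).
Proof.
move=> f pF refl t0; set B := a * _ in f pF *.
have lf := primR_locL2 pF.
pose e s := B * expR (a * s).
pose k := qper D r (fun x => h x - B * expR (a * x)).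
have fE s : f s = e s + k s by [].
have le : locL2 e by move=> b c; exact: prim_L2F (prim_exp D K B _ _).
have lk : locL2 k.
  move=> b c; apply: (@eq_L2 _ _ _ (fun s => f s - e s)); last exact: L2B.
  by move=> s _; rewrite fE; ring.
have kr s : k (s + 2 * D) = r * k s by exact: (qper_shift D_gt0 (refl_coef_neq0 c0_gt0 c0_neq1)).
have sqD (p q w : R -> R) s : locL2 p -> locL2 q -> locL2 w ->
    (forall x, p x ^+ 2 <= 2 * q x ^+ 2 + 2 * w x ^+ 2) ->
    window p s <= 2 * window q s + 2 * window w s.
  move=> lp lq lw pqw.
  have l2 (z : R -> R) : locL2 z -> L1 (- D) D (fun x => z (x + s) ^+ 2).
    by move=> lz; apply: L2_sqr; exact: locL2_shift.
  rewrite /window -(itgZ _ (l2 _ lq)) -(itgZ _ (l2 _ lw)).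
  rewrite -(itgD (L1Z _ (l2 _ lq)) (L1Z _ (l2 _ lw))).
  by apply: le_itg; [exact: l2|apply: L1D; exact/L1Z/l2|move=> x _; exact: pqw].
have w1 s : window f s <= 2 * window e s + 2 * window k s.
  apply: sqD => // x; rewrite fE; have := sqr_ge0 (e x - k x); rewrite !expr2; lra.
have w2 s : window k s <= 2 * window f s + 2 * window e s.
  apply: sqD => // x; rewrite fE; have := sqr_ge0 (e x + k x + e x); rewrite !expr2; lra.
pose aug s := Omega D (wave_th D c0 K Z0 F f s) (wave (- 1) f s) (wave 1 f s).
have [th [nrg [augE bounds nrgE nrg0]]] : exists th nrg : R -> R,
   [/\ forall s, aug s = th s ^+ 2 + nrg s,
       forall s, 0 <= s ->
         ((Z0 * expR (a * s)) ^+ 2 <= 2 * th s ^+ 2 + 2 * th_defect * nrg s) /\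
         (th s ^+ 2 <= 2 * th_gain ^+ 2 * (Z0 * expR (a * s)) ^+ 2 +
            2 * th_defect * nrg s),
       forall s, nrg s = 2 * window f s & forall s, 0 <= nrg s].
  exists (wave_th D c0 K Z0 F f).
  exists (fun s => normL2 D (wave (- 1) f s) ^+ 2 + normL2 D (wave 1 f s) ^+ 2).
  split=> [s|s s0|s|s].
  - by rewrite /aug /Omega addrA.
  - apply: (th_Z_bounds (wave_prim 1 s pF 0 D)) => //.
      exact: wave_locL2.
    by rewrite (wave_itg D_gt0 s pF); have := refl s s0; rewrite /wave -/a; lra.
  - exact: wave_energy.
  - by rewrite addr_ge0 ?sqr_ge0.
have eq_le (y z : R) : y = z -> y <= z by move->.
set E := expR (- Num.min _ _ * t).
suff main : th t ^+ 2 + nrg t <= overshoot * (th 0 ^+ 2 + nrg 0) * E.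
  apply: le_trans (eq_le _ _ (augE t)) (le_trans main (eq_le _ _ _)).
  exact: (congr1 (fun z => overshoot * z * E) (esym (augE 0))).
set Om := th 0 ^+ 2 + nrg 0.
have th00 := sqr_ge0 (th 0).
have n0 := nrg0 0.
have Om0 : 0 <= Om by rewrite addr_ge0.
have df0 := th_defect_ge0.
pose C3 := 2 + 2 * th_defect.
have Z0le : Z0 ^+ 2 <= C3 * Om.
  have [+ _] := bounds 0 (lexx 0); rewrite mulr0 expR0 mulr1.
  move=> /le_trans; apply; rewrite /C3 /Om.
  have := mulr_ge0 df0 th00; lra.
have E0 : 0 < E by exact: expR_gt0.
have Ea : expR (2 * a * t) <= E.
  rewrite ler_expR ler_wpM2r// lerNr ge_min; apply/orP; right.
  exact: lexx.
have Er : expR (- decay_rate * t) <= E.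
  by rewrite ler_expR ler_wpM2r// lerN2 ge_min lexx.
pose C : R := (1 + r ^+ 2) / r ^+ 2.
have C_ge0 : 0 <= C by rewrite divr_ge0 ?addr_ge0 ?ltW.
have cA0 := forcing_gain_ge0.
have C30 : 0 <= C3 by rewrite /C3; lra.
pose W := E * Om.
have W0 : 0 <= W by rewrite mulr_ge0// ltW.
have ZE : (Z0 * expR (a * t)) ^+ 2 <= C3 * W.
  have -> : C3 * W = (C3 * Om) * E by rewrite /W; ring.
  have -> : (Z0 * expR (a * t)) ^+ 2 = Z0 ^+ 2 * expR (2 * a * t).
    by rewrite exprMn expr2 expr2 -expRD; congr (_ * expR _); ring.
  exact: ler_pM (sqr_ge0 _) (expR_ge0 _) Z0le Ea.
have et : window e t <= forcing_gain * (C3 * W).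
  apply: le_trans (forcing_window Z0 t) _; rewrite -mulrA ler_wpM2l//.
  apply: le_trans ZE; rewrite le_eqVlt; apply/orP; left; apply/eqP.
  by rewrite exprMn [in RHS]expr2 [in RHS]expr2 -expRD expr2; congr (_ * expR _); ring.
have e0 : window e 0 <= forcing_gain * (C3 * Om).
  apply: le_trans (forcing_window Z0 0) _; rewrite mulr0 expR0 mulr1.
  by rewrite ler_wpM2l.
have k0 : window k 0 <= (1 + 2 * forcing_gain * C3) * Om.
  have nOm : nrg 0 <= Om by rewrite /Om lerDr.
  have -> : (1 + 2 * forcing_gain * C3) * Om = Om + 2 * (forcing_gain * (C3 * Om)) by ring.
  by move: (w2 0) nOm e0; rewrite -nrgE; clear; lra.
have kt : window k t <= C * (1 + 2 * forcing_gain * C3) * W.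
  apply: le_trans (window_decay lk kr t0) _; rewrite -/C.
  have -> : C * (1 + 2 * forcing_gain * C3) * W =
    C * E * ((1 + 2 * forcing_gain * C3) * Om) by rewrite /W; ring.
  apply: ler_pM => //; [by rewrite mulr_ge0 ?expR_ge0|exact: window_ge0|].
  by rewrite ler_wpM2l.
pose C4 := 4 * forcing_gain * C3 + 4 * C * (1 + 2 * forcing_gain * C3).
have nt : nrg t <= C4 * W.
  rewrite nrgE; move: (w1 t) kt et.
  have -> : C4 * W = 4 * (forcing_gain * (C3 * W)) +
    4 * (C * (1 + 2 * forcing_gain * C3) * W) by rewrite /C4; ring.
  by clear; lra.
have tt : th t ^+ 2 <= 2 * th_gain ^+ 2 * (C3 * W) + 2 * th_defect * (C4 * W).
  have [_ ht] := bounds t t0; apply: le_trans ht _; apply: lerD.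
    by rewrite ler_wpM2l// mulr_ge0// sqr_ge0.
  by rewrite ler_wpM2l// mulr_ge0.
rewrite -/overshoot.
have -> : overshoot * Om * E = (2 * th_gain ^+ 2 * (C3 * W) + 2 * th_defect * (C4 * W)) + C4 * W.
  by rewrite /overshoot -/C -/C3 -/C4 /W; ring.
exact: lerD.
Qed.

Lemma overshoot_gt0 : 0 < overshoot.
Proof.
rewrite /overshoot; have df0 := th_defect_ge0; have cA0 := forcing_gain_ge0.
have q0 : 0 < th_gain ^+ 2 by rewrite exprn_gt0// (lt_le_trans ltr01)// th_gain_ge1.
have C_ge0 : 0 <= (1 + r ^+ 2) / r ^+ 2 by rewrite divr_ge0 ?addr_ge0 ?ltW.
have C30 : 0 < 2 + 2 * th_defect by lra.
have C30' := ltW C30.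
apply: ltr_pwDl; first exact: mulr_gt0 (mulr_gt0 _ q0) C30.
have fC := mulr_ge0 cA0 C30'.
apply: mulr_ge0; first by lra.
apply: addr_ge0; first by rewrite -mulrA mulr_ge0.
rewrite -mulrA; apply: mulr_ge0 => //; apply: mulr_ge0 => //.
by rewrite -mulrA; lra.
Qed.

End Stability.

(** * Initial data *)

Section InitialData.
Context {R : realType}.
Variables (D c0 K : R).
Hypotheses (D_gt0 : 0 < D) (c0_gt0 : 0 < c0) (c0_neq1 : c0 != 1).
Hypothesis res : resonance D c0 K != 0.
Variables (th0 : R) (u0 u0x v0 : R -> R).
Hypotheses (pu0 : prim 0 D u0 u0x) (lv0 : L2 0 D v0).
Hypothesis bc0 : u0 D = feedback D c0 K th0 u0 v0.

Let a : R := D * K.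
Let Z0 : R := Zstate D c0 th0 u0 v0.
Let B : R := K * Z0 / resonance D c0 K.
Let V x : R := itg 0 x v0.

Let pV : prim 0 D V v0. Proof. exact: prim_itg. Qed.

(** The profile of d'Alembert: F(x) + F(- x) = u0(x), while F(x) - F(- x) has
    derivative v0 and vanishes at 0, hence is int_0^x v0. *)
Definition init_profile : R -> R :=
  glue (fun x => 2^-1 * (u0 x + V x)) (fun x => 2^-1 * (u0 x - V x)).

Definition init_dprofile : R -> R :=
  glue (fun x => 2^-1 * (u0x x + v0 x)) (fun x => - (2^-1 * (u0x x - v0 x))).

Lemma glue_pos (P M : R -> R) (x : R) : 0 <= x -> glue P M x = P x.
Proof. by move=> x0; rewrite /glue ltNge x0. Qed.

Lemma glue_neg (P M : R -> R) (x : R) : 0 < x -> glue P M (- x) = M x.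
Proof. by move=> x0; rewrite /glue oppr_lt0 x0 opprK. Qed.

Lemma init_profile_prim : prim (- D) D init_profile init_dprofile.
Proof.
apply: glue_prim => //; [exact/primZ/primD|exact/primZ/primB|].
by rewrite /V itg_point addr0 subr0.
Qed.

Lemma amplitudeE : B * resonance D c0 K = K * Z0. Proof. by rewrite /B divfK. Qed.

(** The feedback law satisfied by the data says that the profile matches
    across the joints of its quasi-periodic part. *)
Lemma init_profile_match : (1 + c0) * init_profile D + (1 - c0) * init_profile (- D) = B * resonance D c0 K.
Proof.
rewrite amplitudeE /init_profile glue_pos ?ltW// glue_neg//.
have -> : K * Z0 = u0 D + c0 * V D by rewrite bc0 /feedback -/Z0 intDE /V; ring.
by field.
Qed.

Definition global_profile : R -> R := osc D c0 K B init_profile.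
Definition global_dprofile : R -> R := osc D c0 K (a * B) init_dprofile.

Lemma global_profile_prim : primR global_profile global_dprofile.
Proof. exact: (osc_prim D_gt0 c0_gt0 c0_neq1 init_profile_prim init_profile_match). Qed.

Lemma global_profile_reflection t :
  (1 + c0) * global_profile (D + t) + (1 - c0) * global_profile (- D + t) = K * (Z0 * expR (D * K * t)).
Proof. by rewrite (osc_reflection K D_gt0 c0_gt0 c0_neq1) amplitudeE mulrA. Qed.

Lemma global_profile_start x : 0 <= x <= D -> wave 1 global_profile 0 x = u0 x.
Proof.
move=> /andP[x0 xD]; have oE := osc0_closed D_gt0 c0_gt0 c0_neq1 init_profile_match.
rewrite /wave !addr0 mul1r /global_profile !oE; try by apply/andP; split; lra.
move: x0; rewrite le_eqVlt => /predU1P[<-|x0].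
  by rewrite oppr0 /init_profile !glue_pos// /V itg_point; field.
by rewrite /init_profile glue_neg// glue_pos ?ltW//; field.
Qed.

Lemma global_dprofile_start x : 0 < x < D -> wave 1 global_dprofile 0 x = v0 x.
Proof.
move=> /andP[x0 xD].
rewrite /wave !addr0 mul1r /global_dprofile !osc0//; try by apply/andP; split; lra.
by rewrite /init_dprofile glue_neg// glue_pos ?ltW//; field.
Qed.

Lemma global_th_start : wave_th D c0 K Z0 global_profile global_dprofile 0 = th0.
Proof.
rewrite /wave_th mulr0 expR0 mulr1 (@eq_itg _ _ _ (wave 1 global_profile 0) u0); last first.
  exact: global_profile_start.
rewrite (@eq_oo_itg _ _ _ (fun x => g D x * wave 1 global_dprofile 0 x)
  (fun x => g D x * v0 x)); last 2 first.
- by move=> x xD; rewrite global_dprofile_start.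
- apply: L2M; first exact: prim_L2F (prim_g D).
  exact: (wave_locL2 1 0 (primR_locL2 global_profile_prim)).
by rewrite /Z0 /Zstate derive1_g !intDE; ring.
Qed.

Lemma global_starts_at : starts_at D (wave_th D c0 K Z0 global_profile global_dprofile) (wave 1 global_profile)
  (wave 1 global_dprofile) th0 u0 v0.
Proof.
split; first exact: global_th_start.
  by move=> x; rewrite in_itv/=; exact: global_profile_start.
by apply: eq_oo_ae; exact: global_dprofile_start.
Qed.

(** The second compatibility condition is the matching condition for the
    derivative of the profile: the time derivative of Z at 0 is D K Z0. *)
Lemma global_dprofile_prim u0xx v0x : prim 0 D u0x u0xx -> prim 0 D v0 v0x -> u0x 0 = 0 ->
  v0 D = feedback D c0 K (intD D u0) v0 u0xx ->
  exists f', primR global_dprofile f'.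
Proof.
move=> pux pv ux0 vD.
have pd : prim (- D) D init_dprofile
    (glue (fun x => 2^-1 * (u0xx x + v0x x)) (fun x => - - (2^-1 * (u0xx x - v0x x)))).
  apply: (@glue_prim _ _ D_gt0 _ _ _ (fun x => - (2^-1 * (u0xx x - v0x x)))).
  - exact/primZ/primD.
  - exact/primN/primZ/primB.
  - by rewrite ux0; ring.
have iuxx : itg 0 D u0xx = u0x D.
  by case: pux => _ <- //; [rewrite ux0 subr0|exact: ltW].
have iguxx : itg 0 D (fun x => g D x * u0xx x) = D * u0 D - itg 0 D u0.
  rewrite -(itg_deriv_id D_gt0 pu0).
  have := itg_by_parts (ltW D_gt0) pux (prim_g D); rewrite g_end ux0 mulr0 mul0r subrr.
  rewrite (@eq_itg _ _ _ (fun x => u0x x * - x) (fun x => - (u0x x * x))); last first.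
    by move=> x _; rewrite mulrN.
  rewrite itgN; last exact: L2M (prim_L2 pu0) (prim_L2F (prim_id _ _)).
  rewrite (@eq_itg _ _ _ (fun x => u0xx x * g D x) (fun x => g D x * u0xx x)); last first.
    by move=> x _; rewrite mulrC.
  by move/eqP; rewrite addrC subr_eq0 => /eqP.
have pm : (1 + c0) * init_dprofile D + (1 - c0) * init_dprofile (- D) = a * B * resonance D c0 K.
  rewrite -mulrA amplitudeE /init_dprofile glue_pos ?ltW// glue_neg//.
  have KZ : K * Z0 = u0 D + c0 * itg 0 D v0 by rewrite bc0 /feedback -/Z0 intDE; ring.
  have : v0 D = D * K * (K * Z0) - c0 * u0x D.
    rewrite vD /feedback /Zstate derive1_g !intDE iuxx iguxx KZ; ring.
  by rewrite /a => ->; field.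
by have := osc_prim D_gt0 c0_gt0 c0_neq1 pd pm; eexists; eassumption.
Qed.

End InitialData.

(** * Well-posedness and stability *)

Theorem lemma2 (R : realType) (D c0 K : R) :
  0 < D -> 0 < c0 -> c0 != 1 -> K < 0 ->
  let lambda := derive1 (g D) D * K in
  0 < lambda ->
  (0 < - ((1 + c0) / (1 - c0)) ->
     lambda != (2 * D)^-1 * ln (- ((1 + c0) / (1 - c0)))) ->
  exists kappa rho : R, [/\ 0 < kappa, 0 < rho &
    forall (th0 : R) (u0 u0x v0 : R -> R),
      isH1 D u0 u0x -> isL2 D v0 ->
      u0 D = feedback D c0 K th0 u0 v0 ->
      exists (th : R -> R) (u ux v : R -> R -> R),
        [/\ solution D c0 K th u ux v /\ starts_at D th u v th0 u0 v0,
            forall (th' : R -> R) (u' ux' v' : R -> R -> R),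
              solution D c0 K th' u' ux' v' ->
              starts_at D th' u' v' th0 u0 v0 ->
              forall t, 0 <= t ->
                [/\ th' t = th t, {in `[0, D], u' t =1 u t} &
                    {ae lebesgue_measure, forall x : R,
                   x \in `[0, D] -> v' t x = v t x}],
            forall t, 0 <= t ->
              Omega D (th t) (ux t) (v t) <=
                kappa * Omega D (th 0) (ux 0) (v 0) * expR (- rho * t) &
            compatible D c0 K th0 u0 v0 ->
              classical_solution D c0 K th u ux v]].
Proof.
move=> D0 c00 c01 K0 lambda _ nres.
have res : resonance D c0 K != 0.
  apply: (@resonance_neq0 _ D c0 K _ _ lambda _ nres) => //.
  by rewrite /lambda derive1_g mulNr.
exists (overshoot D c0 K), (Num.min (decay_rate D c0) (- (2 * (D * K)))); split.
- exact: overshoot_gt0.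
- rewrite lt_min decay_rate_gt0//= oppr_gt0 pmulr_rlt0// pmulr_rlt0//.
move=> th0 u0 u0x v0 /(isH1P _ _ D0) pu0 /isL2P lv0 bc0.
(* A classical solution needs the representative of the derivative of u0 that
   the compatibility condition provides. *)
have [w [pw wcompat]] : exists w, prim 0 D u0 w /\ (compatible D c0 K th0 u0 v0 ->
    exists u0xx v0x, [/\ prim 0 D w u0xx, prim 0 D v0 v0x, w 0 = 0 &
      v0 D = feedback D c0 K (intD D u0) v0 u0xx]).
  have [[w [u0xx [v0x [[/(isH1P _ _ D0) pu /(isH1P _ _ D0) pux]]]]]|nc] :=
      pselect (compatible D c0 K th0 u0 v0).
    move=> /(isH1P _ _ D0) pv w0 _ vD; exists w; split => // _.
    by exists u0xx, v0x.
  by exists u0x; split.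
pose Z0 := Zstate D c0 th0 u0 v0.
pose F := global_profile D c0 K th0 u0 v0.
pose f := global_dprofile D c0 K th0 u0 w v0.
have pF : primR F f by exact: (global_profile_prim D0 c00 c01 res pw lv0 bc0).
have refl t : 0 <= t ->
    (1 + c0) * F (D + t) + (1 - c0) * F (- D + t) = K * (Z0 * expR (D * K * t)).
  by move=> _; exact: global_profile_reflection.
have sol := wave_solution D0 pF refl.
have start : starts_at D (wave_th D c0 K Z0 F f) (wave 1 F) (wave 1 f) th0 u0 v0.
  exact: (global_starts_at D0 c00 c01 res pw lv0 bc0).
exists (wave_th D c0 K Z0 F f), (wave 1 F), (wave (- 1) f), (wave 1 f); split.
- by split.
- move=> th' u' ux' v' sol' [th'0 u'0 v'0] t t0.
  have [thZ uZ vZ] := start.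
  have ws := weak_solution_sub (solution_weak D0 sol') (solution_weak D0 sol).
  have [||| h1 h2 h3] := weak_solution_zero D0 c00 ws _ _ _ t0.
  + by rewrite th'0 thZ subrr.
  + by move=> x xD; rewrite u'0 ?uZ ?subrr// in_itv.
  + apply: (@filterS2 _ _ (ae_filter_ringOfSetsType _) _ _ _ _ v'0 vZ) => x h1 h2 xD.
    by rewrite h1// h2// subrr.
  split.
  + exact: subr0_eq h1.
  + by move=> x; rewrite in_itv/= => /h2; exact: subr0_eq.
  + apply: (@filterS _ _ (ae_filter_ringOfSetsType _) _ _ _ h3) => x h xD.
    by apply: subr0_eq; exact: h.
- by move=> t t0; exact: wave_stability.
- move=> /wcompat[u0xx [v0x [pux pv w0 vD]]].
  have [f' pf] := global_dprofile_prim D0 c00 c01 res pw bc0 pux pv w0 vD.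
  exact: (wave_classical D0 pF pf refl).
Qed.
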